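(* Let $n\ge 2$ and let $q$ be a complex number such that $q\neq 0$ and $q$ is not a $k$-th root of unity with $1\le k\le n$. Let $\lambda_1,{}^t\lambda_1,\lambda_2,{}^t\lambda_2,\ldots,\lambda_p,{}^t\lambda_p$ be the non-self-conjugate Young diagrams and $\lambda_{p+1},\lambda_{p+2},\ldots,\lambda_{p+r}$ the self-conjugate Young diagrams in $\Lambda_n$. Then the representations $$\tilde\pi_{\lambda_1},\tilde\pi_{\lambda_2},\ldots,\tilde\pi_{\lambda_p},\ \tilde\pi_{\lambda_{p+1}}^+,\tilde\pi_{\lambda_{p+1}}^-,\ldots,\tilde\pi_{\lambda_{p+r}}^+,\tilde\pi_{\lambda_{p+r}}^-$$ of $\mathfrak{A}_n(q)$ are irreducible and pairwise inequivalent. These representations represent all equivalence classes of irreducible representations of $\mathfrak{A}_n(q)$. Hence $\mathfrak{A}_n(q)$ is semisimple.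
   Context: Hecke algebra: $\mathcal{H}_n(q)$ is the unital associative $\mathbb{C}$-algebra with generators $g_1,\ldots,g_{n-1}$ and relations $g_i^2=(q-1)g_i+q$ for $1\le i\le n-1$; $g_ig_{i+1}g_i=g_{i+1}g_ig_{i+1}$ for $1\le i\le n-2$; $g_ig_j=g_jg_i$ for $|i-j|\ge 2$. For $q\ne -1$ put $f_i=\frac{2g_i-(q-1)}{q+1}$, $1\le i\le n-1$. Subalgebra: for $n\ge 3$ and $q\neq -1$, $\mathfrak{A}_n(q)$ is the (unital) subalgebra of $\mathcal{H}_n(q)$ over $\mathbb{C}$ generated by $f_1f_{i+1}$, $1\le i\le n-2$; $\mathfrak{A}_2(q)$ is the subalgebra of $\mathcal{H}_2(q)$ generated by the unit element. Young diagrams: $\Lambda_n$ is the set of Young diagrams with $n$ boxes; the box $(i,j)$ is in row $i$, column $j$; ${}^t\lambda$ and ${}^tT$ denote the transposes of a diagram $\lambda$ and a tableau $T$; $\lambda$ is self-conjugate if ${}^t\lambda=\lambda$. $\operatorname{STab}(\lambda)$ is the set of standard tableaux of shape $\lambda$, $T(i,j)$ is the entry of $T$ in box $(i,j)$, and $s_i\cdot T$ is obtained from $T$ by exchanging the entries $i$ and $i+1$. If $k=T(a,b)$, put $\alpha_{k,T}=b-a$; the axial distance from $k$ to $l$ in $T$ is $d_{T,k,l}=\alpha_{k,T}-\alpha_{l,T}$. Representations: for $\lambda\in\Lambda_n$ let $V_\lambda$ be the complex vector space with basis $\{v_T : T\in\operatorname{STab}(\lambda)\}$. The representation $\pi_\lambda$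 of $\mathcal{H}_n(q)$ on $V_\lambda$ is defined by: $\pi_\lambda(g_i)v_T=qv_T$ if $i,i+1$ appear in the same row of $T$; $\pi_\lambda(g_i)v_T=-v_T$ if $i,i+1$ appear in the same column of $T$; otherwise $s_i\cdot T\in\operatorname{STab}(\lambda)$ and $\pi_\lambda(g_i)$ acts on $\mathbb{C}v_T\oplus\mathbb{C}v_{s_i\cdot T}$ by the matrix $$\frac{1}{1-q^d}\begin{bmatrix} q^d(1-q) & \sqrt{q(1-q^{d-1})(1-q^{d+1})}\\ \sqrt{q(1-q^{d-1})(1-q^{d+1})} & -(1-q)\end{bmatrix},\qquad d=d_{T,i,i+1}.$$ $\tilde\pi_\lambda$ denotes the restriction of $\pi_\lambda$ to $\mathfrak{A}_n(q)$, and $\tilde V_\lambda$ its representation space. Components: for self-conjugate $\lambda\in\Lambda_n$, let $\operatorname{STab}(\lambda)^+$ be the set of $T\in\operatorname{STab}(\lambda)$ with $T(1,1)=1$, $T(1,2)=2$, and put $$\tilde V_\lambda^+=\bigoplus_{T\in\operatorname{STab}(\lambda)^+}\mathbb{C}(v_T+v_{{}^tT}),\qquad \tilde V_\lambda^-=\bigoplus_{T\in\operatorname{STab}(\lambda)^+}\mathbb{C}(v_T-v_{{}^tT}),$$ $\mathfrak{A}_n(q)$-submodules of $\tilde V_\lambda$ with $\tilde V_\lambda=\tilde V_\lambda^+\oplus\tilde V_\lambda^-$. $\tilde\pi_\lambda^+$ and $\tilde\pi_\lambda^-$ are the representations of $\mathfrak{A}_n(q)$ on $\tilde V_\lambda^+$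 and $\tilde V_\lambda^-$.
   Formalization: As the printed formulas fail for λ=(2,1), the 2×2 block is read in the basis (v_{s_iT}, v_T), T with d>0, and Ṽ_λ^± is spanned by v_T ± i^m(-1)^{inv(T)} v_{ᵗT}; m counts boxes above the diagonal, inv(T) pairs k<l with l in a higher row. *)

(* Defs.v *)
From HB Require Import structures.
From mathcomp Require Import all_boot all_order perm all_algebra.
From mathcomp Require Import finmap boolp classical_sets.
From mathcomp.multinomials Require Import monalg.

Set Implicit Arguments.
Unset Strict Implicit.
Unset Printing Implicit Defensive.
Import Order.TTheory GRing.Theory Num.Theory.
Local Open Scope ring_scope.
Local Open Scope quotient_scope.

Section Subalgebra.
Context (K : fieldType) (A : algType K) (S : set A).

Inductive in_subalg : A -> Prop :=
| in_subalg_gen x : S x -> in_subalg x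
| in_subalg_one : in_subalg 1
| in_subalg_lin c x y : in_subalg x -> in_subalg y -> in_subalg (c *: x + y)
| in_subalg_mul x y : in_subalg x -> in_subalg y -> in_subalg (x * y).

Definition subalg_pred : {pred A} := [pred x | `[< in_subalg x >]].

Lemma subalg_pred_closed : GRing.subsemialg_closed subalg_pred.
Proof.
apply: GRing.subalg_closed_semi; split.
- exact/asboolP/in_subalg_one.
- by move=> c x y /asboolP hx /asboolP hy; apply/asboolP/in_subalg_lin.
- by move=> x y /asboolP hx /asboolP hy; apply/asboolP/in_subalg_mul.
Qed.

Record subalg := Subalg { subalg_val :> A; _ : subalg_val \in subalg_pred }.

HB.instance Definition _ := [isSub for subalg_val].
HB.instance Definition _ := [Choice of subalg by <:].
HB.instance Definition _ :=
  GRing.SubChoice_isSubAlgebra.Build K A subalg_pred subalg subalg_pred_closed.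

End Subalgebra.

Section Representations.
Context (K : fieldType) (A : algType K).

(* The laws of a representation are not part of [action]; they are required by
   [representation]. *)
Record action := Action {
  act_space : lmodType K;
  act_fun :> A -> act_space -> act_space }.

Definition representation (X : action) : Prop :=
  [/\ forall a, linear (X a),
      forall c a b v, X (c *: a + b) v = c *: X a v + X b v,
      forall v, X 1 v = v
    & forall a b v, X (a * b) v = X a (X b v)].

Definition submodule (X : action) (U : set (act_space X)) : Prop :=
  [/\ U 0,
      forall c u v, U u -> U v -> U (c *: u + v)
    & forall a v, U v -> U (X a v)].

Definition simple_submodule (X : action) (U : set (act_space X)) : Prop :=
  [/\ submodule U,
      exists2 v, U v & v != 0
    & forall W : set (act_space X), submodule W -> (W `<=` U)%classic ->
        (W = [set 0])%classic \/ W = U].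

Definition irreducible (X : action) : Prop :=
  representation X /\ simple_submodule (setT : set (act_space X)).

Definition equivalent (X Y : action) : Prop :=
  exists f : act_space X -> act_space Y,
    [/\ linear f, bijective f & forall a v, f (X a v) = Y a (f v)].

Definition regular_action : action := @Action A (fun a x => a * x).

(* The left regular module is a direct sum of simple submodules; finitely many
   summands are enough since the module is generated by 1. *)
Definition semisimple_algebra : Prop :=
  exists (k : nat) (U : 'I_k -> set (act_space regular_action)),
    (forall i, simple_submodule (U i)) /\
    (forall x : A, exists! u : {ffun 'I_k -> A},
       (forall i, U i (u i)) /\ x = \sum_i u i).

End Representations.

Definition restrict_action (K : fieldType) (A : algType K) (S : set A)
    (X : action A) : action (subalg S) :=
  @Action K (subalg S) (act_space X) (fun a v => X (val a) v).

(* The action on a subspace [U]; the projection onto [U] is only there to land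
   in the type [subvs_of U], and is the identity on the values taken as soon as
   [U] is stable. *)
Definition subspace_action (K : fieldType) (A : algType K) (V : vectType K)
    (rho : A -> V -> V) (U : {vspace V}) : action A :=
  @Action K A (subvs_of U) (fun a u => vsproj U (rho a (vsval u))).

Section AlgebraQuotient.
Context (K : fieldType) (F : algType K) (S : set F).

Inductive in_ideal : F -> Prop :=
| in_ideal_gen x : S x -> in_ideal x
| in_ideal0 : in_ideal 0
| in_idealD x y : in_ideal x -> in_ideal y -> in_ideal (x + y)
| in_idealM a x b : in_ideal x -> in_ideal (a * x * b).

Definition ideal_pred : {pred F} := [pred x | `[< in_ideal x >]].

Lemma ideal_pred_zmod_closed : zmod_closed ideal_pred.
Proof.
split=> [|x y /asboolP hx /asboolP hy]; apply/asboolP; first exact: in_ideal0.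
apply: in_idealD => //.
by have := in_idealM (-1) 1 hy; rewrite mulr1 mulN1r.
Qed.

HB.instance Definition _ :=
  GRing.isZmodClosed.Build F ideal_pred ideal_pred_zmod_closed.

Lemma ideal_predMl a x : x \in ideal_pred -> a * x \in ideal_pred.
Proof.
move/asboolP=> hx; apply/asboolP.
by have := in_idealM a 1 hx; rewrite mulr1.
Qed.

Lemma ideal_predMr x b : x \in ideal_pred -> x * b \in ideal_pred.
Proof.
move/asboolP=> hx; apply/asboolP.
by have := in_idealM 1 b hx; rewrite mul1r.
Qed.

(* MathComp algebras are nonzero rings, hence the argument [proper]. *)
Definition quotient_algebra (proper : ~ in_ideal 1) : Type :=
  Quotient.quot ideal_pred.

Context (proper : ~ in_ideal 1).
Local Notation Q := (quotient_algebra proper).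

HB.instance Definition _ := GRing.Zmodule.on Q.
HB.instance Definition _ := Quotient.on Q.

Definition qalg_one : Q := \pi_Q 1.
Definition qalg_mul (x y : Q) : Q := \pi_Q (repr x * repr y).
Definition qalg_scale (c : K) (x : Q) : Q := \pi_Q (c *: repr x).

Lemma qalg_eqP (x y : F) : reflect (\pi_Q x = \pi_Q y) (x - y \in ideal_pred).
Proof. by rewrite Quotient.idealrBE; apply: eqP. Qed.

Lemma qalg_reprK (x : F) : repr (\pi_Q x) - x \in ideal_pred.
Proof. by apply/qalg_eqP; rewrite reprK. Qed.

Lemma qalg_piD (x y : F) : \pi_Q (x + y) = \pi_Q x + \pi_Q y.
Proof. exact: Quotient.pi_add. Qed.

Lemma qalg_piM (x y : F) : \pi_Q (x * y) = qalg_mul (\pi_Q x) (\pi_Q y).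
Proof.
apply/esym/qalg_eqP; set x' := repr _; set y' := repr _.
rewrite (_ : _ - _ = (x' - x) * y' + x * (y' - y)); last first.
  by rewrite mulrBl mulrBr addrA addrNK.
by apply: rpredD; [apply: ideal_predMr | apply: ideal_predMl];
  apply: qalg_reprK.
Qed.

Lemma qalg_piZ c (x : F) : \pi_Q (c *: x) = qalg_scale c (\pi_Q x).
Proof.
apply/esym/qalg_eqP; rewrite -scalerBr -mulr_algl.
by apply: ideal_predMl; apply: qalg_reprK.
Qed.

Lemma qalg_mulA : associative qalg_mul.
Proof.
elim/quotW=> x; elim/quotW=> y; elim/quotW=> z.
by rewrite -(qalg_piM y z) -(qalg_piM x y) -(qalg_piM x) -(qalg_piM _ z) mulrA.
Qed.

Lemma qalg_mul1l : left_id qalg_one qalg_mul.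
Proof. by elim/quotW=> x; rewrite -(qalg_piM 1 x) mul1r. Qed.

Lemma qalg_mul1r : right_id qalg_one qalg_mul.
Proof. by elim/quotW=> x; rewrite -(qalg_piM x 1) mulr1. Qed.

Lemma qalg_mulDl : left_distributive qalg_mul +%R.
Proof.
elim/quotW=> x; elim/quotW=> y; elim/quotW=> z.
rewrite -(qalg_piD x y) -(qalg_piM _ z) -(qalg_piM x z) -(qalg_piM y z).
by rewrite -qalg_piD mulrDl.
Qed.

Lemma qalg_mulDr : right_distributive qalg_mul +%R.
Proof.
elim/quotW=> x; elim/quotW=> y; elim/quotW=> z.
rewrite -(qalg_piD y z) -(qalg_piM x) -(qalg_piM x y) -(qalg_piM x z).
by rewrite -qalg_piD mulrDr.
Qed.

Lemma qalg_one_neq0 : qalg_one != 0.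
Proof.
apply/eqP => h; apply/proper/asboolP.
change (1 \in ideal_pred); rewrite -[1]subr0; apply/qalg_eqP.
rewrite -/qalg_one h; apply: (addrI (\pi_Q 0)).
by rewrite -qalg_piD !addr0.
Qed.

HB.instance Definition _ := GRing.Zmodule_isNzRing.Build Q
  qalg_mulA qalg_mul1l qalg_mul1r qalg_mulDl qalg_mulDr qalg_one_neq0.

Lemma qalg_scaleA a b x : qalg_scale a (qalg_scale b x) = qalg_scale (a * b) x.
Proof.
elim/quotW: x => x.
by rewrite -(qalg_piZ b x) -(qalg_piZ a) -(qalg_piZ _ x) scalerA.
Qed.

Lemma qalg_scale1 : left_id 1 qalg_scale.
Proof. by elim/quotW=> x; rewrite -(qalg_piZ 1 x) scale1r. Qed.

Lemma qalg_scaleDr : right_distributive qalg_scale +%R.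
Proof.
move=> c; elim/quotW=> x; elim/quotW=> y.
rewrite -(qalg_piD x y) -(qalg_piZ c) -(qalg_piZ c x) -(qalg_piZ c y).
by rewrite -qalg_piD scalerDr.
Qed.

Lemma qalg_scaleDl x : {morph qalg_scale^~ x : a b / a + b}.
Proof.
by elim/quotW: x => x a b; rewrite -!(qalg_piZ _ x) -qalg_piD scalerDl.
Qed.

HB.instance Definition _ := GRing.Zmodule_isLmodule.Build K Q
  qalg_scaleA qalg_scale1 qalg_scaleDr qalg_scaleDl.

Lemma qalg_scaleAl c (x y : Q) : c *: (x * y) = c *: x * y.
Proof.
change (qalg_scale c (qalg_mul x y) = qalg_mul (qalg_scale c x) y).
elim/quotW: x => x; elim/quotW: y => y.
rewrite -(qalg_piM x y) -(qalg_piZ c) -(qalg_piZ c x) -(qalg_piM _ y).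
by rewrite scalerAl.
Qed.

HB.instance Definition _ := GRing.Lmodule_isLalgebra.Build K Q qalg_scaleAl.

Lemma qalg_scaleAr c (x y : Q) : c *: (x * y) = x * (c *: y).
Proof.
change (qalg_scale c (qalg_mul x y) = qalg_mul x (qalg_scale c y)).
elim/quotW: x => x; elim/quotW: y => y.
rewrite -(qalg_piM x y) -(qalg_piZ c) -(qalg_piZ c y) -(qalg_piM x).
by rewrite scalerAr.
Qed.

HB.instance Definition _ := GRing.Lalgebra_isAlgebra.Build K Q qalg_scaleAr.

End AlgebraQuotient.

Section FreeAlgebra.
Context (K : fieldType) (I : choiceType).

Definition free_algebra_carrier : Type := {malg K[{fmonom I}]}.
HB.instance Definition _ := GRing.Lalgebra.on free_algebra_carrier.

Lemma free_scaleAr c (x y : free_algebra_carrier) :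
  c *: (x * y) = x * (c *: y).
Proof.
have comC (z : {malg K[{fmonom I}]}) : z * c%:MP = c *: z.
  rewrite [RHS]malgZ_def /fgscale -[LHS]/(fgmul _ _) fgmulgU.
  by apply: eq_bigr => k _; rewrite mulrC mulm1.
rewrite -[LHS](comC (x * y)) -mulrA; congr (x * _); exact: comC.
Qed.

HB.instance Definition _ :=
  GRing.Lalgebra_isAlgebra.Build K free_algebra_carrier free_scaleAr.

Definition free_algebra : algType K := free_algebra_carrier.

Definition free_gen (i : I) : free_algebra :=
  (mkmalgU (fmu i) 1 : {malg K[{fmonom I}]}).

Definition free_action (V : lmodType K) (G : I -> V -> V)
    (x : free_algebra) (v : V) : V :=
  let x : {malg K[{fmonom I}]} := x in
  \sum_(m <- msupp x) x@_m *: foldr G v (m : seq I).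

Lemma free_actionE (V : lmodType K) (G : I -> V -> V) (E : {fset {fmonom I}})
    (x : {malg K[{fmonom I}]}) v :
  (msupp x `<=` E)%fset ->
  free_action G x v = \sum_(m <- E) x@_m *: foldr G v (m : seq I).
Proof.
move=> le; rewrite [LHS](big_fset_incl _ le) => //= m _ /mcoeff_outdom ->.
by rewrite scale0r.
Qed.

Lemma free_action_linear (V : lmodType K) (G : I -> V -> V) c
    (x y : free_algebra) v :
  free_action G (c *: x + y) v = c *: free_action G x v + free_action G y v.
Proof.
pose x' : {malg K[{fmonom I}]} := x; pose y' : {malg K[{fmonom I}]} := y.
pose E := (msupp x' `|` msupp y' `|` msupp (c *: x' + y'))%fset.
rewrite -[c *: x + y]/(c *: x' + y') -[x in RHS]/x' -[y in RHS]/y'.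
have lex : (msupp x' `<=` E)%fset by rewrite /E -fsetUA fsubsetUl.
have ley : (msupp y' `<=` E)%fset.
  by rewrite /E fsetUC; apply: fsubset_trans (fsubsetUr _ _); exact: fsubsetUr.
have le : (msupp (c *: x' + y') `<=` E)%fset by exact: fsubsetUr.
rewrite (free_actionE _ _ le) (free_actionE _ _ lex) (free_actionE _ _ ley).
rewrite scaler_sumr -big_split /=; apply: eq_bigr => m _.
by rewrite mcoeffD mcoeffZ scalerDl scalerA.
Qed.

Lemma free_action_sum (V : lmodType K) (G : I -> V -> V) (J : Type) (s : seq J)
    (x : J -> free_algebra) v :
  free_action G (\sum_(j <- s) x j) v = \sum_(j <- s) free_action G (x j) v.
Proof.
elim: s => [|j s IH].
  rewrite !big_nil; have := free_action_linear G (-1) 0 0 v.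
  by rewrite scaler0 addr0 scaleN1r addNr.
rewrite !big_cons -[x j]scale1r free_action_linear scale1r.
by rewrite IH scale1r.
Qed.

Lemma free_actionU (V : lmodType K) (G : I -> V -> V) (c : K)
    (m : {fmonom I}) v :
  free_action G (mkmalgU m c : {malg K[{fmonom I}]}) v =
  c *: foldr G v (m : seq I).
Proof.
by rewrite (free_actionE _ _ (@msuppU_le _ _ m c)) big_seq_fset1 mcoeffUU.
Qed.

Lemma free_action_gen (V : lmodType K) (G : I -> V -> V) i v :
  free_action G (free_gen i) v = G i v.
Proof. by rewrite free_actionU scale1r fmU. Qed.

Lemma free_action1 (V : lmodType K) (G : I -> V -> V) v :
  free_action G 1 v = v.
Proof.
have := free_actionU G 1 (mone : {fmonom I}) v.
by rewrite scale1r fm1.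
Qed.

Section LinearAction.
Context (V : lmodType K) (G : I -> V -> V) (linG : forall i, linear (G i)).

Lemma foldr_linear (w : seq I) : linear (fun v => foldr G v w).
Proof. by move=> c u v; elim: w => //= i w ->; rewrite linG. Qed.

Lemma free_action_linear_r (x : free_algebra) : linear (free_action G x).
Proof.
move=> c u v; rewrite /free_action scaler_sumr -big_split /=.
apply: eq_bigr => m _; have /= -> := foldr_linear (m : seq I) c u v.
by rewrite scalerDr !scalerA mulrC.
Qed.

Lemma free_actionM (x y : free_algebra) v :
  free_action G (x * y) v = free_action G x (free_action G y v).
Proof.
pose x' : {malg K[{fmonom I}]} := x; pose y' : {malg K[{fmonom I}]} := y.
have foldr_sum (w : seq I) (E : seq {fmonom I}) (f : {fmonom I} -> V)
      (a : {fmonom I} -> K) :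
    foldr G (\sum_(m <- E) a m *: f m) w = \sum_(m <- E) a m *: foldr G (f m) w.
  have f0 : foldr G 0 w = 0.
    by have := foldr_linear w (-1) 0 0; rewrite scaler0 addr0 scaleN1r addNr.
  elim: E => [|m E IH]; first by rewrite !big_nil.
  by rewrite !big_cons foldr_linear IH.
rewrite (_ : x * y = (\sum_(m1 <- msupp x') \sum_(m2 <- msupp y')
    (mkmalgU (mmul m1 m2) (x'@_m1 * y'@_m2) : {malg K[{fmonom I}]})));
  last first.
  exact: (malgME x' y').
rewrite (free_action_sum G (msupp x')); apply: eq_bigr => m1 _.
rewrite (free_action_sum G (msupp y')) foldr_sum scaler_sumr.
apply: eq_bigr => m2 _.
by rewrite free_actionU fmM foldr_cat scalerA.
Qed.

End LinearAction.

Section Evaluation.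
Context (a : K).

Definition free_eval_monom (m : {fmonom I}) : K := a ^+ size m.

Lemma free_eval_monom_morph : mmorphism free_eval_monom.
Proof.
by split=> [x y|]; rewrite /free_eval_monom ?fmM ?fm1 // size_cat exprD.
Qed.

HB.instance Definition _ :=
  isMultiplicative.Build _ _ free_eval_monom free_eval_monom_morph.

Definition free_eval (x : free_algebra) : K := mmap idfun free_eval_monom x.

Lemma free_eval_gen i : free_eval (free_gen i) = a.
Proof. by rewrite /free_eval mmapU /= mul1r /free_eval_monom fmU expr1. Qed.

Lemma free_evalM x y : free_eval (x * y) = free_eval x * free_eval y.
Proof. exact: (mmap_is_multiplicative (f := idfun)).1. Qed.

Lemma free_evalD x y : free_eval (x + y) = free_eval x + free_eval y.
Proof. exact: mmapD. Qed.

Lemma free_evalZ c x : free_eval (c *: x) = c * free_eval x.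
Proof. exact: (mmapZ (f := idfun)). Qed.

Lemma free_eval1 : free_eval 1 = 1.
Proof. exact: (mmap1 (f := idfun)). Qed.

End Evaluation.
End FreeAlgebra.

(* Generators are numbered from 0: [x_ i] plays the role of $g_{i+1}$. *)
Section HeckeRelators.
Context (K : fieldType) (n : nat) (q : K) (F : algType K) (x_ : 'I_n.-1 -> F).

Inductive hecke_relator : F -> Prop :=
| hecke_quadratic i :
    hecke_relator (x_ i ^+ 2 - ((q - 1) *: x_ i + q%:A))
| hecke_braid (i j : 'I_n.-1) : j = i.+1 :> nat ->
    hecke_relator (x_ i * x_ j * x_ i - x_ j * x_ i * x_ j)
| hecke_commute (i j : 'I_n.-1) : (i.+1 < j)%N || (j.+1 < i)%N ->
    hecke_relator (x_ i * x_ j - x_ j * x_ i).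

(* The relators are killed by any character sending every generator to [q]. *)
Lemma hecke_ideal_proper (chi : F -> K) :
  (forall x y, chi (x * y) = chi x * chi y) ->
  (forall x y, chi (x + y) = chi x + chi y) ->
  (forall c x, chi (c *: x) = c * chi x) ->
  chi 1 = 1 -> (forall i, chi (x_ i) = q) ->
  ~ in_ideal hecke_relator 1.
Proof.
move=> chiM chiD chiZ chi1 chix.
have chi0 : chi 0 = 0 by rewrite -[0](scale0r 0) chiZ mul0r.
have chiB x y : chi (x - y) = chi x - chi y.
  by rewrite -scaleN1r chiD chiZ mulN1r.
suff h x : in_ideal hecke_relator x -> chi x = 0.
  by move/h/eqP; rewrite chi1 oner_eq0.
elim=> {x} [_ [i|i j _|i j _]| |x y _ hx _ hy|a x b _ hx] //.
- rewrite chiB chiD !chiZ expr2 chiM chix chi1.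
  by rewrite mulr1 mulrBl mul1r addrNK subrr.
- by rewrite chiB !chiM !chix subrr.
- by rewrite chiB !chiM !chix subrr.
- by rewrite chiD hx hy addr0.
- by rewrite !chiM hx mulr0 mul0r.
Qed.

End HeckeRelators.

Section Hecke.
Context (K : fieldType) (n : nat) (q : K).

Local Notation free := (free_algebra K 'I_n.-1).
Local Notation relator := (@hecke_relator K n q free (@free_gen K 'I_n.-1)).

Lemma hecke_proper : ~ in_ideal relator 1.
Proof.
apply: (hecke_ideal_proper (chi := @free_eval K 'I_n.-1 q)).
- exact: free_evalM.
- exact: free_evalD.
- exact: free_evalZ.
- exact: free_eval1.
- exact: free_eval_gen.
Qed.

Definition hecke : algType K := quotient_algebra hecke_proper.

Definition hecke_pi (x : free) : hecke := \pi_(quotient_algebra hecke_proper) x.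
Definition hecke_repr (x : hecke) : free :=
  repr (x : quotient_algebra hecke_proper).

(* The action of [hecke] extending [G], computed on representatives; it does not
   depend on them as soon as [G] satisfies the defining relations. *)
Definition hecke_action (V : lmodType K) (G : 'I_n.-1 -> V -> V) :
    action hecke :=
  @Action K hecke V (fun x v => free_action G (hecke_repr x) v).

Section HeckeActionTheory.
Context (V : lmodType K) (G : 'I_n.-1 -> V -> V).
Hypothesis linG : forall i, linear (G i).
Hypothesis relG : forall x, relator x -> forall v, free_action G x v = 0.

Lemma hecke_action_pi x v : hecke_action G (hecke_pi x) v = free_action G x v.
Proof.
have ideal0 y : in_ideal relator y -> forall w, free_action G y w = 0.
  have act0 w : free_action G 0 w = 0.
    have := free_action_linear G (-1) 0 0 w.
    by rewrite scaler0 addr0 scaleN1r addNr.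
  have act0r y' : free_action G y' 0 = 0.
    have := free_action_linear_r linG y' (-1) 0 0.
    by rewrite scaler0 addr0 scaleN1r addNr.
  elim=> {y} [y /relG //|//|y z _ hy _ hz w|a y b _ hy w].
    by rewrite -[y]scale1r free_action_linear hy hz scaler0 addr0.
  by rewrite !free_actionM // hy act0r.
have /asboolP/ideal0/(_ v) := qalg_reprK hecke_proper x.
rewrite addrC -scaleN1r free_action_linear scaleN1r => /eqP.
by rewrite addrC subr_eq0 => /eqP.
Qed.

Lemma hecke_action_gen i v : hecke_action G (hecke_pi (free_gen K i)) v = G i v.
Proof. by rewrite hecke_action_pi free_action_gen. Qed.

Lemma hecke_action_representation : representation (hecke_action G).
Proof.
have surj (a : hecke) : exists x, a = hecke_pi x.
  by exists (hecke_repr a); symmetry; apply: reprK.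
split=> [a|c a b v|v|a b v].
- exact: free_action_linear_r.
- have [[x ->] [y ->]] := (surj a, surj b).
  have -> : c *: hecke_pi x + hecke_pi y = hecke_pi (c *: x + y).
    by rewrite /hecke_pi qalg_piD qalg_piZ.
  by rewrite 3!hecke_action_pi free_action_linear.
- have -> : 1 = hecke_pi 1 by [].
  by rewrite hecke_action_pi free_action1.
- have [[x ->] [y ->]] := (surj a, surj b).
  have -> : hecke_pi x * hecke_pi y = hecke_pi (x * y).
    by rewrite /hecke_pi qalg_piM.
  by rewrite 3!hecke_action_pi free_actionM.
Qed.

End HeckeActionTheory.

Definition hecke_gen (i : 'I_n.-1) : hecke := hecke_pi (free_gen K i).
Local Notation g_ := hecke_gen.

Definition hecke_f (i : 'I_n.-1) : hecke :=
  (q + 1)^-1 *: (2%:R *: g_ i - (q - 1)%:A).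

(* The products of the first [f] with the later ones; there is none for
   [n = 2], and the subalgebra is then generated by the unit element. *)
Definition alt_gens : set hecke :=
  [set x | exists i j : 'I_n.-1,
     [/\ i = 0%N :> nat, (0 < j)%N & x = hecke_f i * hecke_f j]]%classic.

Definition alt_hecke : algType K := subalg alt_gens.

End Hecke.

Section Tableaux.
Context (n : nat).

(* Rows and columns are numbered from 0; a diagram with [n] boxes fits in the
   [n] by [n] square. *)
Definition box : Type := ('I_n * 'I_n)%type.

Definition is_diagram (D : {set box}) : bool :=
  (#|D| == n) &&
  [forall b in D, forall c : box,
     (c.1 <= b.1)%N && (c.2 <= b.2)%N ==> (c \in D)].

Definition young : Type := {D : {set box} | is_diagram D}.

Definition tr_box (b : box) : box := (b.2, b.1).

Lemma is_diagram_tr (la : young) : is_diagram [set tr_box b | b in val la].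
Proof.
have trK : involutive tr_box by case.
case/andP: (valP la) => /eqP cla /forall_inP hla; apply/andP; split.
  by rewrite card_imset ?cla //; apply: inv_inj.
apply/forall_inP => _ /imsetP[b hb ->]; apply/forallP => c; apply/implyP.
case/andP=> h1 h2; apply/imsetP; exists (tr_box c); last by rewrite trK.
by have /forallP/(_ (tr_box c))/implyP := hla _ hb; apply; rewrite /= h1 h2.
Qed.

Definition tr_young (la : young) : young :=
  exist (fun D => is_diagram D) _ (is_diagram_tr la).

(* A tableau is encoded by the position of its entries: [T k] is the box that
   contains the entry usually written [k.+1]. *)
Definition tableau : Type := {ffun 'I_n -> box}.

Definition is_standard (la : young) (T : tableau) : bool :=
  [&& injectiveb T, [set T k | k : 'I_n] == val la &
      [forall k, forall l,
         [|| ((T k).1 == (T l).1) && ((T k).2 < (T l).2)%N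
           | ((T k).2 == (T l).2) && ((T k).1 < (T l).1)%N] ==> (k < l)%N]].

Definition stab (la : young) : Type := {T : tableau | is_standard la T}.

Definition tr_tab (T : tableau) : tableau := [ffun k => tr_box (T k)].

Definition content (T : tableau) (k : 'I_n) : int := (T k).2%:Z - (T k).1%:Z.

Definition axial_distance (T : tableau) (k l : 'I_n) : int :=
  content T k - content T l.

Definition entry (i : 'I_n.-1) : 'I_n := widen_ord (leq_pred n) i.

Lemma entryS_proof (i : 'I_n.-1) : (i.+1 < n)%N.
Proof. by case: i => i /=; case: n. Qed.

Definition entryS (i : 'I_n.-1) : 'I_n := Ordinal (entryS_proof i).

Definition swap_tab (i : 'I_n.-1) (T : tableau) : tableau :=
  [ffun k => T (tperm (entry i) (entryS i) k)].

(* The first two entries are in the first two boxes of the first row. *)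
Definition is_plus (T : tableau) : bool :=
  [forall k : 'I_n, (k < 2)%N ==>
     ((T k).1 == 0%N :> nat) && ((T k).2 == k :> nat)].

(* The number of pairs of entries whose order is reversed when the rows of [T]
   are read from top to bottom. *)
Definition inversions (T : tableau) : nat :=
  #|[set kl : 'I_n * 'I_n |
       (kl.1 < kl.2)%N && ((T kl.2).1 < (T kl.1).1)%N]|.

Definition above_diagonal (la : young) : nat :=
  #|[set b in val la | (b.1 < b.2)%N]|.

End Tableaux.

Section Seminormal.
Context (K : numClosedFieldType) (n : nat) (q : K).
Implicit Types (la : young n) (i : 'I_n.-1) (T : tableau n).

Definition seminormal_space la : vectType K := {ffun stab la -> K^o}.

(* This is 0 if [T] is not a standard tableau of shape [la]. *)
Definition tab_vec la T : seminormal_space la :=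
  [ffun S : stab la => (val S == T)%:R : K^o].

Definition seminormal_block (d : int) : 'M[K]_2 :=
  let e := sqrtC (q * (1 - q ^ (d - 1)) * (1 - q ^ (d + 1))) in
  (1 - q ^ d)^-1 *:
    (block_mx (q ^ d * (1 - q))%:M e%:M e%:M (- (1 - q))%:M : 'M_(1 + 1)).

(* If the entries moved by the generator are neither in the same row nor in the
   same column, let [T0] be that one of [T] and [swap_tab i T] for which their
   axial distance [d] is positive; the generator then acts by
   [seminormal_block d] on the ordered basis ([tab_vec (swap_tab i T0)],
   [tab_vec T0]).  Two points are fixed here.
   - The order of the basis.  The axial distance is -1 for neighbours in the
     same row, where the last diagonal entry of the block is q and the first
     one is -1; with the basis in the other order the braid relation already
     fails for the shape (2, 1).
   - The off-diagonal coefficient.  The blocks for d and -d describe the same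
     operator only up to a sign depending on the square roots, so that one
     block is used for each pair of tableaux. *)
Definition seminormal_image la i T : seminormal_space la :=
  let v := tab_vec la in
  let T' := swap_tab i T in
  let d := axial_distance T (entry i) (entryS i) in
  let B := seminormal_block `|d| in
  if (T (entry i)).1 == (T (entryS i)).1 then q *: v T
  else if (T (entry i)).2 == (T (entryS i)).2 then - v T
  else if 0 < d then B 0 1 *: v T' + B 1 1 *: v T
  else B 0 0 *: v T + B 1 0 *: v T'.

Definition seminormal_gen la i (v : seminormal_space la) :
    seminormal_space la :=
  \sum_(T : stab la) (v T : K) *: seminormal_image la i (val T).

Definition pi_rep la : action (hecke n q) :=
  hecke_action q (@seminormal_gen la).

Definition tilde_pi la : action (alt_hecke n q) :=
  restrict_action (alt_gens (q := q)) (pi_rep la).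

(* The vector paired with [tab_vec T] is the basis vector of the transpose of
   [T], normalized by a fourth root of unity.  Transposing tableaux negates the
   diagonal coefficients of the [hecke_f i], but not the off-diagonal ones,
   which are symmetric; the sign [(-1) ^+ inversions T], which changes when two
   consecutive entries are exchanged, corrects this, and the power of ['i] makes
   the correction compatible with transposing twice.  Without it the two
   subspaces below are not stable: for the shape (2, 1) the stable lines are
   spanned by v +- i v', not by v +- v', with v and v' the two basis vectors. *)
Definition transpose_vec la T : seminormal_space la :=
  ('i ^+ above_diagonal la * (-1) ^+ inversions T) *: tab_vec la (tr_tab T).

(* [s = false] for the sign +, [s = true] for the sign -. *)
Definition half_space (s : bool) la : {vspace seminormal_space la} :=
  (\sum_(T : stab la | is_plus (val T))
     <[tab_vec la (val T) + (-1) ^+ s *: transpose_vec la (val T)]>)%VS.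

Definition tilde_pi_half (s : bool) la : action (alt_hecke n q) :=
  subspace_action (tilde_pi la) (half_space s la).

Definition alt_family (p r : nat) (lam : p.-tuple (young n))
    (mu : r.-tuple (young n)) (x : 'I_p + 'I_r * bool) :
    action (alt_hecke n q) :=
  match x with
  | inl i => tilde_pi (tnth lam i)
  | inr (j, s) => tilde_pi_half s (tnth mu j)
  end.

End Seminormal.

(* Main.v *)
(* With d the axial distance of i and i+1 in T, the representation V_la is given by
   g_i v_T = a(d) v_T + b(d) v_{s_i T}, a(d) = (q - 1) / (1 - q^d), where b(d) vanishes
   if s_i T is not standard; the Hecke relations are then rational identities.
   The Jucys-Murphy elements L_{k+1} = q^-1 g_k L_k g_k act on v_T by powers of q with
   the contents as exponents, and these separate the standard tableaux of all shapes;
   since adjacent transpositions connect the tableaux of one shape, the matrix units of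
   all the V_la are the actions of elements of the Hecke algebra.  The latter is spanned
   by n! words, while the squares of the numbers of standard tableaux sum to n! at least
   (by the commutation of adding and removing boxes); hence it acts faithfully.
   Transposition of tableaux, with suitable signs, gives maps J : V_la -> V_{t la} that
   anticommute with the f_i.  Every h is a + b f_1 with a, b in the alternating
   subalgebra, so J h + h J = 2 J a; for h a matrix unit (or a combination of two) this
   yields elements of the subalgebra that act as matrix units on the listed modules,
   which are moreover jointly faithful.  Everything claimed about the list follows. *)
Require Import Defs.
From mathcomp Require Import all_boot all_order perm all_algebra.
From mathcomp Require Import finmap boolp classical_sets reals.
From mathcomp.real_closed Require Import complex.
From mathcomp.multinomials Require Import monalg.
From mathcomp Require Import fintype finset.
From mathcomp Require Import zify ring.

Set Implicit Arguments.
Unset Strict Implicit.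
Unset Printing Implicit Defensive.
Import Order.TTheory GRing.Theory Num.Theory.
Local Open Scope ring_scope.

(** No dimension is at hand: the Hecke algebra is a quotient of a free algebra and a module is only
    an [lmodType]. Structure theory is therefore replaced by elements acting as matrix units on
    jointly faithful modules: a nonzero coordinate generates the module, 1 is the sum of the
    idempotents E_ii, and an irreducible module, whatever its dimension, is not killed by all of
    them. Faithfulness is a count. Matrix units are dual to matrix coefficients, there are at least
    n! of them, and n! words span, so that the linear independence of these words is not
    presupposed. In the descent to the alternating subalgebra, x = 2a satisfies J x = J h + h J. Let
    h be a matrix unit of shape la. If la is not self-conjugate, h vanishes on V_{t la}, so that x
    acts on V_la as h does. If la is self-conjugate, both terms contribute on V_la, and J is, up to
    a scalar, an involution with the two halves as eigenspaces; there h is chosen with values in one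
    half, and the two terms add up on this half and cancel on the other. *)

Lemma linear_at0 (K : fieldType) (V W : lmodType K) (f : V -> W) : linear f -> f 0 = 0.
Proof. by move=> linf; have := linf (-1) 0 0; rewrite scaler0 addr0 scaleN1r addNr. Qed.

(** * Spans, and the calculus of actions and submodules *)

Section Span.
Context (K : fieldType) (V : lmodType K).

(** Coefficients belong to positions in [s], so that a list of words some of which may coincide can
    be used as it is. *)
Definition inspan (s : seq V) (x : V) :=
  exists c : nat -> K, x = \sum_(i < size s) c i *: s`_i.

Lemma inspan_mem s x : x \in s -> inspan s x.
Proof.
move=> xs; exists (fun i => (i == index x s)%:R).
have lt : (index x s < size s)%N by rewrite index_mem.
rewrite (bigD1 (Ordinal lt)) //= eqxx scale1r nth_index // big1 ?addr0 //.
by move=> i; rewrite -val_eqE /= => /negPf ->; rewrite scale0r.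
Qed.

Lemma inspan_lin s c x y : inspan s x -> inspan s y -> inspan s (c *: x + y).
Proof.
move=> [a ->] [b ->]; exists (fun i => c * a i + b i).
rewrite scaler_sumr -big_split /=; apply: eq_bigr => i _.
by rewrite scalerDl scalerA.
Qed.

Lemma inspan0 s : inspan s 0.
Proof. by exists (fun=> 0); rewrite big1 // => i _; rewrite scale0r. Qed.

Lemma inspan_sum s (J : Type) (r : seq J) (c : J -> K) (F : J -> V) :
  (forall j, inspan s (F j)) -> inspan s (\sum_(j <- r) c j *: F j).
Proof.
move=> sF; elim: r => [|j r IH]; first by rewrite big_nil; apply: inspan0.
by rewrite big_cons; apply: inspan_lin.
Qed.

Lemma linear_comb (W : lmodType K) (f : V -> W) (J : Type) (r : seq J) (c : J -> K) F :
  linear f -> f (\sum_(j <- r) c j *: F j) = \sum_(j <- r) c j *: f (F j).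
Proof.
move=> linf; elim: r => [|j r IH]; last by rewrite !big_cons linf IH.
by rewrite !big_nil linear_at0.
Qed.

Lemma inspan_map s t (f : V -> V) x : linear f ->
  (forall y, y \in s -> inspan t (f y)) -> inspan s x -> inspan t (f x).
Proof.
move=> linf ft [c ->]; rewrite linear_comb //; apply: inspan_sum => i.
by apply/ft/mem_nth.
Qed.

End Span.

Section RepresentationTheory.
Context (K : fieldType) (A : algType K) (X : action A).
Hypothesis repX : representation X.

Lemma act_lin a c u v : X a (c *: u + v) = c *: X a u + X a v.
Proof. by case: repX => h _ _ _; apply: h. Qed.

Lemma act_linl a b c v : X (c *: a + b) v = c *: X a v + X b v.
Proof. by case: repX. Qed.

Lemma act1 v : X 1 v = v. Proof. by case: repX. Qed.
Lemma actM a b v : X (a * b) v = X a (X b v). Proof. by case: repX. Qed.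

Lemma act0r a : X a 0 = 0.
Proof. exact: linear_at0 (act_lin a). Qed.

Lemma actDr a u v : X a (u + v) = X a u + X a v.
Proof. by rewrite -[u]scale1r act_lin !scale1r. Qed.

Lemma actZr a c u : X a (c *: u) = c *: X a u.
Proof. by rewrite -[_ *: u]addr0 act_lin act0r addr0. Qed.

Lemma act_sumr a (J : Type) (s : seq J) (P : pred J) F :
  X a (\sum_(j <- s | P j) F j) = \sum_(j <- s | P j) X a (F j).
Proof. by apply: (big_morph (X a)) => [u v|]; rewrite (actDr, act0r). Qed.

Lemma act0l v : X 0 v = 0.
Proof. by have := act_linl 0 0 (-1) v; rewrite scaler0 addr0 scaleN1r addNr. Qed.

Lemma actDl a b v : X (a + b) v = X a v + X b v.
Proof. by rewrite -[a]scale1r act_linl !scale1r. Qed.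

Lemma actZl a c v : X (c *: a) v = c *: X a v.
Proof. by rewrite -[_ *: a]addr0 act_linl act0l addr0. Qed.

Lemma actBl a b v : X (a - b) v = X a v - X b v.
Proof. by rewrite -[- b]scaleN1r actDl actZl scaleN1r. Qed.

Lemma act_suml (J : Type) (s : seq J) (P : pred J) (F : J -> A) v :
  X (\sum_(j <- s | P j) F j) v = \sum_(j <- s | P j) X (F j) v.
Proof. by apply: (big_morph (X^~ v)) => [a b|]; rewrite (actDl, act0l). Qed.

Lemma act_shift s t r a v :
  X (s *: (t *: a - r%:A)) v = s *: (t *: X a v - r *: v).
Proof. by rewrite actZl actBl !actZl act1. Qed.

End RepresentationTheory.

Section Submodules.
Context (K : fieldType) (A : algType K) (X : action A).
Variables (W : set (act_space X)).
Hypothesis subW : submodule W.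

Lemma submoduleZ c u : W u -> W (c *: u).
Proof. by case: subW => W0 Wl _ Wu; rewrite -[_ *: u]addr0; apply: Wl. Qed.

Lemma submoduleD u v : W u -> W v -> W (u + v).
Proof. by case: subW => _ Wl _ Wu Wv; rewrite -[u]scale1r; apply: Wl. Qed.

Lemma submodule_sum (J : finType) (P : pred J) F :
  (forall j, P j -> W (F j)) -> W (\sum_(j | P j) F j).
Proof.
move=> WF; apply: (big_ind W) => //; first by case: subW.
exact: submoduleD.
Qed.

End Submodules.

Lemma equivalent_sym (K : fieldType) (A : algType K) (X Y : action A) :
  equivalent X Y -> equivalent Y X.
Proof.
case=> f [linf [g fK gK] fE]; exists g; split.
- by move=> c u v; apply: (can_inj fK); rewrite linf !gK.
- by exists f.
- by move=> a v; apply: (can_inj fK); rewrite fE !gK.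
Qed.

(** * Modules over an algebra with a faithful system of matrix units *)

Section MatrixUnits.
Context (K : fieldType) (A : algType K) (I : finType) (B : I -> finType).
Context (X : I -> action A).
Variables (b : forall x, B x -> act_space (X x)) (E : forall x, B x -> B x -> A).
Arguments b : clear implicits.
Arguments E : clear implicits.

Hypothesis repX : forall x, representation (X x).
Hypothesis B_inhabited : forall x, B x.
Hypothesis b_neq0 : forall x i, b x i != 0.
Hypothesis b_span : forall x (v : act_space (X x)),
  exists c : B x -> K, v = \sum_i c i *: b x i.
Hypothesis E_same : forall x i j k,
  X x (E x i j) (b x k) = if j == k then b x i else 0.
Hypothesis E_other : forall x y i j k, x <> y -> X y (E x i j) (b y k) = 0.
Hypothesis X_faithful : forall a,
  (forall x k, X x a (b x k) = 0) -> a = 0.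

Lemma act_ext a a' : (forall x k, X x a (b x k) = X x a' (b x k)) -> a = a'.
Proof.
move=> h; apply/eqP; rewrite -subr_eq0; apply/eqP/X_faithful => x k.
by rewrite (actBl (repX x)) h subrr.
Qed.

Lemma E_sum x i j (c : B x -> K) : 
  X x (E x i j) (\sum_k c k *: b x k) = c j *: b x i.
Proof.
rewrite (act_sumr (repX x)) (bigD1 j) //= (actZr (repX x)) E_same eqxx.
rewrite big1 ?addr0 // => k /negPf nkj.
by rewrite (actZr (repX x)) E_same eq_sym nkj scaler0.
Qed.

Lemma E_kill x y i j (v : act_space (X y)) : x <> y -> X y (E x i j) v = 0.
Proof.
move=> nxy; have [c ->] := b_span v; rewrite (act_sumr (repX y)) big1 // => k _.
by rewrite (actZr (repX y)) E_other // scaler0.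
Qed.

Lemma b_free x (c c' : B x -> K) :
  \sum_k c k *: b x k = \sum_k c' k *: b x k -> c =1 c'.
Proof.
move=> e j; have := congr1 (X x (E x j j)) e; rewrite !E_sum => /eqP.
by rewrite -subr_eq0 -scalerBl scaler_eq0 (negPf (b_neq0 _)) orbF subr_eq0 => /eqP.
Qed.

Definition coord x (v : act_space (X x)) : B x -> K := projT1 (cid (b_span v)).

Lemma coordK x (v : act_space (X x)) : v = \sum_k coord v k *: b x k.
Proof. exact: (projT2 (cid (b_span v))). Qed.

Lemma coord_lin x c (u v : act_space (X x)) k :
  coord (c *: u + v) k = c * coord u k + coord v k.
Proof.
move: k; apply: b_free; rewrite -coordK {1}(coordK u) {1}(coordK v).
rewrite scaler_sumr -big_split /=; apply: eq_bigr => k _.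
by rewrite scalerDl scalerA.
Qed.

(** If coordinate [j] of [v] is nonzero, [E x k j] sends [v] to a nonzero multiple of [b x k]; hence
    [W] contains the whole basis. *)
Lemma units_simple x (W : set (act_space (X x))) v :
  submodule W -> W v -> v != 0 -> forall w, W w.
Proof.
move=> subW Wv v0 w.
have [j cj] : exists j, coord v j != 0.
  apply/existsP; apply: contraR v0 => /existsPn c0; rewrite (coordK v).
  by rewrite big1 // => k _; have /negPn/eqP -> := c0 k; rewrite scale0r.
rewrite (coordK w); apply: submodule_sum => // k _; apply: submoduleZ => //.
rewrite -[b x k](scalerK cj); apply: submoduleZ => //.
by rewrite -E_sum -coordK; case: subW => _ _; apply.
Qed.

Lemma units_irreducible x : irreducible (X x).
Proof.
split=> //; split.
- by split.
- by exists (b x (B_inhabited x)).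
move=> W subW _; have [[v Wv v0]|W0] := pselect (exists2 v, W v & v != 0).
  by right; apply/seteqP; split=> // w _; apply: units_simple v0 _.
left; apply/seteqP; split=> [v Wv|_ ->]; last by case: subW.
by apply: contra_notP W0 => /eqP v0; exists v.
Qed.

(** [E x i i] fixes [b x i] but kills all of [X y], so that an intertwiner would send [b x i] to
    0. *)
Lemma units_inequivalent x y : x <> y -> ~ equivalent (X x) (X y).
Proof.
move=> nxy [f [linf bijf fE]].
have f0 := linear_at0 linf.
pose i := B_inhabited x; have /eqP := b_neq0 i; apply.
apply: (bij_inj bijf); rewrite f0.
by have := E_same i i i; rewrite eqxx => {1}<-; rewrite fE E_kill.
Qed.

Lemma units_one : 1 = \sum_x \sum_i E x i i.
Proof.
apply: act_ext => y k; rewrite (act1 (repX y)) (act_suml (repX y)).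
rewrite (bigD1 y) //= [X in _ = _ + X]big1 ?addr0 => [|x /eqP nxy].
  rewrite (act_suml (repX y)) (bigD1 k) //= E_same eqxx big1 ?addr0 // => i.
  by rewrite E_same => /negPf ->.
by rewrite (act_suml (repX y)) big1 // => i _; rewrite E_other.
Qed.

(** Left multiplication of [E x i i] by [a] only sees column [i] of the matrix of [a]: the left
    ideal generated by [E x i i] is a copy of [X x]. *)
Lemma units_mull a x i : a * E x i i = \sum_k coord (X x a (b x i)) k *: E x k i.
Proof.
apply: act_ext => y k; rewrite (actM (repX y)) (act_suml (repX y)).
have [e|/eqP nxy] := eqVneq x y; last first.
  rewrite E_other // (act0r (repX y)) big1 // => l _.
  by rewrite (actZl (repX y)) E_other // scaler0.
subst y; rewrite E_same; case: eqP => [<-|nik].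
  rewrite {1}(coordK (X x a (b x i))); apply: eq_bigr => l _.
  by rewrite (actZl (repX x)) E_same eqxx.
rewrite (act0r (repX x)) big1 // => l _.
by rewrite (actZl (repX x)) E_same (introF eqP nik) scaler0.
Qed.

Lemma units_mulE x i j k : E x i j * E x j k = E x i k.
Proof.
apply: act_ext => y l; rewrite (actM (repX y)).
have [e|/eqP nxy] := eqVneq x y; last by rewrite !E_kill.
by subst y; rewrite !E_same; case: eqP => _; rewrite ?E_same ?eqxx ?act0r.
Qed.

(** Since the [E x i i] sum to 1, one of them does not kill [v]; sending [b x k] to [Y (E x k i) v]
    then embeds [X x] into [Y], and simplicity of [Y] makes this onto. *)
Lemma units_complete (Y : action A) :
  irreducible Y -> exists x, equivalent Y (X x).
Proof.
case=> repY [_ [v _ v0] simpleY].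
have [x [i u0]] : exists x i, Y (E x i i) v != 0.
  have [//|none] := pselect (exists x i, Y (E x i i) v != 0).
  move: v0; rewrite -(act1 repY v) units_one (act_suml repY) big1 ?eqxx // => x _.
  rewrite (act_suml repY) big1 // => i _.
  by apply: contra_notP none => /eqP ?; exists x, i.
exists x; apply: equivalent_sym; set u := Y _ v in u0.
pose g (w : act_space (X x)) : act_space Y := \sum_k coord w k *: Y (E x k i) v.
have g_lin : linear g.
  move=> c w w'; rewrite /g scaler_sumr -big_split /=; apply: eq_bigr => k _.
  by rewrite coord_lin scalerDl scalerA.
have gE a w : g (X x a w) = Y a (g w).
  have gw w' : g w' = Y (\sum_k coord w' k *: E x k i) v.
    by rewrite (act_suml repY); apply: eq_bigr => k _; rewrite (actZl repY).
  (* The inserted [E x i i] changes nothing, and [units_mull] can now expand its product with [a] on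
     the left. *)
  have -> : g w = Y ((\sum_k coord w k *: E x k i) * E x i i) v.
    rewrite gw mulr_suml; congr (Y _ v); apply: eq_bigr => k _.
    by rewrite -scalerAl units_mulE.
  rewrite -(actM repY) mulrA units_mull gw; congr (Y _ v).
  apply: eq_bigr => k _; congr (coord _ _ *: _).
  rewrite (actM (repX x)); congr (X x a _); rewrite (act_suml (repX x)) {1}(coordK w).
  by apply: eq_bigr => l _; rewrite (actZl (repX x)) E_same eqxx.
have g0 := linear_at0 g_lin.
have g_b : g (b x i) = u.
  have b_coord : coord (b x i) =1 fun k => (k == i)%:R.
    apply: b_free; rewrite -coordK (bigD1 i) //= eqxx scale1r big1 ?addr0 //.
    by move=> k /negPf ->; rewrite scale0r.
  rewrite /g (bigD1 i) //= b_coord eqxx scale1r big1 ?addr0 // => k.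
  by rewrite b_coord => /negPf ->; rewrite scale0r.
have g_inj : injective g.
  move=> w w' e; apply/eqP; rewrite -subr_eq0; apply/eqP.
  have {e} : g (w - w') = 0.
    by rewrite addrC -scaleN1r g_lin e scaleN1r addNr.
  move: (w - w') => {w'}w gw0; rewrite (coordK w) big1 // => k _.
  (* [E x i k] isolates coordinate [k]: what remains is [coord w k *: u = 0]. *)
  have := gE (E x i k) w; rewrite gw0 (act0r repY) {1}(coordK w) E_sum.
  rewrite -[_ *: b x i]addr0 g_lin g0 addr0 g_b.
  by move/eqP; rewrite scaler_eq0 (negPf u0) orbF => /eqP ->; rewrite scale0r.
have [W0|WT] : (range g = [set 0] \/ range g = [set: _])%classic.
  apply: simpleY => //; split.
  - by exists 0.
  - by move=> c z z0 [w _ <-] [w0 _ <-]; exists (c *: w + w0); rewrite ?g_lin.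
  - by move=> a z [w _ <-]; exists (X x a w); rewrite ?gE.
- have : range g u by exists (b x i).
  by rewrite W0 /= => /eqP; rewrite (negPf u0).
have g_surj w : {w' | g w' = w}.
  by apply: cid; have : range g w; [by rewrite WT | case=> w' _ <-; exists w'].
exists g; split=> //; exists (fun w => projT1 (g_surj w)) => w; last first.
  exact: (projT2 (g_surj w)).
by apply: g_inj; rewrite (projT2 (g_surj _)).
Qed.

Lemma units_mul_neq (t t' : {x : I & B x}) j l : t != t' ->
  E (tag t) j (tagged t) * E (tag t') (tagged t') l = 0.
Proof.
case: t t' j l => x i [y k] /= j l nik.
apply: X_faithful => z m; rewrite (actM (repX z)).
have [e|/eqP nyz] := eqVneq y z; last by rewrite (E_kill _ _ _ nyz) (act0r (repX z)).
subst z; rewrite E_same; case: eqP => _; rewrite ?(act0r (repX y)) //.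
have [e|/eqP nxy] := eqVneq x y; last by rewrite E_kill.
subst y; rewrite E_same; case: eqP => // e; move: nik; rewrite e eqxx //.
Qed.

(** The equation [a = a * E x i i] describes the left ideal of the idempotent [E x i i]. A nonzero
    [a] in it is a combination of the [E x k i]; if the coefficient for [k = j] is nonzero,
    multiplication by [E x i j] recovers [E x i i] up to that scalar. *)
Lemma units_ideal_simple x i :
  simple_submodule (X := regular_action A) [set a | a = a * E x i i]%classic.
Proof.
have subU : submodule (X := regular_action A) [set a | a = a * E x i i]%classic.
  split=> /= [|c u v eu ev|a v ev]; first by rewrite mul0r.
    by rewrite mulrDl -scalerAl -eu -ev.
  by rewrite -mulrA -ev.
split=> //.
  exists (E x i i) => /=; first by rewrite units_mulE.
  apply/eqP => e; have := E_same i i i; rewrite e eqxx (act0l (repX x)) => /esym/eqP.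
  by rewrite (negPf (b_neq0 i)).
move=> W subW WU; have [[a Wa a0]|W0] := pselect (exists2 a, W a & a != 0).
  right; apply/seteqP; split=> // w /= ew.
  have ea := WU _ Wa; rewrite /= in ea.
  have [j cj] : exists j, coord (X x a (b x i)) j != 0.
    apply/existsP; apply: contraR a0 => /existsPn c0; rewrite ea units_mull.
    by rewrite big1 // => k _; have /negPn/eqP -> := c0 k; rewrite scale0r.
  have : W (E x i j * a) by case: subW => _ _; apply.
  rewrite ea units_mull mulr_sumr (bigD1 j) //= big1 ?addr0 => [|k nkj]; last first.
    rewrite -scalerAr (units_mul_neq (t := Tagged B j) (t' := Tagged B k)) ?scaler0 //.
    by rewrite eq_Tagged /= eq_sym.
  rewrite -scalerAr units_mulE => WE.
  rewrite ew -[E x i i](scalerK cj); case: (subW) => _ _; apply.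
  by have := submoduleZ subW (coord (X x a (b x i)) j)^-1 WE.
left; apply/seteqP; split=> [v Wv|_ ->]; last by case: subW.
by apply: contra_notP W0 => /eqP v0; exists v.
Qed.

(** The [E x i i] are orthogonal idempotents with sum 1: the component of [a] in each ideal is [a]
    times the idempotent, and multiplying a decomposition by that idempotent shows uniqueness. *)
Lemma units_semisimple : semisimple_algebra A.
Proof.
pose J : finType := {x : I & B x}; pose e (t : J) := E (tag t) (tagged t) (tagged t).
exists #|J|, (fun k => [set a | a = a * e (enum_val k)]%classic); split=> [k|a].
  exact: units_ideal_simple.
have oneE : 1 = \sum_(k < #|J|) e (enum_val k).
  rewrite units_one (@sig_big_dep _ _ _ _ _ xpredT (fun=> xpredT) (fun x i => E x i i)) /= -/J.
  by rewrite (reindex (@enum_val J J)) //=; apply/onW_bij/enum_val_bij.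
exists [ffun k => a * e (enum_val k)]; split.
  split=> [k|]; first by rewrite ffunE /= -mulrA units_mulE.
  rewrite -{1}[a]mulr1 oneE mulr_sumr; apply: eq_bigr => k _.
  by rewrite ffunE.
move=> u [uU ->]; apply/ffunP => k; rewrite ffunE mulr_suml (bigD1 k) //=.
rewrite big1 ?addr0 => [|l nlk]; first by rewrite -uU.
rewrite uU -mulrA units_mul_neq ?mulr0 //.
by apply: contraNneq nlk => /enum_val_inj ->.
Qed.

End MatrixUnits.

(** * Corners of Young diagrams and numbers of standard tableaux *)

Section YoungDiagrams.
Local Open Scope nat_scope.

(** Allows a row of a diagram to be replaced by its length. *)
Lemma downclosed_ord n (S : {set 'I_n}) (j : 'I_n) :
  (forall i k : 'I_n, i <= k -> k \in S -> i \in S) -> (j \in S) = (j < #|S|).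
Proof.
move=> dS.
have card_lt m : m <= n -> #|[set i : 'I_n | i < m]| = m.
  move=> mn; rewrite cardsE -sum1_card (eq_bigl (fun i : 'I_n => i < m)) //.
  by rewrite (big_ord_narrow mn) sum1_card card_ord.
apply/idP/idP => [jS|]; last first.
  apply: contraLR => jS; rewrite -leqNgt -[X in _ <= X](card_lt j (ltnW (ltn_ord j))).
  apply/subset_leq_card/fintype.subsetP => k kS; rewrite inE ltnNge.
  by apply: contra jS => jk; apply: dS kS.
rewrite -(card_lt j.+1) //; apply/subset_leq_card/fintype.subsetP => k.
by rewrite inE ltnS => kj; apply: dS jS.
Qed.

Section Diagrams.
Variable n : nat.
Implicit Types (D : {set box n}) (b c : box n).

Definition box_le b c := (b.1 <= c.1) && (b.2 <= c.2).

Lemma box_le_refl b : box_le b b. Proof. by rewrite /box_le !leqnn. Qed.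

Lemma box_le_anti b c : box_le b c -> box_le c b -> b = c.
Proof.
case: b c => b1 b2 [c1 c2] /andP[/= h1 h2] /andP[/= h3 h4].
by congr pair; apply/val_inj/anti_leq; rewrite ?h1 ?h2 ?h3 ?h4.
Qed.

(** Unlike [is_diagram] this leaves the number of boxes free, since the counting runs through
    diagrams of all sizes in one square. *)
Definition downclosed D := [forall b in D, forall c, box_le c b ==> (c \in D)].

Lemma downclosedP D :
  reflect (forall b c, box_le c b -> b \in D -> c \in D) (downclosed D).
Proof.
apply: (iffP forall_inP) => [h b c cb bD|h b bD].
  by have /forallP/(_ c)/implyP := h _ bD; apply.
by apply/forallP => c; apply/implyP => cb; apply: h bD.
Qed.

(** The addable boxes; only those inside the square are seen, whence the bound [#|D| < n] in the
    counts below. *)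
Definition up D := [set b | (b \notin D) && downclosed (b |: D)].
Definition down D := [set b | (b \in D) && downclosed (D :\ b)].

Definition row D (i : 'I_n) : {set 'I_n} := [set j | (i, j) \in D].
Definition rowlen D (i : nat) : nat :=
  if insub i is Some i' then #|row D i'| else 0.

Lemma rowlen_ord D (i : 'I_n) : rowlen D i = #|row D i|.
Proof. by rewrite /rowlen valK. Qed.

Lemma rowlenP D (b : box n) : downclosed D -> (b \in D) = (b.2 < rowlen D b.1).
Proof.
move=> /downclosedP dD; case: b => i j; rewrite rowlen_ord -downclosed_ord ?inE //.
by move=> k l kl; rewrite !inE; apply: dD; rewrite /box_le leqnn.
Qed.

Lemma card_row_le D i : rowlen D i <= #|D|.
Proof.
rewrite /rowlen; case: insubP => //= i' _ _.
rewrite -(card_imset _ (f := fun j => (i', j))); last by move=> ? ? [].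
by apply/subset_leq_card/fintype.subsetP => _ /imsetP[j + ->]; rewrite inE.
Qed.

(* A box in row [i] forces [i.+1] boxes in the first column. *)
Lemma rowlen_card D i : downclosed D -> i < n -> #|D| <= i -> rowlen D i = 0.
Proof.
move=> dD ltin; rewrite leqNgt; apply: contraNeq; rewrite -lt0n => r0.
have n0 : 0 < n by apply: leq_ltn_trans ltin.
have iD (k : 'I_n) : k <= i -> (k, Ordinal n0) \in D.
  move=> ki; have : (Ordinal ltin, Ordinal n0) \in D by rewrite rowlenP.
  by have /downclosedP := dD; apply; rewrite /box_le /= ki leqnn.
pose f (k : 'I_i.+1) := (widen_ord ltin k, Ordinal n0).
rewrite -[X in X <= _](card_ord i.+1) -(card_imset _ (f := f)) => [|k l [/val_inj //]].
apply/subset_leq_card/fintype.subsetP => _ /imsetP[k _ ->]; apply: iD => /=.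
by rewrite -ltnS.
Qed.

(** Whether row [i] ends at an addable box, and for [down_row] at a removable one; [up_row D i.+1]
    and [down_row D i] are the same inequality. *)
Definition up_row D i := (i == 0) || (rowlen D i < rowlen D i.-1).
Definition down_row D i := rowlen D i.+1 < rowlen D i.

Lemma upE D b : downclosed D ->
  (b \in up D) = (b.2 == rowlen D b.1 :> nat) && up_row D b.1.
Proof.
move=> dD; rewrite !inE rowlenP // -leqNgt; apply/idP/idP.
  case/andP => lb /downclosedP db.
  have inD c : box_le c b -> c != b -> c \in D.
    by move=> cb nb; have := db b c cb; rewrite !inE eqxx (negPf nb); apply.
  have eb : b.2 = rowlen D b.1 :> nat.
    apply/eqP; rewrite eqn_leq lb andbT.
    case: (posnP b.2) => [-> //|b0].
    have lt : b.2.-1 < n by apply: leq_ltn_trans (ltn_ord b.2); apply: leq_pred.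
    have := inD (b.1, Ordinal lt); rewrite rowlenP //= prednK //; apply.
      by rewrite /box_le /= leqnn leq_pred.
    by apply/eqP => /(congr1 (fun c => nat_of_ord c.2)) /=; lia.
  rewrite eb eqxx /up_row /=; case: (posnP b.1) => [-> //|b0]; rewrite -eb.
  have lt : b.1.-1 < n by apply: leq_ltn_trans (ltn_ord b.1); apply: leq_pred.
  have := inD (Ordinal lt, b.2); rewrite rowlenP //= => -> //.
  - by rewrite /box_le /= leqnn leq_pred.
  by apply/eqP => /(congr1 (fun c => nat_of_ord c.1)) /=; lia.
case/andP=> /eqP eb ub; rewrite eb leqnn /=; apply/downclosedP => c d dc.
rewrite !inE => /predU1P[ec|cD]; last first.
  by move/downclosedP: dD => /(_ c d dc cD) ->; rewrite orbT.
have [//|ndb] := eqVneq d b; rewrite rowlenP //=; subst c.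
case/andP: dc => d1 d2; move: d1; rewrite leq_eqVlt => /orP[/eqP d1|d1].
  rewrite d1 -eb ltn_neqAle d2 andbT; apply: contra ndb => /eqP e2.
  by apply/eqP; case: (d) (b) d1 e2 => ? ? [? ?] /= /val_inj -> /val_inj ->.
move: ub; rewrite /up_row; case: (posnP b.1) => [e|b0 /=]; first by rewrite e in d1.
have lt : b.1.-1 < n by apply: leq_ltn_trans (ltn_ord b.1); apply: leq_pred.
move=> h; suff : d \in D by rewrite rowlenP.
have : (Ordinal lt, b.2) \in D by rewrite rowlenP //= eb.
by have /downclosedP := dD; apply; rewrite /box_le /= d2 andbT -ltnS prednK.
Qed.

Lemma downE D b : downclosed D ->
  (b \in down D) = (b.2.+1 == rowlen D b.1 :> nat) && down_row D b.1.
Proof.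
move=> dD; rewrite !inE rowlenP //; apply/idP/idP.
  case/andP => lb /downclosedP db.
  have ninD c : box_le b c -> c != b -> c \notin D.
    move=> bc nc; have := db c b bc; rewrite !inE eqxx nc /=. by case: (c \in D) => // /(_ isT).
  have eb : b.2.+1 = rowlen D b.1 :> nat.
    apply/eqP; rewrite eqn_leq lb /= leqNgt; apply/negP => lt.
    have lt' : b.2.+1 < n.
      by apply: leq_trans lt _; rewrite rowlen_ord -[X in _ <= X](card_ord n) max_card.
    have := ninD (b.1, Ordinal lt'); rewrite rowlenP //= lt => /(_ _ _)/negP; apply=> //.
      by rewrite /box_le /= leqnn leqnSn.
    by apply/eqP => /(congr1 (fun c => nat_of_ord c.2)) /=; lia.
  rewrite eb eqxx /down_row -eb /= ltnS leqNgt; apply/negP => lt.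
  have lt' : b.1.+1 < n.
    by move: lt; rewrite /rowlen; case: insubP.
  have := ninD (Ordinal lt', b.2); rewrite rowlenP //= lt => /(_ _ _)/negP; apply=> //.
    by rewrite /box_le /= leqnn leqnSn.
  by apply/eqP => /(congr1 (fun c => nat_of_ord c.1)) /=; lia.
case/andP=> /eqP eb ub; rewrite -eb leqnn /=; apply/downclosedP => c d dc.
rewrite !inE => /andP[ncb cD]; have /downclosedP/(_ c d dc cD) dD' := dD.
rewrite dD' andbT; apply: contra ncb => /eqP ed; subst d.
case/andP: dc => d1 d2; have := cD; rewrite rowlenP // => c2.
move: d1; rewrite leq_eqVlt => /orP[/eqP d1|d1].
  apply/eqP; case: (b) (c) d1 d2 c2 eb => b1 b2 [c1 c2] /= /val_inj -> h2 h3 e.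
  by congr pair; apply: val_inj => /=; lia.
have lt : b.1.+1 < n by apply: leq_ltn_trans d1 _.
have : (Ordinal lt, c.2) \in D.
  by have /downclosedP := dD; apply; last exact: cD; rewrite /box_le /= d1 leqnn.
by rewrite rowlenP //=; move: ub; rewrite /down_row; lia.
Qed.

(** A row below the first carries an addable box exactly when the row above it carries a removable
    one. The first row always carries an addable box, and the last row of the square is empty since
    [#|D| < n]. *)
Lemma card_up D : downclosed D -> #|D| < n -> #|up D| = #|down D|.+1.
Proof.
move=> dD Dn.
have sumE (S : {set box n}) : #|S| = \sum_(i < n) \sum_(j < n) ((i, j) \in S).
  rewrite pair_big /= -sum1_card big_mkcond /=.
  by apply: eq_bigr => -[i j] _ /=; case: (_ \in _).
(* A row contributes at most one box, in column [r.-1]; the bound [r <= n] keeps it inside the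
   square. *)
have pick (r : nat) (u : bool) :
    (u -> 0 < r <= n) -> \sum_(j < n) ((j.+1 == r :> nat) && u) = u.
  case: u => [/(_ isT)/andP[r0 rn]|_]; last by rewrite big1 // => j _; rewrite andbF.
  have rn' : r.-1 < n by rewrite prednK.
  rewrite (bigD1 (Ordinal rn')) //= prednK // eqxx big1 // => j nj.
  rewrite andbT; case: eqP => // e; case/eqP: nj; apply: val_inj => /=.
  by rewrite -e.
have -> : #|up D| = \sum_(0 <= i < n) up_row D i.
  rewrite sumE big_mkord; apply: eq_bigr => i _.
  rewrite -[RHS](pick (rowlen D i).+1) => [|_].
    by apply: eq_bigr => j _; rewrite upE.
  by rewrite /= (leq_ltn_trans (card_row_le D i)).
have -> : #|down D| = \sum_(0 <= i < n) down_row D i.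
  rewrite sumE big_mkord; apply: eq_bigr => i _.
  rewrite -[RHS](pick (rowlen D i)) => [|di].
    by apply: eq_bigr => j _; rewrite downE.
  by rewrite (leq_ltn_trans _ di) // ltnW // (leq_ltn_trans (card_row_le D i)).
have [m en] : exists m, n = m.+1 by exists n.-1; rewrite prednK // (leq_ltn_trans _ Dn).
have sumS (F : nat -> nat) : \sum_(0 <= i < n) F i = \sum_(0 <= i < m.+1) F i.
  by rewrite {1}en.
rewrite !sumS big_nat_recl //= big_nat_recr //=.
rewrite [X in _ = (_ + X).+1](_ : _ = 0) ?addn0 //.
by rewrite /down_row (@rowlen_card _ m) // ?en // -ltnS -en.
Qed.

(** The number of ways to take [k] boxes off [D] one corner at a time; for [k = #|D|] this counts
    the standard tableaux of shape [D]. *)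
Fixpoint num_tab k D : nat :=
  if k is k'.+1 then \sum_(b in down D) num_tab k' (D :\ b) else 1.

Lemma downclosed0 : downclosed set0.
Proof. by apply/downclosedP => b c _; rewrite inE. Qed.

(** Both sides amount to [(b |: D) :\ c] being downclosed: its union with [D] is [b |: D] and its
    intersection with [D] is [D :\ c]. *)
Lemma up_down_comm D b c : downclosed D -> b \notin D -> c \in D ->
  (b \in up D) && (c \in down (b |: D)) = (c \in down D) && (b \in up (D :\ c)).
Proof.
move=> dD bD cD; have nbc : b != c by apply: contraNneq bD => ->.
have e : b |: (D :\ c) = (b |: D) :\ c.
  apply/setP => d; rewrite !inE; have [->|] := eqVneq d b; last by rewrite orFb.
  by rewrite nbc.
rewrite !inE bD cD /= ?orbT ?andbF /= e.
case dE: (downclosed (_ :\ c)); rewrite ?andbF ?andbT //.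
move/downclosedP in dE; move/downclosedP in dD.
have -> : downclosed (b |: D).
  apply/downclosedP => d d' h; rewrite !inE.
  case/predU1P => [ed|dD']; last by rewrite (dD _ _ h) ?orbT.
  have := dE d d' h; rewrite !inE ed eqxx nbc /= => /(_ isT) /andP[_].
  by [].
suff -> : downclosed (D :\ c) by rewrite (negPf bD) andbF.
apply/downclosedP => d d' h; rewrite !inE => /andP[ndc dD'].
by have := dE d d' h; rewrite !inE ndc dD' orbT (dD _ _ h dD') => /(_ isT) /andP[->].
Qed.

(** Once [b] is added, the next box removed is either [b] again, which gives [D] back, or an old box
    [c]. *)
Lemma sum_up_num_tab k D : downclosed D ->
  \sum_(b in up D) num_tab k.+1 (b |: D) = #|up D| * num_tab k D +
    \sum_(b | b \notin D) \sum_(c | (c \in D) && ((b \in up D) && (c \in down (b |: D))))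
      num_tab k (b |: (D :\ c)).
Proof.
move=> dD; rewrite -sum_nat_const big_mkcond [X in _ = X + _]big_mkcond.
rewrite [X in _ = _ + X]big_mkcond -big_split /=; apply: eq_bigr => b _.
case bD: (b \in D) => /=; first by rewrite inE bD.
case bU: (b \in up D) => /=; last by rewrite big1 // => c; rewrite andbF.
rewrite (bigD1 b) /=; last first.
  by rewrite !inE eqxx /= setU1K ?bD.
rewrite setU1K ?bD //; congr (_ + _); apply: eq_big => [c|c /andP[cU ncb]].
  by rewrite !inE; case: (eqVneq c b) => [->|]; rewrite ?bD //= ?andbT ?andbF // andbA andbb.
congr num_tab; apply/setP => d; rewrite !inE; have [->|//] := eqVneq d b.
by rewrite eq_sym (negPf ncb).
Qed.

(** Dually, once [c] is removed, the box added is either [c] again or a box [b] outside [D]; the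
    second hypothesis is the induction hypothesis of the next lemma. *)
Lemma sum_down_num_tab k D : downclosed D ->
  (forall c, c \in down D -> \sum_(b in up (D :\ c)) num_tab k.+1 (b |: (D :\ c)) =
                            k.+1 * num_tab k (D :\ c)) ->
  k.+1 * num_tab k.+1 D = #|down D| * num_tab k.+1 D +
    \sum_(c | c \in D) \sum_(b | (b \notin D) && ((c \in down D) && (b \in up (D :\ c))))
      num_tab k.+1 (b |: (D :\ c)).
Proof.
move=> dD IH.
rewrite -sum_nat_const [in LHS]/= big_distrr /= big_mkcond [X in _ = X + _]big_mkcond.
rewrite [X in _ = _ + X]big_mkcond -big_split /=; apply: eq_bigr => c _.
case cD: (c \in D) => /=; last by rewrite inE cD.
case cU: (c \in down D) => /=; last by rewrite big1 // => b; rewrite andbF.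
rewrite -IH // (bigD1 c) /=; last first.
  by rewrite !inE eqxx /= setD1K ?cD // dD.
rewrite setD1K //; congr (_ + _); apply: eq_bigl => b.
by rewrite !inE; case: (eqVneq b c) => [->|nbc]; rewrite ?cD //= ?andbT ?andbF // andbA andbb.
Qed.

(** This is the relation DU = UD + 1 of Young's lattice: by [up_down_comm] the two expansions above
    have the same mixed terms, and by [card_up] their first terms differ by one copy of
    [num_tab]. *)
Lemma sum_num_tab k D : downclosed D -> #|D| = k -> k < n ->
  \sum_(b in up D) num_tab k.+1 (b |: D) = k.+1 * num_tab k D.
Proof.
elim: k D => [|k IH] D dD cD kn.
  rewrite sum_up_num_tab // card_up ?cD // mulSn -addnA.
  have D0 : D = set0 by apply/eqP; rewrite -cards_eq0 cD.
  rewrite [X in _ + (X * _ + _)](_ : _ = 0); last first.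
    by apply/eqP; rewrite cards_eq0; apply/eqP/setP => b; rewrite !inE D0 inE.
  by rewrite big1 => [|b _]; [rewrite mulSn | rewrite big1 // => c; rewrite D0 inE].
rewrite sum_up_num_tab // card_up ?cD // mulSn -addnA [RHS]mulSn; congr (_ + _).
rewrite (@sum_down_num_tab k) //; last first.
  move=> c; rewrite inE => /andP[cinD dDc]; apply: IH => //; last exact: ltnW.
  by apply/eqP; rewrite -eqSS -cD [in X in _ == X](cardsD1 c) cinD.
congr (_ + _).
rewrite (exchange_big_dep (fun c => c \in D)) /=; last by move=> b c _ /andP[].
apply: eq_bigr => c cinD; apply: eq_bigl => b; rewrite cinD /=.
by case bD: (b \notin D) => //=; rewrite up_down_comm.
Qed.

(** One factor of each square is expanded over the removable boxes; summing instead over the smaller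
    diagram, [sum_num_tab] turns the other factor into [k.+1] times its number. *)
Lemma num_tab_sqr k : k <= n ->
  \sum_(D : {set box n} | downclosed D && (#|D| == k)) num_tab k D ^ 2 = k`!.
Proof.
elim: k => [|k IH] kn.
  rewrite (big_pred1 set0) // => D; rewrite cards_eq0 /=.
  by case: eqP => [->|]; rewrite ?andbF ?downclosed0.
rewrite factS -(IH (ltnW kn)) big_distrr /=.
under eq_bigr => D _ do rewrite -mulnn {1}/num_tab -/num_tab big_distrl /=.
transitivity (\sum_(D : {set box n} | downclosed D && (#|D| == k)) \sum_(b in up D)
   num_tab k D * num_tab k.+1 (b |: D)); last first.
  apply: eq_bigr => D /andP[dD /eqP cD].
  by rewrite -big_distrr /= (@sum_num_tab k) // mulnCA mulnn.
rewrite !pair_big_dep /=.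
(* A diagram with an added box corresponds to a larger diagram with a removed box. *)
pose h (x : {set box n} * box n) := (x.2 |: x.1, x.2).
pose h' (x : {set box n} * box n) := (x.1 :\ x.2, x.2).
rewrite (reindex_onto h h') => [|[D b] /=]; last first.
  by rewrite !inE => /andP[_ /andP[bD _]]; rewrite /h /h' /= setD1K.
apply: eq_big => [[D b]|[D b]] /=.
  rewrite !inE eqxx /=; case bD: (b \in D).
    rewrite /= !andbF; apply/negbTE/nandP; right.
    by apply/eqP => -[] /setP/(_ b); rewrite !inE eqxx bD.
  rewrite setU1K ?bD // /h' /h /= setU1K ?bD // eqxx andbT cardsU1 bD add1n eqSS.
  by rewrite andbC andbA [RHS]andbAC.
move=> /andP[_ /eqP[e]]; rewrite e //.
Qed.

(** The orders in which [D] can be filled: the box removed first is the one filled last, hence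
    [rcons]. *)
Fixpoint paths k D : seq (seq (box n)) :=
  if k is k'.+1 then
    [seq rcons p b | b <- enum (down D), p <- paths k' (D :\ b)]
  else [:: [::]].

Lemma size_paths k D : size (paths k D) = num_tab k D.
Proof.
elim: k D => //= k IH D; rewrite size_allpairs_dep sumnE big_map big_enum.
by apply: eq_bigr => b _.
Qed.

Lemma uniq_paths k D : uniq (paths k D).
Proof.
elim: k D => //= k IH D; apply: allpairs_uniq_dep => //; first exact: enum_uniq.
by move=> [b p] [b' p'] _ _ /= /rcons_inj[-> ->].
Qed.

Lemma pathsP k D p : downclosed D -> #|D| = k -> p \in paths k D ->
  [/\ size p = k, p =i D &
    forall x0 i j, i < k -> j < k -> box_le (nth x0 p i) (nth x0 p j) -> i <= j].
Proof.
elim: k D p => [|k IH] D p dD cD.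
  move/eqP: cD; rewrite cards_eq0 inE => /eqP -> /eqP ->.
  by split=> // b; rewrite !inE.
case/allpairsPdep => b [p' [+ p'P ->]].
rewrite mem_enum inE => /andP[bD dDb].
have cDb : #|D :\ b| = k by apply/eqP; rewrite -eqSS -cD [in X in _ == X](cardsD1 b) bD.
have [sp memp mono] := IH _ _ dDb cDb p'P; split; first by rewrite size_rcons sp.
  by move=> c; rewrite mem_rcons inE memp !inE; case: eqP => [->|].
move=> x0 i j ik jk; rewrite !nth_rcons sp.
case: (ltnP i k) => hi; case: (ltnP j k) => hj.
- exact: mono.
- by move=> _; lia.
- have -> : i = k by lia.
  rewrite eqxx => h; have /downclosedP/(_ _ _ h) := dDb.
  by rewrite -memp mem_nth ?sp // => /(_ isT); rewrite !inE eqxx.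
- by move=> _; lia.
Qed.

(** Each order of filling is a standard tableau. A lower bound is what the comparison with the n!
    spanning words asks for. *)
Lemma num_tab_stab (la : young n) : 0 < n -> num_tab n (val la) <= #|{: stab la}|.
Proof.
move=> n0; have /andP[/eqP cla dla'] := valP la.
have dla : downclosed (val la) by [].
pose x0 : box n := (Ordinal n0, Ordinal n0).
pose F (p : seq (box n)) : tableau n := [ffun i : 'I_n => nth x0 p i].
have F_inj : {in paths n (val la) &, injective F}.
  move=> p p' /(pathsP dla cla)[sp _ _] /(pathsP dla cla)[sp' _ _] /ffunP e.
  apply: (@eq_from_nth _ x0); rewrite sp ?sp' // => i ltin.
  by have := e (Ordinal ltin); rewrite !ffunE.
rewrite -size_paths -(size_map F) card_sig cardE.
apply: uniq_leq_size; first by rewrite map_inj_in_uniq ?uniq_paths.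
move=> _ /mapP[p /(pathsP dla cla)[sp memp mono] ->]; rewrite mem_enum unfold_in.
have inj : injective (F p).
  move=> i j; rewrite !ffunE => e; apply: val_inj => /=; apply/anti_leq.
  by apply/andP; split; apply: (mono x0) => //; [rewrite e|rewrite -e]; apply: box_le_refl.
apply/and3P; split.
- exact/injectiveP.
- rewrite eqEcard cla card_imset // card_ord leqnn andbT.
  by apply/fintype.subsetP => _ /imsetP[i _ ->]; rewrite ffunE -memp mem_nth ?sp.
apply/forallP => i; apply/forallP => j; apply/implyP => h.
have nij : i != j by apply: contraTneq h => ->; rewrite !ltnn !andbF.
rewrite ltn_neqAle nij /= (mono x0) //.
move: h; rewrite !ffunE /box_le.
by case/orP => /andP[/eqP -> /ltnW ->]; rewrite leqnn.
Qed.

(** A box with the largest sum of coordinates is removable. *)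
Lemma down_neq0 D : downclosed D -> D != set0 -> exists b, b \in down D.
Proof.
move=> /downclosedP dD /set0Pn[b0 b0D].
case: (@arg_maxnP _ b0 (fun b => b \in D) (fun b => b.1 + b.2) b0D) => b bD bmax.
exists b; rewrite inE bD; apply/downclosedP => c d dc; rewrite !inE => /andP[ncb cD].
rewrite (dD _ _ dc cD) andbT; apply: contra ncb => /eqP ed; subst d.
have := bmax c cD; case/andP: dc => h1 h2 h.
by apply/eqP/box_le_anti; rewrite /box_le; lia.
Qed.

Lemma num_tab_gt0 k D : downclosed D -> #|D| = k -> 0 < num_tab k D.
Proof.
elim: k D => // k IH D dD cD.
have [|b bD] := down_neq0 dD; first by rewrite -cards_eq0 cD.
rewrite /= (bigD1 b) //= addn_gt0 IH //; move: bD; rewrite inE => /andP[bD //].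
by move=> _; apply/eqP; rewrite -eqSS -cD [in X in _ == X](cardsD1 b) bD.
Qed.

Lemma stab_exists (la : young n) : 0 < n -> exists T : tableau n, is_standard la T.
Proof.
move=> n0; have /andP[/eqP cla dla] := valP la.
have := leq_trans (num_tab_gt0 dla cla) (num_tab_stab la n0).
by case/card_gt0P => T _; exists (val T); apply: valP.
Qed.

End Diagrams.

Lemma sum_stab_sqr n : 0 < n -> n`! <= \sum_(la : young n) #|{: stab la}| ^ 2.
Proof.
move=> n0; rewrite -(@num_tab_sqr n n) //.
rewrite (reindex_omap (val : young n -> _) insub) => [|D /andP[dD cD]]; last first.
  by rewrite insubT //; apply/andP.
rewrite (eq_bigl xpredT) => [|la].
  by apply: leq_sum => la _; rewrite leq_exp2r // num_tab_stab.
by rewrite valK eqxx andbT; have /andP[-> h] := valP la; rewrite andbT.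
Qed.

End YoungDiagrams.

(** * Standard tableaux *)

Section StandardTableaux.
Variable n : nat.
Implicit Types (la : young n) (T : tableau n) (i : 'I_n.-1) (b c : box n).
Local Open Scope nat_scope.

Lemma young_downclosed la : downclosed (val la).
Proof. by case/andP: (valP la). Qed.

Lemma card_young la : #|val la| = n.
Proof. by case/andP: (valP la) => /eqP. Qed.

Definition box_content b : int := (b.2%:Z - b.1%:Z)%R.

Lemma contentE T k : content T k = box_content (T k). Proof. by []. Qed.

Lemma tperm_entry i (k : 'I_n) : tperm (entry i) (entryS i) k =
  (if (k : nat) == i then i.+1 else if (k : nat) == i.+1 then i : nat else k) :> nat.
Proof.
case: tpermP => [->|->|/eqP + /eqP +]; rewrite -?val_eqE /= ?eqxx //.
  by rewrite (_ : (i.+1 == i) = false) //; apply/eqP; lia.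
by move=> /negPf -> /negPf ->.
Qed.

(** An adjacent transposition reverses the order of a single pair of entries, which is left out on
    both sides. *)
Lemma tperm_entry_lt i (k l : 'I_n) (s := tperm (entry i) (entryS i)) :
  (s k < s l) && ((s k, s l) != (entry i, entryS i)) =
  (k < l) && ((k, l) != (entry i, entryS i)).
Proof.
rewrite !xpair_eqE -!val_eqE /= /s !tperm_entry.
by case: (eqVneq (k : nat) i); case: (eqVneq (k : nat) i.+1);
  case: (eqVneq (l : nat) i); case: (eqVneq (l : nat) i.+1); lia.
Qed.

(** The difference is at most the column of one box plus the row of the other, and a hook with this
    arm and this leg lies in [D]. *)
Lemma content_diff_lt (D : {set box n}) b c : downclosed D -> b \in D -> c \in D ->
  (`|box_content b - box_content c| < #|D|%:Z)%R.
Proof.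
move=> /downclosedP dD.
suff key b' c' : b' \in D -> c' \in D -> b'.2 + c'.1 < #|D|.
  move=> bD cD; rewrite /box_content.
  have := key _ _ bD cD; have := key _ _ cD bD.
  move: (b.1 : nat) (b.2 : nat) (c.1 : nat) (c.2 : nat) #|D| => *; lia.
move: b' c' => {}b {}c; move=> bD cD; pose z : 'I_n := Ordinal (leq_ltn_trans (leq0n _)
  (ltn_ord b.1)).
(* [f] runs along the first row up to column [b.2], where the truncated [k - b.2] is 0, and then
   down the first column. *)
pose f (k : 'I_(b.2 + c.1).+1) : box n :=
  (insubd z (k - b.2), insubd z (if k <= b.2 then k : nat else 0)).
have fE (k : 'I_(b.2 + c.1).+1) :
    (f k).1 = k - b.2 :> nat /\ (f k).2 = (if k <= b.2 then k : nat else 0) :> nat.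
  rewrite /f /= !insubdK //.
    rewrite unfold_in; case: (leqP k b.2) => kb; first exact: leq_ltn_trans kb (ltn_ord _).
    exact: leq_ltn_trans (leq0n _) (ltn_ord b.1).
  rewrite unfold_in; apply: leq_ltn_trans (ltn_ord c.1).
  by have := ltn_ord k; lia.
have f_inj : injective f.
  move=> k l e; apply: val_inj => /=; have [k1 k2] := fE k; have [l1 l2] := fE l.
  move: k1 k2; rewrite e l1 l2; by case: (leqP k b.2); case: (leqP l b.2); lia.
rewrite -[X in X <= _](card_ord (b.2 + c.1).+1) -(card_imset _ f_inj).
apply/subset_leq_card/fintype.subsetP => _ /imsetP[k _ ->].
have [k1 k2] := fE k; have := ltn_ord k; move: k2; case: (leqP k b.2) => kb k2 ltk.
  by apply: dD bD; rewrite /box_le k1 k2; lia.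
by apply: dD cD; rewrite /box_le k1 k2; lia.
Qed.

Section Standard.
Variables (la : young n) (T : tableau n).
Hypothesis stdT : is_standard la T.

Lemma std_inj : injective T.
Proof. by case/and3P: stdT => /injectiveP. Qed.

Lemma std_image : [set T k | k : 'I_n] = val la.
Proof. by case/and3P: stdT => _ /eqP. Qed.

Lemma std_mem k : T k \in val la.
Proof. by rewrite -std_image imset_f. Qed.

Lemma std_surj b : b \in val la -> exists k, b = T k.
Proof. by rewrite -std_image => /imsetP[k _ ->]; exists k. Qed.

Lemma std_lt k l :
  ((T k).1 == (T l).1) && ((T k).2 < (T l).2) ||
  ((T k).2 == (T l).2) && ((T k).1 < (T l).1) -> k < l.
Proof. by case/and3P: stdT => _ _ /forallP/(_ k)/forallP/(_ l)/implyP. Qed.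

(** Standardness compares only boxes in one row or one column; the box in the row of [T k] and the
    column of [T l] links the two. *)
Lemma std_le k l : box_le (T k) (T l) -> k <= l.
Proof.
case/andP=> h1 h2.
have : ((T k).1, (T l).2) \in val la.
  have /downclosedP := young_downclosed la; apply; last exact: (std_mem l).
  by rewrite /box_le h1 leqnn.
case/std_surj => m em.
apply: (@leq_trans m).
  move: h2; rewrite leq_eqVlt => /orP[/eqP h2|h2].
    by rewrite (_ : k = m) //; apply: std_inj; rewrite -em -(val_inj h2); case: (T k).
  by apply/ltnW/std_lt; rewrite -em /= eqxx h2.
move: h1; rewrite leq_eqVlt => /orP[/eqP h1|h1].
  by rewrite (_ : l = m) //; apply: std_inj; rewrite -em (val_inj h1); case: (T l).
by apply/ltnW/std_lt; rewrite -em /= eqxx h1 orbT.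
Qed.

Lemma std_between k l b : box_le (T k) b -> box_le b (T l) ->
  exists m, [/\ b = T m, k <= m & m <= l].
Proof.
move=> kb bl; have : b \in val la.
  by have /downclosedP := young_downclosed la; apply; first exact: bl; exact: std_mem.
by case/std_surj => m e; exists m; rewrite !std_le // -e.
Qed.

Lemma std_prefix (k : nat) : downclosed [set T j | j : 'I_n & j < k].
Proof.
apply/downclosedP => b c cb /imsetP[j]; rewrite inE => jk ej; rewrite {b}ej in cb.
have : c \in val la.
  by have /downclosedP := young_downclosed la; apply; first exact: cb; exact: std_mem.
case/std_surj => m e; rewrite e imset_f // inE; apply: leq_ltn_trans jk.
by apply: std_le; rewrite -e.
Qed.

Lemma std_axial_lt k l : (`|axial_distance T k l| < n%:Z)%R.
Proof.
have := content_diff_lt (young_downclosed la) (std_mem k) (std_mem l).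
by rewrite card_young.
Qed.

(** The rectangle spanned by the two boxes can only hold the entries [entry i] and [entryS i], so
    that it consists of these two boxes. *)
Lemma std_adjacent i : let b := T (entry i) in let c := T (entryS i) in
  box_le b c ->
  (b.1 = c.1) /\ (c.2 = b.2.+1 :> nat) \/ (b.2 = c.2) /\ (c.1 = b.1.+1 :> nat).
Proof.
move=> b c bc; have /andP[h1 h2] := bc.
have two x : box_le b x -> box_le x c -> x = b \/ x = c.
  move=> bx xc; have [m [-> km ml]] := std_between bx xc.
  have [em|em] : m = entry i :> nat \/ m = entryS i :> nat.
  - by move: km ml => /=; lia.
  - by left; congr (T _); apply: val_inj.
  - by right; congr (T _); apply: val_inj.
have nbc : b != c.
  by apply/eqP => /std_inj /(congr1 val) /=; lia.
have [e|e] : (b.1, c.2) = b \/ (b.1, c.2) = c by apply: two; rewrite /box_le /= ?leqnn ?h1 ?h2.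
  right; have e2 : c.2 = b.2 by rewrite -e.
  split=> //; move: h1; rewrite leq_eqVlt => /orP[/eqP e1|h1].
    by case/eqP: nbc; rewrite [b]surjective_pairing [c]surjective_pairing e2 (val_inj e1).
  have lt : b.1.+1 < n by apply: leq_ltn_trans h1 _.
  have [/(congr1 (fun x : box n => x.1 : nat)) /= | <- //] :
      (Ordinal lt, b.2) = b \/ (Ordinal lt, b.2) = c.
    by apply: two; rewrite /box_le /= ?e2 ?leqnn ?leqnSn ?h1.
  by lia.
left; have e1 : b.1 = c.1 by rewrite -e.
split=> //; move: h2; rewrite leq_eqVlt => /orP[/eqP e2|h2].
  by case/eqP: nbc; rewrite [b]surjective_pairing [c]surjective_pairing e1 (val_inj e2).
have lt : b.2.+1 < n by apply: leq_ltn_trans h2 _.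
have [/(congr1 (fun x : box n => x.2 : nat)) /= | <- //] :
    (b.1, Ordinal lt) = b \/ (b.1, Ordinal lt) = c.
  by apply: two; rewrite /box_le /= ?e1 ?leqnn ?leqnSn ?h2.
by lia.
Qed.

Lemma std_nle i : ~~ box_le (T (entryS i)) (T (entry i)).
Proof. by apply/negP => /std_le /=; rewrite ltnn. Qed.

Variant axial_spec i : bool -> bool -> int -> Prop :=
| AxialRow of (T (entryS i)).2 = (T (entry i)).2.+1 :> nat :
    axial_spec i true false (-1)%R
| AxialCol of (T (entryS i)).1 = (T (entry i)).1.+1 :> nat :
    axial_spec i false true 1%R
| AxialPos (d : int) of (1 < d)%R & (T (entry i)).1 < (T (entryS i)).1
    & (T (entryS i)).2 < (T (entry i)).2 : axial_spec i false false d
| AxialNeg (d : int) of (d < -1)%R & (T (entryS i)).1 < (T (entry i)).1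
    & (T (entry i)).2 < (T (entryS i)).2 : axial_spec i false false d.

Lemma axialP i : axial_spec i ((T (entry i)).1 == (T (entryS i)).1)
  ((T (entry i)).2 == (T (entryS i)).2) (axial_distance T (entry i) (entryS i)).
Proof.
have := @std_adjacent i; have := std_nle i; rewrite /axial_distance /content.
set b := T (entry i); set c := T (entryS i); rewrite /box_le => nle adj.
have eq1 : (b.1 == c.1) = (b.1 == c.1 :> nat) by [].
have eq2 : (b.2 == c.2) = (b.2 == c.2 :> nat) by [].
case: (boolP (box_le b c)) => bc.
  case: (adj bc) => -[e1 e2].
    rewrite e1 eqxx eq2 e2 (_ : (_ == _) = false); last by apply/eqP; lia.
    by rewrite (_ : (_ - _)%R = (-1)%R); [constructor | lia].
  rewrite e1 eqxx eq1 e2 (_ : (_ == _) = false); last by apply/eqP; lia.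
  by rewrite (_ : (_ - _)%R = 1%R); [constructor | lia].
move: bc nle; rewrite /box_le !negb_and -!ltnNge => h1 h2.
have [h|h] : (b.1 < c.1 /\ c.2 < b.2) \/ (c.1 < b.1 /\ b.2 < c.2) by lia.
all: have -> : (b.1 == c.1) = false by rewrite eq1; apply/eqP; lia.
all: have -> : (b.2 == c.2) = false by rewrite eq2; apply/eqP; lia.
  by apply: AxialPos; rewrite -/b -/c; lia.
by apply: AxialNeg; rewrite -/b -/c; lia.
Qed.

Lemma axial_neq0 i : axial_distance T (entry i) (entryS i) != 0%R.
Proof. by case: axialP => // d; lia. Qed.

(** On a common diagonal the two boxes would span a rectangle whose other two corners both hold the
    single entry in between. This keeps the denominator 1 - q^(x+y) of the braid relation away from
    0. *)
Lemma content_step2 (i j : 'I_n.-1) : j = i.+1 :> nat ->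
  axial_distance T (entry i) (entryS j) != 0%R.
Proof.
move=> ji; apply/eqP; rewrite /axial_distance /content.
set b := T (entry i); set c := T (entryS j) => e.
have nbc : b != c by apply/eqP => /std_inj /(congr1 val) /=; lia.
have bc : box_le b c.
  have [//|cb] : box_le b c \/ box_le c b by rewrite /box_le; lia.
  by have := std_le cb; rewrite /= ji; lia.
have [h1 h2] : b.1 < c.1 /\ b.2 < c.2.
  suff : b.1 <> c.1 :> nat by move: bc; rewrite /box_le; lia.
  move=> e1; case/eqP: nbc; rewrite [b]surjective_pairing [c]surjective_pairing.
  by congr pair; apply: val_inj; [|move: e e1] => /=; lia.
have mid x : box_le b x -> box_le x c -> x != b -> x != c -> x = T (entryS i).
  move=> bx xc; have [m [-> km ml]] := std_between bx xc.
  rewrite !(inj_eq std_inj) -!(inj_eq val_inj) /= => n1 n2.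
  by congr (T _); apply: val_inj => /=; move: km ml n1 n2 => /=; lia.
have e1 : (b.1, c.2) = T (entryS i).
  apply: mid; rewrite /box_le /= ?leqnn ?(ltnW h1) ?(ltnW h2) //.
    by apply/eqP => /(congr1 (fun x : box n => x.2 : nat)) /=; lia.
  by apply/eqP => /(congr1 (fun x : box n => x.1 : nat)) /=; lia.
have e2 : (c.1, b.2) = T (entryS i).
  apply: mid; rewrite /box_le /= ?leqnn ?(ltnW h1) ?(ltnW h2) //.
    by apply/eqP => /(congr1 (fun x : box n => x.1 : nat)) /=; lia.
  by apply/eqP => /(congr1 (fun x : box n => x.2 : nat)) /=; lia.
by move: h1; rewrite [b.1](congr1 (fst : box n -> _) (etrans e1 (esym e2))) ltnn.
Qed.

Lemma swap_std i : (T (entry i)).1 != (T (entryS i)).1 ->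
  (T (entry i)).2 != (T (entryS i)).2 -> is_standard la (swap_tab i T).
Proof.
move=> n1 n2; apply/and3P; split.
- by apply/injectiveP => k l; rewrite !ffunE => /std_inj/perm_inj.
- rewrite -std_image; apply/eqP/setP => b; apply/imsetP/imsetP => -[k _ ->].
    by rewrite ffunE; eexists.
  by exists (tperm (entry i) (entryS i) k); rewrite // ffunE tpermK.
apply/forallP => k; apply/forallP => l; apply/implyP; rewrite !ffunE => h.
have lt_s := std_lt h; have := tperm_entry_lt i k l; rewrite /= lt_s /=.
case: ((tperm (entry i) (entryS i) k, tperm (entry i) (entryS i) l) =P (entry i, entryS i))
  h => [[-> ->]|_ _ /esym/andP[] //].
by rewrite (negPf n1) (negPf n2).
Qed.

End Standard.

Lemma swap_tabK i : involutive (swap_tab i).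
Proof. by move=> T; apply/ffunP => k; rewrite !ffunE tpermK. Qed.

Lemma content_swap i T k :
  content (swap_tab i T) k = content T (tperm (entry i) (entryS i) k).
Proof. by rewrite /content ffunE. Qed.

Lemma std_shape_inj (la mu : young n) T : is_standard la T -> is_standard mu T -> la = mu.
Proof. by move=> h1 h2; apply: val_inj; rewrite /= -(std_image h1) -(std_image h2). Qed.

Lemma std_first la T (k : 'I_n) : is_standard la T -> k = 0 :> nat -> content T k = 0%R.
Proof.
move=> stdT k0.
have lt : 0 < n by apply: leq_ltn_trans (ltn_ord k).
have zle : box_le (Ordinal lt, Ordinal lt) (T k) by [].
have : (Ordinal lt, Ordinal lt) \in val la.
  by have /downclosedP := young_downclosed la; apply; first exact: zle; exact: std_mem.
case/(std_surj stdT) => m em; have mk : m <= k by apply: (std_le stdT); rewrite -em.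
have -> : k = m by apply: val_inj => /=; lia.
by rewrite /content -em.
Qed.

Lemma first_difference T S : T != S ->
  exists2 k : 'I_n, T k != S k & forall j : 'I_n, j < k -> T j = S j.
Proof.
move=> neTS; have [k0 nek0] : exists k, T k != S k.
  by apply/existsP; apply: contraR neTS => /existsPn h; apply/eqP/ffunP => k; apply/eqP/negPn.
case: (@arg_minnP _ k0 (fun k => T k != S k) (fun k => k : nat) nek0) => k nek mink.
by exists k => // j jk; apply: contraTeq jk => /mink; rewrite -leqNgt.
Qed.

(** Let [k] be the first entry placed differently. [T k] and [S k] are distinct addable boxes of one
    diagram, hence incomparable, and incomparable boxes have different contents. *)
Lemma std_separate la mu T S : is_standard la T -> is_standard mu S -> T != S ->
  exists2 k : 'I_n, content T k != content S k &
    (`|content T k - content S k| <= n%:Z)%R.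
Proof.
move=> stdT stdS neTS.
have [k nek mink] := first_difference neTS.
(* The boxes of [V] up to entry [k] form a diagram; if it contained [U k], this box would be [V k]
   or an earlier box of [U]. *)
have no_le (U V : tableau n) la' mu' : is_standard la' U -> is_standard mu' V ->
    U k != V k -> (forall j : 'I_n, j < k -> U j = V j) -> ~~ box_le (U k) (V k).
  move=> stdU stdV neUV eqUV; apply/negP => le.
  have /downclosedP/(_ _ _ le) := std_prefix stdV k.+1.
  rewrite imset_f ?inE // => /(_ isT) /imsetP[j]; rewrite inE ltnS leq_eqVlt.
  case/predU1P => [/val_inj -> e|jk]; first by rewrite e eqxx in neUV.
  by rewrite -eqUV // => /(std_inj stdU) e; rewrite e ltnn in jk.
have leTS := no_le T S _ _ stdT stdS nek mink.
have leST : ~~ box_le (S k) (T k).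
  by apply: no_le stdS stdT _ _ => [|j /mink]; rewrite // eq_sym.
exists k; first by move: leTS leST; rewrite /content /box_le; lia.
pose D (U : tableau n) := [set U j | j : 'I_n & j < k.+1].
have dD : downclosed (D T :|: D S).
  apply/downclosedP => b c bc; rewrite !inE => /orP[] bD.
    by have /downclosedP/(_ _ _ bc bD) -> := std_prefix stdT k.+1.
  by have /downclosedP/(_ _ _ bc bD) -> := std_prefix stdS k.+1; rewrite orbT.
have inD (U : tableau n) : U k \in D U by rewrite imset_f // inE.
have := content_diff_lt dD (_ : T k \in _) (_ : S k \in _).
rewrite !inE !inD orbT => /(_ isT isT) lt_card.
(* Besides the boxes of [T] only [S k] can occur, since the earlier entries agree. *)
suff card_le : #|D T :|: D S| <= n.+1.
  by move: lt_card card_le; rewrite -!contentE; move: #|_| => m; lia.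
apply: (@leq_trans #|S k |: [set T j | j : 'I_n]|); last first.
  by rewrite cardsU1 -add1n leq_add ?leq_b1 // -[X in _ <= X](card_ord n) leq_imset_card.
apply/subset_leq_card/fintype.subsetP => b; rewrite !inE => /orP[] /imsetP[j].
  by move=> _ ->; rewrite imset_f ?orbT.
rewrite inE ltnS leq_eqVlt => /predU1P[/val_inj -> ->|jk ->]; first by rewrite eqxx.
by rewrite -mink // imset_f ?orbT.
Qed.

Definition inversion_set T :=
  [set kl : 'I_n * 'I_n | (kl.1 < kl.2) && ((T kl.2).1 < (T kl.1).1)].

(* The pairs of entries other than [(i, i + 1)] are permuted by the transposition. *)
Lemma inversions_split i T :
  exists m, inversions T = ((T (entryS i)).1 < (T (entry i)).1) + m /\
    inversions (swap_tab i T) = ((T (entry i)).1 < (T (entryS i)).1) + m.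
Proof.
pose a := (entry i, entryS i); pose s := tperm (entry i) (entryS i).
pose f (kl : 'I_n * 'I_n) := (s kl.1, s kl.2).
have f_inj : injective f by move=> [k l] [k' l'] [/perm_inj -> /perm_inj ->].
exists #|inversion_set T :\ a|; split.
  by rewrite /inversions -/(inversion_set T) (cardsD1 a) inE /= ltnSn.
rewrite /inversions -/(inversion_set (swap_tab i T)) (cardsD1 a) inE /= ltnSn /=.
rewrite !ffunE tpermL tpermR; congr (_ + _).
rewrite -(card_preimset _ f_inj); apply: eq_card => -[k l]; rewrite !inE /= !ffunE.
have := tperm_entry_lt i k l; rewrite /= -/s -/a => e.
by rewrite /s !tpermK -/s !andbA [_ && (s k < s l)]andbC [_ && (k < l)]andbC e.
Qed.

Lemma inversions_swap i T : (T (entry i)).1 != (T (entryS i)).1 ->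
  odd (inversions (swap_tab i T)) = ~~ odd (inversions T).
Proof.
rewrite -val_eqE /= => ne; have [m [-> ->]] := inversions_split i T.
by rewrite !oddD; case: ltngtP ne => //= _ _; case: odd.
Qed.

(** At the first difference each tableau fills the other's box later. Without inversions the two
    boxes are then in one row, where the left one has to be filled first in both tableaux. *)
Lemma std_inversions_eq0 la T S : is_standard la T -> is_standard la S ->
  inversions T = 0 -> inversions S = 0 -> T = S.
Proof.
move=> stdT stdS iT iS; apply: contraTeq isT => neTS.
have [k nek mink] := first_difference neTS.
have row_mono U : inversions U = 0 -> forall j l : 'I_n, j < l -> (U j).1 <= (U l).1.
  move=> /eqP; rewrite cards_eq0 => /eqP/setP iU j l jl.
  by have := iU (j, l); rewrite !inE /= jl /= ltnNge => /negbFE.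
have later U V : is_standard la U -> is_standard la V -> U k != V k ->
    (forall j : 'I_n, j < k -> U j = V j) -> exists2 m : 'I_n, U k = V m & k < m.
  move=> stdU stdV neUV eqUV; have [m em] := std_surj stdV (std_mem stdU k).
  exists m => //; case: (ltngtP k m) => // [mk|/val_inj ekm].
    by move: em; rewrite -eqUV // => /(std_inj stdU) e; rewrite e ltnn in mk.
  by rewrite em ekm eqxx in neUV.
have [m em km] := later _ _ stdT stdS nek mink.
have [m' em' km'] : exists2 m : 'I_n, S k = T m & k < m.
  by apply: later => // [|j /mink //]; rewrite eq_sym.
have := row_mono _ iS _ _ km; have := row_mono _ iT _ _ km'; rewrite -em -em' => r1 r2.
have r : (T k).1 = (S k).1 by apply: val_inj; apply/anti_leq; rewrite r1 r2.
case: (ltngtP (T k).2 (S k).2) => h.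
- have := @std_lt _ _ stdS m k; rewrite -em r eqxx h => /(_ isT).
  by rewrite ltnNge (ltnW km).
- have := @std_lt _ _ stdT m' k; rewrite -em' r eqxx h => /(_ isT).
  by rewrite ltnNge (ltnW km').
- case/eqP: nek; rewrite [T k]surjective_pairing [S k]surjective_pairing r.
  by rewrite (val_inj h).
Qed.

(** Exchanging adjacent entries with the later one in a higher row lowers the number of inversions,
    so that every tableau is joined to the one without inversions. Both directions are carried along
    because [P] is not assumed symmetric. *)
Lemma swap_connected la (P : tableau n -> tableau n -> Prop) :
  (forall T, is_standard la T -> P T T) ->
  (forall T1 T2 T3, P T1 T2 -> P T2 T3 -> P T1 T3) ->
  (forall i T, is_standard la T -> is_standard la (swap_tab i T) -> P T (swap_tab i T)) ->
  forall T S, is_standard la T -> is_standard la S -> P T S.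
Proof.
move=> Prefl Ptrans Pswap.
suff key T : is_standard la T ->
    exists T0, [/\ is_standard la T0, inversions T0 = 0, P T T0 & P T0 T].
  move=> T S stdT stdS; have [T0 [stdT0 iT0 PT _]] := key _ stdT.
  have [S0 [stdS0 iS0 _ PS]] := key _ stdS.
  by apply: Ptrans PT _; rewrite (std_inversions_eq0 stdT0 stdS0).
have [m] := ubnP (inversions T); elim: m T => // m IH T; rewrite ltnS => le_m stdT.
case: (boolP [exists i : 'I_n.-1, (T (entryS i)).1 < (T (entry i)).1]).
  case/existsP => i lt_i.
  have stdS : is_standard la (swap_tab i T).
    apply: swap_std => //; first by rewrite -val_eqE neq_ltn lt_i orbT.
    by case: (axialP stdT i) => // e; rewrite e ltnNge leqnSn in lt_i.
  have [c [eT eS]] := inversions_split i T.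
  have [|T0 [stdT0 iT0 P1 P2]] := IH _ _ stdS.
    by apply: leq_trans le_m; rewrite eT eS; case: ltngtP lt_i.
  exists T0; split=> //; [apply: Ptrans P1|apply: (Ptrans _ _ _ P2)]; first exact: Pswap.
  by rewrite -{2}[T](swap_tabK i); apply: Pswap; rewrite ?swap_tabK.
(* Rows now increase weakly from each entry to the next, hence along all entries. *)
move/existsPn => row_le; exists T; split; try exact: Prefl; rewrite //.
have row_mono (j l : 'I_n) : j <= l -> (T j).1 <= (T l).1.
  move=> jl; have [d ed] : exists d, l = j + d :> nat by exists (l - j); rewrite subnKC.
  elim: d l ed {jl} => [|d IHd] l ed; first by rewrite (_ : j = l) //; apply: val_inj => /=; lia.
  have lt : j + d < n.-1 by have := ltn_ord l; lia.
  have h := row_le (Ordinal lt); rewrite -leqNgt in h.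
  have -> : l = entryS (Ordinal lt) by apply: val_inj => /=; lia.
  by apply: leq_trans h; apply: IHd.
apply/eqP; rewrite cards_eq0; apply/eqP/setP => -[j l]; rewrite !inE /=.
by case: ltnP => //= jl; rewrite ltnNge row_mono // ltnW.
Qed.

End StandardTableaux.

(** The points that are not fixed come in pairs [x], [f x], and comparing ranks selects one point of
    each pair. *)
Lemma odd_card_involution (T : finType) (f : T -> T) (A : {set T}) :
  involutive f -> (forall x, x \in A -> f x \in A) ->
  odd #|A| = odd #|[set x in A | f x == x]|.
Proof.
move=> fK fA; have memA x : (f x \in A) = (x \in A).
  by apply/idP/idP => /fA; rewrite ?fK.
pose B := [set x in A | (enum_rank x < enum_rank (f x))%N].
have cB : #|[set x in A | (enum_rank (f x) < enum_rank x)%N]| = #|B|.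
  rewrite -(card_preimset _ (inv_inj fK)); apply: eq_card => x.
  by rewrite !inE memA fK.
have -> : #|A| = (#|[set x in A | f x == x]| + (#|B| + #|B|))%N.
  rewrite -(cardsID [set x | f x == x]); congr (_ + _)%N.
    by apply: eq_card => x; rewrite !inE.
  rewrite -[in LHS](cardsID [set x | (enum_rank x < enum_rank (f x))%N]).
  congr (_ + _)%N; last rewrite -cB; apply: eq_card => x; rewrite !inE.
    case: (eqVneq (f x) x) => [->|]; first by rewrite ltnn !andbF.
    by rewrite andbC.
  case: (eqVneq (f x) x) => [->|nfx]; first by rewrite ltnn !andbF.
  rewrite andbC /= -leqNgt leq_eqVlt orbC andbC; case: eqP => [/val_inj/enum_rank_inj e|_].
    by rewrite e eqxx in nfx.
  by rewrite orbF andbC.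
by rewrite addnn oddD odd_double addbF.
Qed.

(** * Transposition of tableaux and the parity of inversions *)

Section Transpose.
Variable n : nat.
Implicit Types (la : young n) (T : tableau n) (i : 'I_n.-1) (b c : box n).
Local Open Scope nat_scope.

Lemma tr_boxK : involutive (@tr_box n). Proof. by case. Qed.

Lemma tr_tabK : involutive (@tr_tab n).
Proof. by move=> T; apply/ffunP => k; rewrite !ffunE tr_boxK. Qed.

Lemma mem_tr la b : (b \in val (tr_young la)) = (tr_box b \in val la).
Proof.
apply/imsetP/idP => [[c cla ->]|h]; first by rewrite tr_boxK.
by exists (tr_box b); rewrite ?tr_boxK.
Qed.

Lemma tr_youngK : involutive (@tr_young n).
Proof. by move=> la; apply/val_inj/setP => b; rewrite !mem_tr tr_boxK. Qed.

Lemma tr_std la T : is_standard la T -> is_standard (tr_young la) (tr_tab T).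
Proof.
move=> stdT; apply/and3P; split.
- by apply/injectiveP => k l; rewrite !ffunE => /(inv_inj tr_boxK)/(std_inj stdT).
- rewrite -[X in _ == X]/[set tr_box b | b in val la] -(std_image stdT).
  by rewrite -imset_comp; apply/eqP/eq_imset => k; rewrite /= ffunE.
apply/forallP => k; apply/forallP => l; apply/implyP; rewrite !ffunE /= => h.
by apply: (std_lt stdT); rewrite orbC.
Qed.

Lemma swap_tr i T : swap_tab i (tr_tab T) = tr_tab (swap_tab i T).
Proof. by apply/ffunP => k; rewrite !ffunE. Qed.

Lemma content_tr T k : content (tr_tab T) k = (- content T k)%R.
Proof. by rewrite /content ffunE /= opprB. Qed.

(** Among the pairs of boxes with the first strictly to the north-east of the second, those whose
    first box is filled later are the inversions of [T], the others those of [tr_tab T]. Transposing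
    and exchanging the two boxes is an involution on these pairs, whose fixed points are given by
    the boxes above the diagonal. *)
Lemma odd_inversions_tr la T : is_standard la T -> tr_young la = la ->
  odd (inversions T + inversions (tr_tab T)) = odd (above_diagonal la).
Proof.
move=> stdT tla.
pose R b c := (b.1 < c.1) && (c.2 < b.2).
pose NE := [set x : box n * box n | [&& x.1 \in val la, x.2 \in val la & R x.1 x.2]].
pose f (x : box n * box n) := (tr_box x.2, tr_box x.1).
have mla b : (tr_box b \in val la) = (b \in val la) by rewrite -mem_tr tla.
transitivity (odd #|NE|); last first.
  rewrite (@odd_card_involution _ f).
  - congr odd; rewrite /above_diagonal -(card_imset _ (f := fun b => (b, tr_box b))); last first.
      by move=> b c [].
    apply: eq_card => -[b c]; rewrite inE; apply/andP/imsetP.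
      rewrite inE /= => -[/and3P[bla _ /andP[+ +]] /eqP[_ ec]].
      by rewrite -ec => h _; exists b; rewrite ?inE ?bla.
    case=> d; rewrite inE => /andP[dla dlt] [-> ->].
    by rewrite !inE /= mla dla /R /= dlt /f /= tr_boxK.
  - by case=> x y; rewrite /f /= !tr_boxK.
  - by case=> x y; rewrite !inE /= !mla /R /= => /and3P[-> -> /andP[-> ->]].
congr odd.
pose g (kl : 'I_n * 'I_n) := (T kl.1, T kl.2).
have g_inj : injective g by move=> [k l] [k' l'] [/(std_inj stdT) -> /(std_inj stdT) ->].
pose M := [set kl : 'I_n * 'I_n | R (T kl.1) (T kl.2)].
have -> : NE = g @: M.
  apply/setP => -[b c]; rewrite inE /=; apply/and3P/imsetP.
    case=> /(std_surj stdT)[k ->] /(std_surj stdT)[l ->] h.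
    by exists (k, l); rewrite ?inE.
  by case=> -[k l]; rewrite inE /= => h [-> ->]; rewrite !(std_mem stdT).
rewrite card_imset // -(cardsID [set kl : 'I_n * 'I_n | kl.1 < kl.2]).
have not_le (k l : 'I_n) : k < l -> ~~ box_le (T l) (T k).
  by move=> kl; apply: contraL kl => /(std_le stdT); rewrite -leqNgt.
rewrite addnC; congr (_ + _).
  apply: eq_card => -[k l]; rewrite !inE /= !ffunE /= andbC.
  by case kl: (k < l) => //; rewrite ?andbF ?andbT // /R; have := not_le _ _ kl;
    rewrite /box_le; lia.
rewrite -(card_preimset _ (f := fun kl : 'I_n * 'I_n => (kl.2, kl.1)));
  last by move=> [? ?] [? ?] [-> ->].
apply: eq_card => -[k l]; rewrite !inE /= /R.
case: (ltngtP k l) => kl /=.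
- by have := not_le _ _ kl; rewrite /box_le; lia.
- by [].
- by rewrite (val_inj kl) !ltnn.
Qed.

Section Plus.
Hypothesis n_ge2 : 1 < n.

(** The first entry occupies the corner, and the second is next to it either in the first row or in
    the first column. *)
Lemma is_plus_tr la T : is_standard la T -> is_plus (tr_tab T) = ~~ is_plus T.
Proof.
move=> stdT.
have lt0 : 0 < n.-1 by lia.
pose i0 : 'I_n.-1 := Ordinal lt0.
have T0 : T (entry i0) = (entry i0, entry i0).
  have : (entry i0, entry i0) \in val la.
    have /downclosedP := young_downclosed la; apply; last exact: (std_mem stdT (entry i0)).
    by [].
  case/(std_surj stdT) => k ek.
  have := @std_le _ _ _ stdT k (entry i0); rewrite -ek => /(_ isT) /=.
  rewrite leqn0 => /eqP k0; rewrite ek; congr (T _); exact: val_inj.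
have plusE (U : tableau n) : (U (entry i0)).1 = 0 :> nat -> (U (entry i0)).2 = 0 :> nat ->
    is_plus U = ((U (entryS i0)).1 == 0 :> nat) && ((U (entryS i0)).2 == 1 :> nat).
  move=> U1 U2; apply/forallP/idP => [/(_ (entryS i0)) //|h k].
  apply/implyP => k2; have [e|e] : k = entry i0 \/ k = entryS i0.
  - by case: (posnP k) => k0; [left|right]; apply: val_inj => /=; lia.
  - by rewrite e U1 U2.
  - by rewrite e.
have [b1 eb1] : exists b1 : bool, b1 = ((T (entry i0)).1 == (T (entryS i0)).1) by eexists.
have [b2 eb2] : exists b2 : bool, b2 = ((T (entry i0)).2 == (T (entryS i0)).2) by eexists.
have := axialP stdT i0; rewrite -eb1 -eb2 => ax.
rewrite !plusE ?ffunE ?T0 //=.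
case: ax eb1 eb2 => [h /esym/eqP e1 _|h _ /esym/eqP e2|d _ h1 h2|d _ h1 h2].
- by rewrite -e1 h T0.
- by rewrite -e2 h T0.
- by rewrite T0 in h2.
- by rewrite T0 in h1.
Qed.
End Plus.

End Transpose.

(** * The seminormal representations *)

Section SeminormalForm.
Context (K : numClosedFieldType) (n : nat) (q : K).
Implicit Types (la : young n) (i : 'I_n.-1) (T : tableau n).
Local Notation v := (tab_vec K).
Local Notation G := (seminormal_gen q).

(* At [d = -1] and [d = 1], that is for neighbours in a row or in a column, these
   coefficients are [q] and [-1] and [off_coef] is [0]: no separate case is needed. *)
Definition diag_coef (d : int) : K := (q - 1) / (1 - q ^ d).
Definition off_coef (d : int) : K := seminormal_block q `|d| 0 1.

Lemma off_coefN d : off_coef (- d) = off_coef d.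
Proof. by rewrite /off_coef normrN. Qed.

Lemma seminormal_blockE d :
  let e := sqrtC (q * (1 - q ^ (d - 1)) * (1 - q ^ (d + 1))) in
  [/\ seminormal_block q d 0 0 = (1 - q ^ d)^-1 * (q ^ d * (1 - q)),
      seminormal_block q d 0 1 = (1 - q ^ d)^-1 * e,
      seminormal_block q d 1 0 = (1 - q ^ d)^-1 * e
    & seminormal_block q d 1 1 = (1 - q ^ d)^-1 * (- (1 - q))].
Proof.
have e0 : 0 = lshift 1 (0 : 'I_1) :> 'I_(1 + 1) by apply: val_inj.
have e1 : 1 = rshift 1 (0 : 'I_1) :> 'I_(1 + 1) by apply: val_inj.
rewrite /seminormal_block; split; rewrite mxE ?e0 ?e1.
- by rewrite block_mxEul mxE mulr1n.
- by rewrite block_mxEur mxE mulr1n.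
- by rewrite block_mxEdl mxE mulr1n.
- by rewrite block_mxEdr mxE mulr1n.
Qed.

Hypothesis q_neq0 : q != 0.
Hypothesis q_not_root : forall k : nat, (1 <= k <= n)%N -> q ^+ k != 1.

Lemma qz_neq1 (d : int) : d != 0 -> `|d| <= n%:Z -> q ^ d != 1.
Proof.
case: d => [d|d] d0 dn.
  by rewrite -exprnP q_not_root //; move: d0 dn; lia.
rewrite NegzE -invr_expz -exprnP invr_eq1 q_not_root //; move: dn; lia.
Qed.

(** The relations see the square root only through this square, so that its branch does not matter.
    The right-hand side is invariant under d -> -d, which reduces the proof to nonnegative d. *)
Lemma off_coef_sqr d : q ^ d != 1 ->
  off_coef d ^+ 2 = q * (1 - q ^ d / q) * (1 - q ^ d * q) / (1 - q ^ d) ^+ 2.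
Proof.
move=> qd1.
suff key m : (0 <= m :> int) -> q ^ m != 1 ->
    off_coef m ^+ 2 = q * (1 - q ^ m / q) * (1 - q ^ m * q) / (1 - q ^ m) ^+ 2.
  case: (leP 0 d) => [d0|d0]; first exact: key.
  have qd0 : q ^ d != 0 by rewrite expfz_neq0.
  rewrite -off_coefN key ?oppr_ge0 1?ltW // -?invr_expz ?invr_eq1 //.
  by field; rewrite q_neq0 qd0 !subr_eq0 qd1 eq_sym qd1.
move=> m0 qm1; rewrite /off_coef ger0_norm //; case: (seminormal_blockE m) => _ -> _ _.
rewrite exprMn sqrtCK expfzDr // expfzDr // exprN1 expr1z.
by field; rewrite q_neq0 subr_eq0 eq_sym qm1.
Qed.

Lemma off_coef1 : off_coef 1 = 0.
Proof.
rewrite /off_coef normr1; case: (seminormal_blockE 1) => _ -> _ _.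
have -> : q ^ (1 - 1) = 1 by rewrite subrr.
by rewrite subrr mulr0 mul0r sqrtC0 mulr0.
Qed.

Lemma tab_vecE la (w : seminormal_space K la) :
  w = \sum_(T : stab la) (w T : K) *: v la (val T).
Proof.
apply/ffunP => S; rewrite sum_ffunE (bigD1 S) //= !ffunE eqxx.
rewrite big1 ?addr0 => [|T /negPf nTS]; first by rewrite [RHS]mulr1.
by rewrite !ffunE val_eqE eq_sym nTS; apply: mulr0.
Qed.

Lemma seminormal_gen_linear la i : linear (@seminormal_gen K n q la i).
Proof.
move=> c u w; rewrite /seminormal_gen scaler_sumr -big_split /=.
by apply: eq_bigr => T _; rewrite !ffunE scalerDl scalerA.
Qed.

Lemma seminormal_gen_vec la i (T : stab la) :
  seminormal_gen q i (v la (val T)) = seminormal_image q la i (val T).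
Proof.
rewrite /seminormal_gen (bigD1 T) //= ffunE eqxx scale1r big1 ?addr0 // => S.
by move=> /negPf nST; rewrite ffunE val_eqE nST scale0r.
Qed.

Lemma linear_ext la (V : lmodType K) (f g : seminormal_space K la -> V) :
  linear f -> linear g ->
  (forall T, is_standard la T -> f (v la T) = g (v la T)) -> f =1 g.
Proof.
move=> linf ling fg w; rewrite (tab_vecE w) (linear_comb _ _ _ linf) (linear_comb _ _ _ ling).
by apply: eq_bigr => T _; rewrite fg // (valP T).
Qed.

Definition gen_dist T i := axial_distance T (entry i) (entryS i).

Lemma gen_dist_swap T i : gen_dist (swap_tab i T) i = - gen_dist T i.
Proof. by rewrite /gen_dist /axial_distance !content_swap tpermL tpermR [RHS]opprB. Qed.

Lemma seminormal_genE la T i : is_standard la T ->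
  G i (v la T) = diag_coef (gen_dist T i) *: v la T + off_coef (gen_dist T i) *: v la (swap_tab
    i T).
Proof.
move=> stdT; rewrite (seminormal_gen_vec i (Sub T stdT : stab la)) /= /seminormal_image /gen_dist.
have q1 : q != 1 by apply: (@qz_neq1 1); have := std_axial_lt stdT (entry i) (entryS i); lia.
have q1' : 1 - q != 0 by rewrite subr_eq0 eq_sym.
have dlt := std_axial_lt stdT (entry i) (entryS i).
case: (axialP stdT i) dlt => [_|_|d d1 h1 h2|d d1 h1 h2] dlt.
- rewrite off_coefN off_coef1 scale0r addr0 /diag_coef exprN1; congr (_ *: _).
  by field; rewrite q_neq0 subr_eq0 q1.
- rewrite off_coef1 scale0r addr0 /diag_coef expr1z -opprB mulNr divff // scaleN1r //.
- have d0 : 0 < d by lia.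
  rewrite d0 gtr0_norm // addrC; case: (seminormal_blockE d) => _ _ _ ->.
  congr (_ *: _ + _ *: _); first by rewrite /diag_coef mulrC opprB.
  by rewrite /off_coef gtr0_norm.
(* The block of [- d] applies with [v T] as its first vector; its coefficient q^(-d) (1-q) /
   (1-q^(-d)) equals (q-1) / (1-q^d). *)
have d0 : d < 0 by lia.
rewrite ltNge ltW //= ltr0_norm //; case: (seminormal_blockE (- d)) => -> e -> _.
congr (_ *: _ + _ *: _); last by rewrite /off_coef ltr0_norm // e.
have qd : q ^ d != 1 by apply: qz_neq1; lia.
have qd0 : q ^ d != 0 by rewrite expfz_neq0.
rewrite /diag_coef -invr_expz; field; rewrite qd0 !subr_eq0 qd eq_sym qd //.
Qed.

Lemma swap_std_or_off0 la T i : is_standard la T ->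
  off_coef (gen_dist T i) = 0 \/ is_standard la (swap_tab i T).
Proof.
move=> stdT; have := @swap_std _ _ _ stdT i; rewrite /gen_dist.
case: (axialP stdT i) => [_ _|_ _|d _ _ _ h|d _ _ _ h].
- by left; rewrite off_coefN off_coef1.
- by left; rewrite off_coef1.
- by right; apply: h.
- by right; apply: h.
Qed.

(* The formula for [G i (v la T)] needs [T] standard; in the products below each
   nonstandard tableau comes with a vanishing coefficient. *)
Definition good la (c : K) T := c = 0 \/ is_standard la T.

Lemma good_mul la c d T : good la c T -> good la (c * d) T.
Proof. by case=> [->|stdT]; [left; rewrite mul0r | right]. Qed.

Lemma good_swap la c T i : good la c T ->
  good la (c * off_coef (gen_dist T i)) (swap_tab i T).
Proof.
case=> [->|stdT]; first by left; rewrite mul0r.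
by case: (swap_std_or_off0 i stdT) => [->|]; [left; rewrite mulr0 | right].
Qed.

Lemma seminormal_genZ la i c u : G i (c *: u : seminormal_space K la) = c *: G i u.
Proof.
have g0 := linear_at0 (@seminormal_gen_linear la i).
by rewrite -[c *: u]addr0 seminormal_gen_linear g0 addr0.
Qed.

Lemma seminormal_genD la i (u w : seminormal_space K la) : G i (u + w) = G i u + G i w.
Proof. by rewrite -[u]scale1r seminormal_gen_linear !scale1r. Qed.

Lemma seminormal_gen_good la c T i : good la c T ->
  G i (c *: v la T) = (c * diag_coef (gen_dist T i)) *: v la T +
                      (c * off_coef (gen_dist T i)) *: v la (swap_tab i T).
Proof.
rewrite seminormal_genZ => -[->|stdT]; first by rewrite !mul0r !scale0r addr0.
by rewrite seminormal_genE // scalerDr !scalerA.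
Qed.

Lemma seminormal_gen2 la T i j : is_standard la T ->
  G j (G i (v la T)) =
    (diag_coef (gen_dist T i) * diag_coef (gen_dist T j)) *: v la T +
    (diag_coef (gen_dist T i) * off_coef (gen_dist T j)) *: v la (swap_tab j T) +
    ((off_coef (gen_dist T i) * diag_coef (gen_dist (swap_tab i T) j)) *: v la (swap_tab i T) +
     (off_coef (gen_dist T i) * off_coef (gen_dist (swap_tab i T) j)) *: v la (swap_tab j
       (swap_tab i T))).
Proof.
move=> stdT; have g1 c : good la c T by right.
have g2 : good la (off_coef (gen_dist T i)) (swap_tab i T) by apply: swap_std_or_off0.
by rewrite seminormal_genE // seminormal_genD !seminormal_gen_good.
Qed.

Lemma seminormal_gen3 la T i j k : is_standard la T ->
  let A T i := diag_coef (gen_dist T i) in let B T i := off_coef (gen_dist T i) in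
  let s := @swap_tab n in
  G k (G j (G i (v la T))) =
    (A T i * A T j * A T k) *: v la T +
    (A T i * A T j * B T k) *: v la (s k T) +
    ((A T i * B T j * A (s j T) k) *: v la (s j T) +
     (A T i * B T j * B (s j T) k) *: v la (s k (s j T))) +
    ((B T i * A (s i T) j * A (s i T) k) *: v la (s i T) +
     (B T i * A (s i T) j * B (s i T) k) *: v la (s k (s i T)) +
     ((B T i * B (s i T) j * A (s j (s i T)) k) *: v la (s j (s i T)) +
      (B T i * B (s i T) j * B (s j (s i T)) k) *: v la (s k (s j (s i T))))).
Proof.
move=> stdT /=; have g1 c : good la c T by right.
have g2 l : good la (off_coef (gen_dist T l)) (swap_tab l T) by apply: swap_std_or_off0.
have g2' c : good la (c * off_coef (gen_dist T j)) (swap_tab j T) by apply: good_swap.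
have g2'' c : good la (off_coef (gen_dist T i) * c) (swap_tab i T) by apply: good_mul.
have g3 : good la (off_coef (gen_dist T i) * off_coef (gen_dist (swap_tab i T) j))
  (swap_tab j (swap_tab i T)) by apply: good_swap.
by rewrite seminormal_gen2 // !seminormal_genD !seminormal_gen_good.
Qed.

(** With a and b the two coefficients this says a(d)^2 + b(d)^2 = (q-1) a(d) + q and a(d) + a(-d) =
    q-1. *)
Lemma seminormal_quadratic la i (w : seminormal_space K la) :
  G i (G i w) = (q - 1) *: G i w + q *: w.
Proof.
move: w; apply: linear_ext => [c u w|c u w|T stdT].
- by rewrite !seminormal_gen_linear.
- rewrite !seminormal_gen_linear !scalerDr !scalerA [_ * c]mulrC [q * c]mulrC.
  by rewrite -!scalerA addrACA.
rewrite seminormal_gen2 // seminormal_genE // swap_tabK gen_dist_swap off_coefN.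
set d := gen_dist T i; have d0 : d != 0 by apply: (axial_neq0 stdT).
have qd : q ^ d != 1 by apply: qz_neq1 => //; apply/ltW/(std_axial_lt stdT).
have qd0 : q ^ d != 0 by rewrite expfz_neq0.
have sqr := off_coef_sqr qd; rewrite expr2 in sqr; rewrite sqr.
apply/ffunP => S; rewrite !ffunE /GRing.scale /= /diag_coef -invr_expz.
move: (_ == _)%:R (_ == _)%:R (off_coef d) => x y b.
by field; rewrite q_neq0 qd0 !subr_eq0 qd eq_sym qd.
Qed.

Lemma entry_succ_eq (i j : 'I_n.-1) : j = i.+1 :> nat -> entryS i = entry j.
Proof. by move=> ji; apply: val_inj. Qed.

Lemma swap_braid (i j : 'I_n.-1) T : j = i.+1 :> nat ->
  swap_tab i (swap_tab j (swap_tab i T)) = swap_tab j (swap_tab i (swap_tab j T)).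
Proof.
move=> ji; apply/ffunP => k; rewrite !ffunE; congr (T _).
rewrite (entry_succ_eq ji); set a := entry i; set b := entry j; set c := entryS j.
have ab : a != b by apply/eqP => /(congr1 (@nat_of_ord n)) /=; lia.
have cb : c != b by apply/eqP => /(congr1 (@nat_of_ord n)) /=; lia.
have ca : c != a by apply/eqP => /(congr1 (@nat_of_ord n)) /=; lia.
have e1 := tpermJ b c (tperm a b); have e2 := tpermJ a b (tperm b c).
rewrite tpermR tpermD 1?eq_sym // in e1; rewrite tpermL tpermD // 1?eq_sym // in e2.
rewrite conjgE tpermV in e1; rewrite conjgE tpermV in e2.
by rewrite -!permM -?mulgA e1 e2.
Qed.

Lemma gen_dist_braid (i j : 'I_n.-1) T : j = i.+1 :> nat ->
  [/\ gen_dist (swap_tab i T) j = gen_dist T i + gen_dist T j,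
      gen_dist (swap_tab j T) i = gen_dist T i + gen_dist T j,
      gen_dist (swap_tab j (swap_tab i T)) i = gen_dist T j
    & gen_dist (swap_tab i (swap_tab j T)) j = gen_dist T i].
Proof.
move=> ji; rewrite /gen_dist /axial_distance !content_swap (entry_succ_eq ji).
set a := entry i; set b := entry j; set c := entryS j.
have ab : a != b by apply/eqP => /(congr1 (@nat_of_ord n)) /=; lia.
have cb : c != b by apply/eqP => /(congr1 (@nat_of_ord n)) /=; lia.
have ca : c != a by apply/eqP => /(congr1 (@nat_of_ord n)) /=; lia.
have [ba bc ac] : [/\ b != a, b != c & a != c] by split; rewrite eq_sym.
rewrite !(tpermL, tpermR, (tpermD ab cb), (tpermD ba ca), (tpermD ac bc)).
by split=> //; rewrite ?(tpermL, tpermR);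
  move: (content T a) (content T b) (content T c) => x y z; ring.
Qed.

(** Coefficients are compared on the six tableaux obtained from [T] by the two swaps. Three of them
    agree by commutativity; [c1], [c2] and [c3] concern [T], [swap_tab i T] and [swap_tab j T], and
    the off-diagonal coefficients enter [c1] only squared. *)
Lemma seminormal_braid (i j : 'I_n.-1) la (w : seminormal_space K la) : j = i.+1 :> nat ->
  G i (G j (G i w)) = G j (G i (G j w)).
Proof.
move=> ji; move: w; apply: linear_ext => [c u w|c u w|T stdT].
- by rewrite !seminormal_gen_linear.
- by rewrite !seminormal_gen_linear.
rewrite (seminormal_gen3 i j i stdT) (seminormal_gen3 j i j stdT) !swap_tabK !gen_dist_swap
  !off_coefN (swap_braid T ji).
have [-> -> -> ->] := gen_dist_braid T ji.
set x := gen_dist T i; set y := gen_dist T j.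
have x0 : x != 0 by apply: (axial_neq0 stdT).
have y0 : y != 0 by apply: (axial_neq0 stdT).
have xy : x + y = axial_distance T (entry i) (entryS j).
  by rewrite /x /y /gen_dist /axial_distance -(entry_succ_eq ji); ring.
have xy0 : x + y != 0 by rewrite xy; apply: (content_step2 stdT).
have qx : q ^ x != 1 by apply: qz_neq1 => //; apply/ltW/(std_axial_lt stdT).
have qy : q ^ y != 1 by apply: qz_neq1 => //; apply/ltW/(std_axial_lt stdT).
have qxy' : q ^ (x + y) != 1 by apply: qz_neq1 => //; rewrite xy; apply/ltW/(std_axial_lt stdT).
clearbody x y; clear xy.
have qxyE : q ^ (x + y) = q ^ x * q ^ y by apply: expfzDr.
have qxy := qxy'; rewrite qxyE in qxy.
have u0 : q ^ x != 0 by rewrite expfz_neq0.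
have w0 : q ^ y != 0 by rewrite expfz_neq0.
have := off_coef_sqr qx; have := off_coef_sqr qy; rewrite !expr2.
set A := diag_coef; set B := off_coef => By Bx.
have AE d : A d = (q - 1) / (1 - q ^ d) by [].
have [nx ny nxy] : [/\ 1 - q ^ x != 0, 1 - q ^ y != 0 & 1 - q ^ x * q ^ y != 0].
  by rewrite !subr_eq0 ![1 == _]eq_sym.
have c1 : A x * A y * A x + B x * A (x + y) * B x = A y * A x * A y + B y * A (x + y) * B y.
  rewrite ![_ * A (x + y) * _]mulrAC Bx By !AE qxyE.
  by field; rewrite q_neq0 nx ny nxy.
have c2 : A x * A y + A (x + y) * A (- x) = A y * A (x + y).
  by rewrite !AE qxyE -invr_expz; field; rewrite u0 nx ny nxy -opprB oppr_eq0 nx.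
have c3 : A x * A (x + y) = A y * A x + A (x + y) * A (- y).
  by rewrite !AE qxyE -invr_expz; field; rewrite w0 nx ny nxy -opprB oppr_eq0 ny.
apply/ffunP => S; rewrite !ffunE /GRing.scale /=.
move: (_ == _)%:R (_ == _)%:R (_ == _)%:R (_ == _)%:R (_ == _)%:R (_ == _)%:R.
move=> x6 x5 x4 x3 x2 x1.
transitivity ((A x * A y * A x + B x * A (x + y) * B x) * x1 +
    B x * (A x * A y + A (x + y) * A (- x)) * x2 + B y * (A x * A (x + y)) * x3 +
    A x * B y * B (x + y) * x4 + B x * B (x + y) * A y * x5 + B x * B (x + y) * B y * x6).
  by ring.
by rewrite c1 c2 c3; ring.
Qed.

Lemma swap_comm (i j : 'I_n.-1) T : (i.+1 < j)%N ->
  swap_tab i (swap_tab j T) = swap_tab j (swap_tab i T).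
Proof.
move=> ij; apply/ffunP => k; rewrite !ffunE; congr (T _).
rewrite -!permM; congr (fun_of_perm _ k); apply/permP => l; rewrite !permM.
apply: val_inj; rewrite /= !tperm_entry.
by case: (eqVneq (l : nat) i) => ?; case: (eqVneq (l : nat) i.+1) => ?;
   case: (eqVneq (l : nat) j) => ?; case: (eqVneq (l : nat) j.+1) => ?; 
   repeat (case: eqVneq => ?); lia.
Qed.

Lemma gen_dist_commute (i j : 'I_n.-1) T : (i.+1 < j)%N || (j.+1 < i)%N ->
  gen_dist (swap_tab i T) j = gen_dist T j.
Proof.
move=> ij; rewrite /gen_dist /axial_distance !content_swap !tpermD //;
  by apply/eqP => /(congr1 (@nat_of_ord n)) /=; lia.
Qed.

Lemma seminormal_commute (i j : 'I_n.-1) la (w : seminormal_space K la) :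
  (i.+1 < j)%N || (j.+1 < i)%N -> G i (G j w) = G j (G i w).
Proof.
wlog ij : i j / (i.+1 < j)%N => [hw|_].
  by move=> /orP[h|h]; [|symmetry]; apply: hw; rewrite ?h.
move: w; apply: linear_ext => [c u w|c u w|T stdT].
- by rewrite !seminormal_gen_linear.
- by rewrite !seminormal_gen_linear.
rewrite (seminormal_gen2 i j stdT) (seminormal_gen2 j i stdT) (swap_comm T ij)
  !gen_dist_commute ?ij ?orbT //.
apply/ffunP => S; rewrite !ffunE /GRing.scale /=; ring.
Qed.

Lemma relator_act la x : hecke_relator q (@free_gen K 'I_n.-1) x ->
  forall w : seminormal_space K la, free_action (fun i => G i) x w = 0.
Proof.
have linG i : linear (@seminormal_gen K n q la i) by apply: seminormal_gen_linear.
have actB y z w : free_action (fun i => @seminormal_gen K n q la i) (y - z) w =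
    free_action (fun i => G i) y w - free_action (fun i => G i) z w.
  by rewrite addrC -[- z]scaleN1r free_action_linear scaleN1r addrC.
have act0 w : free_action (fun i => @seminormal_gen K n q la i) 0 w = 0.
  by rewrite -[0](subrr 1) actB subrr.
have act3 x1 x2 x3 w : free_action (fun i => @seminormal_gen K n q la i) (x1 * x2 * x3) w =
    free_action (fun i => G i) x1 (free_action (fun i => G i) x2 (free_action (fun i => G i) x3
      w)).
  by rewrite !(free_actionM linG).
case=> [i|i j ji|i j ij] w; apply: (etrans (actB _ _ _)); apply/eqP; rewrite subr_eq0; apply/eqP.
- apply: (etrans (free_actionM linG _ _ _)); rewrite !free_action_gen.
  rewrite free_action_linear free_action_gen seminormal_quadratic; congr (_ + _).
  by rewrite -[q%:A]addr0 free_action_linear free_action1 act0 addr0.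
- apply: (etrans (act3 _ _ _ _)); apply: (etrans _ (esym (act3 _ _ _ _))).
  by rewrite !free_action_gen; apply: seminormal_braid.
- apply: (etrans (free_actionM linG _ _ _)); apply: (etrans _ (esym (free_actionM linG _ _ _))).
  by rewrite !free_action_gen; apply: seminormal_commute.
Qed.

Lemma pi_rep_representation la : representation (pi_rep q la).
Proof.
apply: hecke_action_representation; first exact: seminormal_gen_linear.
exact: relator_act.
Qed.

Lemma pi_rep_gen la i w : pi_rep q la (hecke_gen q i) w = G i w.
Proof.
apply: hecke_action_gen; first exact: seminormal_gen_linear.
exact: relator_act.
Qed.

End SeminormalForm.

(** * Jucys-Murphy elements *)

Section JucysMurphy.
Context (K : numClosedFieldType) (n : nat) (q : K).
Hypothesis q_neq0 : q != 0.
Hypothesis q_not_root : forall k : nat, (1 <= k <= n)%N -> q ^+ k != 1.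
Implicit Types (la mu : young n) (i : 'I_n.-1) (T S U : tableau n).
Local Notation v := (tab_vec K).
Local Notation H := (hecke n q).

Let rep la : representation (pi_rep q la) := pi_rep_representation q_neq0 q_not_root la.

Fixpoint jucys_murphy (k : nat) : H :=
  if k is k'.+1 then
    let g := if insub k' is Some i then hecke_gen q i else 1 in
    q^-1 *: (g * jucys_murphy k' * g)
  else 1.

(** By induction L_k is diagonal on [v T] and [v (s_k T)], with the contents of [k] and [k + 1] in
    [T] as exponents; conjugating by g_k exchanges these. *)
Lemma jucys_murphy_act la T (k : 'I_n) : is_standard la T ->
  pi_rep q la (jucys_murphy k) (v la T) = q ^ content T k *: v la T.
Proof.
case: k => k ltkn; elim: k ltkn T => [|k IH] ltkn T stdT.
  by rewrite (std_first stdT) // act1 // scale1r.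
have ltk : (k < n.-1)%N by lia.
pose i := Ordinal ltk.
have -> : Ordinal ltkn = entryS i by apply: val_inj.
have ltk' : (k < n)%N by lia.
rewrite [jucys_murphy _]/= (insubT (fun j => (j < n.-1)%N) ltk) -/i.
rewrite (actZl (rep la)) !(actM (rep la)) !(pi_rep_gen q_neq0 q_not_root).
have ek : Ordinal ltk' = entry i by apply: val_inj.
have Lgood c U : good la c U ->
    pi_rep q la (jucys_murphy k) (c *: v la U) = (c * q ^ content U (entry i)) *: v la U.
  rewrite (actZr (rep la)) => -[->|stdU]; first by rewrite mul0r !scale0r.
  by rewrite -ek (IH ltk') // scalerA.
have g0 c : good la c T by right.
have g1 : good la (off_coef q (gen_dist T i)) (swap_tab i T) by apply: swap_std_or_off0.
rewrite (seminormal_genE q_neq0 q_not_root) // (actDr (rep la)) !Lgood //.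
rewrite seminormal_genD !(seminormal_gen_good q_neq0 q_not_root) //; last exact: good_mul.
rewrite swap_tabK gen_dist_swap off_coefN content_swap tpermL.
have d0 : gen_dist T i != 0 by apply: (axial_neq0 stdT).
have qd : q ^ gen_dist T i != 1 by apply: (qz_neq1 q_neq0 q_not_root d0);
  apply/ltW/(std_axial_lt stdT).
have sqr := off_coef_sqr q_neq0 qd; rewrite expr2 in sqr.
apply/ffunP => R; rewrite !ffunE /GRing.scale /=.
have Y0 : q ^ content T (entryS i) != 0 by rewrite expfz_neq0.
have X0 : q ^ content T (entry i) != 0 by rewrite expfz_neq0.
have qdE : q ^ gen_dist T i = q ^ content T (entry i) / q ^ content T (entryS i).
  by rewrite /gen_dist /axial_distance expfzDr // -invr_expz.
move: sqr qd; rewrite /diag_coef -invr_expz qdE.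
move: (q ^ content T _) (q ^ content T _) X0 Y0 (off_coef _ _) => X Y Y0 X0 O sqr qd.
move: (_ == _)%:R (_ == _)%:R => x y.
have XY : X - Y != 0 by rewrite subr_eq0; apply: contra qd => /eqP ->; rewrite divff.
have YX : Y - X != 0 by rewrite -opprB oppr_eq0.
have nXY : 1 - Y / X != 0 by rewrite subr_eq0 eq_sym.
have nYX : 1 - (Y / X)^-1 != 0.
  by rewrite invf_div subr_eq0; apply: contra nXY => /eqP e;
    rewrite -[Y / X]invf_div -e invr1 subrr.
(* Here [Y] and [X] are the powers for the entries [i] and [i + 1]: [e1] is the diagonal coefficient
   of g L g, and [e2] makes the off-diagonal one vanish. *)
have e1 : (q - 1) / (1 - Y / X) * Y * ((q - 1) / (1 - Y / X)) + O * X * O = q * X.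
  by rewrite [O * X * O]mulrAC sqr; field; rewrite q_neq0 X0 XY.
have e2 : (q - 1) / (1 - Y / X) * Y + X * ((q - 1) / (1 - (Y / X)^-1)) = 0.
  by field; rewrite X0 Y0 XY YX.
rewrite -[RHS](mulKf q_neq0) [q * (X * y)]mulrA -e1 -[in RHS](addr0 (_ * y)) -(mul0r (O * x)) -e2.
by congr (_ * _); ring.
Qed.

(** When both tableaux are standard, 1 < |d| < n, so that d, d-1 and d+1 are nonzero of absolute
    value at most n. *)
Lemma off_coef_neq0 la T i : is_standard la T -> is_standard la (swap_tab i T) ->
  off_coef q (gen_dist T i) != 0.
Proof.
move=> stdT stdS.
have d2 : 1 < `|gen_dist T i|.
  rewrite /gen_dist.
  have [b1 eb1] : exists b : bool, b = ((T (entry i)).1 == (T (entryS i)).1) by eexists.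
  have [b2 eb2] : exists b : bool, b = ((T (entry i)).2 == (T (entryS i)).2) by eexists.
  have := axialP stdT i; rewrite -eb1 -eb2 => ax.
  case: ax eb1 eb2 => [h /esym/eqP e1 _|h _ /esym/eqP e2|d d1 _ _ _ _|d d1 _ _ _ _]; try lia.
  - have := @std_lt _ _ _ stdS (entryS i) (entry i).
    by rewrite !ffunE tpermL tpermR e1 eqxx h ltnSn => /(_ isT) /=; lia.
  - have := @std_lt _ _ _ stdS (entryS i) (entry i).
    by rewrite !ffunE tpermL tpermR e2 eqxx h ltnSn orbT => /(_ isT) /=; lia.
have dlt := std_axial_lt stdT (entry i) (entryS i); rewrite -/(gen_dist T i) in dlt.
suff : off_coef q (gen_dist T i) ^+ 2 != 0 by rewrite expf_eq0.
rewrite off_coef_sqr //; last by apply: (qz_neq1 q_neq0 q_not_root); lia.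
have qd := @qz_neq1 _ _ _ q_neq0 q_not_root (gen_dist T i).
have qd1 := @qz_neq1 _ _ _ q_neq0 q_not_root (gen_dist T i - 1).
have qd2 := @qz_neq1 _ _ _ q_neq0 q_not_root (gen_dist T i + 1).
rewrite expfzDr // exprN1 in qd1; rewrite expfzDr // expr1z in qd2.
rewrite !mulf_neq0 ?invr_eq0 ?expf_neq0 // subr_eq0 eq_sym.
- apply: qd1; lia.
- apply: qd2; lia.
- apply: qd; lia.
Qed.

(* q is not an n-th root of unity: the first boxes where [T] and [S] differ are two
   addable boxes of one diagram, of contents at most [n] apart. *)
Lemma separating_scalar la mu T S : is_standard la T -> is_standard mu S -> T != S ->
  exists k : 'I_n, q ^ content T k != q ^ content S k.
Proof.
move=> stdT stdS /(std_separate stdT stdS)[k nek lek]; exists k.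
have := @qz_neq1 _ _ _ q_neq0 q_not_root (content T k - content S k).
rewrite subr_eq0 => /(_ nek lek); rewrite expfzDr // -invr_expz.
by apply: contra => /eqP ->; rewrite divff // expfz_neq0.
Qed.

(** Lagrange interpolation: each [U] in [s] contributes a factor (L_k - b) / (a - b), with [k] an
    entry whose eigenvalues a at [T] and b at [U] differ. *)
Lemma partial_projection la T (s : seq (tableau n)) : is_standard la T ->
  exists h : H, [/\ pi_rep q la h (v la T) = v la T &
    forall mu S, is_standard mu S -> exists c,
      pi_rep q mu h (v mu S) = c *: v mu S /\ (S \in s -> S != T -> c = 0)].
Proof.
move=> stdT; elim: s => [|U s [h [hT hS]]].
  exists 1; split; first exact: act1.
  by move=> mu S stdS; exists 1; rewrite act1 // scale1r.
case: (eqVneq U T) => [->|neUT].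
  exists h; split=> // mu S stdS; have [c [hc c0]] := hS mu S stdS.
  by exists c; split=> //; rewrite inE => /predU1P[->|/c0//]; rewrite eqxx.
(* A [U] that is standard of no shape never has to be annihilated. *)
case: (boolP [exists nu : young n, is_standard nu U]) => [/existsP[nu stdU]|nostd]; last first.
  exists h; split=> // mu S stdS; have [c [hc c0]] := hS mu S stdS.
  exists c; split=> //; rewrite inE => /predU1P[eS|/c0//].
  by case/existsP: nostd; exists mu; rewrite -eS.
rewrite eq_sym in neUT; have [k nek] := separating_scalar stdT stdU neUT.
pose a := q ^ content T k; pose b := q ^ content U k.
have ab0 : a - b != 0 by rewrite subr_eq0.
pose h' : H := (a - b)^-1 *: ((jucys_murphy k - b%:A) * h).
have h'E mu S c : is_standard mu S -> pi_rep q mu h (v mu S) = c *: v mu S ->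
    pi_rep q mu h' (v mu S) = ((a - b)^-1 * (c * (q ^ content S k - b))) *: v mu S.
  move=> stdS hc; rewrite /h' (actZl (rep mu)) (actM (rep mu)) hc (actZr (rep mu)).
  rewrite (actBl (rep mu)) (actZl (rep mu)) (act1 (rep mu)) jucys_murphy_act //.
  by rewrite -scalerBl !scalerA mulrA.
exists h'; split.
  by rewrite (@h'E _ _ 1) ?scale1r // mul1r mulVf // scale1r.
move=> mu S stdS; have [c [hc c0]] := hS mu S stdS.
exists ((a - b)^-1 * (c * (q ^ content S k - b))); split; first exact: h'E.
rewrite inE => /predU1P[->|Ss] neST; first by rewrite subrr !mulr0.
by rewrite c0 // mul0r mulr0.
Qed.

Lemma projection_exists la T : is_standard la T -> exists h : H,
  forall mu S, is_standard mu S -> pi_rep q mu h (v mu S) = if S == T then v mu S else 0.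
Proof.
move=> stdT; have [h [hT hS]] := partial_projection (enum {: tableau n}) stdT.
exists h => mu S stdS; case: eqP => [e|/eqP neST].
  by subst S; have <- := std_shape_inj stdT stdS.
by have [c [-> ->]] := hS mu S stdS; rewrite ?scale0r ?mem_enum.
Qed.

(** All shapes are tested at once; such an element acts by 0 on every shape other than that of
    [S]. *)
Definition matrix_unit T S (h : H) := forall mu U, is_standard mu U ->
  pi_rep q mu h (v mu U) = if U == S then v mu T else 0.

Lemma matrix_unit_exists la T S : is_standard la T -> is_standard la S ->
  exists h, matrix_unit T S h.
Proof.
pose P T S := (exists h, matrix_unit T S h) /\ forall mu, is_standard mu S -> is_standard mu T.
suff key T' S' : is_standard la T' -> is_standard la S' -> P T' S'.
  by move=> stdT stdS; have [] := key _ _ stdT stdS.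
apply: swap_connected T' S' => [T' stdT|T1 T2 T3 [[h1 h1E] s12] [[h2 h2E] s23]|i T' stdT stdS].
- split=> //; have [h hE] := projection_exists stdT; exists h => mu U stdU.
  by rewrite hE //; case: eqP => [->|].
- split; last by move=> mu /s23/s12.
  exists (h1 * h2) => mu U stdU; rewrite (actM (rep mu)) h2E //.
  case: eqP => [eU|_]; last exact: (act0r (rep mu)).
  by rewrite h1E ?eqxx //; apply: s23; rewrite -eU.
split; last first.
  by move=> mu /(std_shape_inj stdS) <-.
have [h1 h1E] := projection_exists stdT; have [h2 h2E] := projection_exists stdS.
have O0 := off_coef_neq0 stdT stdS.
(* Between the projections onto [T'] and its swap, only the off-diagonal coefficient of the
   generator survives. *)
exists ((off_coef q (gen_dist T' i))^-1 *: (h1 * (hecke_gen q i * h2))) => mu U stdU.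
rewrite (actZl (rep mu)) !(actM (rep mu)) h2E //.
case: eqP => [eU|_]; last by rewrite !(act0r (rep mu)) scaler0.
subst U; have emu := std_shape_inj stdS stdU; subst mu.
rewrite (pi_rep_gen q_neq0 q_not_root) (seminormal_genE q_neq0 q_not_root) // swap_tabK.
rewrite gen_dist_swap off_coefN (actDr (rep la)) !(actZr (rep la)) !h1E //.
rewrite eqxx; case: eqP => [e|_]; last by rewrite scaler0 add0r scalerA mulVf // scale1r.
have /ffunP/(_ (entry i)) := e; rewrite ffunE tpermL => /(std_inj stdT).
by move/(congr1 (@nat_of_ord n)) => /=; lia.
Qed.

End JucysMurphy.

(** * A spanning set of the Hecke algebra *)

Section HeckeAlgebra.
Context (K : fieldType) (n : nat) (q : K).
Local Notation H := (hecke n q).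
Local Notation g := (@hecke_gen K n q).
Local Notation pi := (@hecke_pi K n q).

Lemma hecke_piD x y : pi (x + y) = pi x + pi y.
Proof. exact: qalg_piD. Qed.

Lemma hecke_pi1 : pi 1 = 1.
Proof. by []. Qed.

Lemma hecke_piM x y : pi (x * y) = pi x * pi y.
Proof. exact: qalg_piM. Qed.

Lemma hecke_piZ c x : pi (c *: x) = c *: pi x.
Proof. exact: qalg_piZ. Qed.

Lemma hecke_pi_surj h : exists x, h = pi x.
Proof. by exists (hecke_repr h); symmetry; apply: reprK. Qed.

Lemma hecke_pi_relator x y :
  hecke_relator q (@free_gen K 'I_n.-1) (x - y) -> pi x = pi y.
Proof. by move=> rel; apply/qalg_eqP/asboolP/in_ideal_gen. Qed.

Lemma hecke_gen_quadratic i : g i * g i = (q - 1) *: g i + q%:A.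
Proof.
have sqr x : pi (x ^+ 2) = pi x * pi x by rewrite expr2 hecke_piM.
have lin x : pi ((q - 1) *: x + q%:A) = (q - 1) *: pi x + q%:A.
  by rewrite hecke_piD !hecke_piZ hecke_pi1.
have rel := hecke_pi_relator (hecke_quadratic q (@free_gen K 'I_n.-1) i).
exact: (etrans (esym (sqr _)) (etrans rel (lin _))).
Qed.

Lemma hecke_gen_braid (i j : 'I_n.-1) : j = i.+1 :> nat ->
  g i * g j * g i = g j * g i * g j.
Proof.
move=> ji; have M3 x y z : pi (x * y * z) = pi x * pi y * pi z by rewrite !hecke_piM.
have := hecke_pi_relator (hecke_braid q (@free_gen K 'I_n.-1) ji) => rel.
exact: (etrans (esym (M3 _ _ _)) (etrans rel (M3 _ _ _))).
Qed.

Lemma hecke_gen_commute (i j : 'I_n.-1) : (i.+1 < j)%N || (j.+1 < i)%N ->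
  g i * g j = g j * g i.
Proof.
move=> ij; have := hecke_pi_relator (hecke_commute q (@free_gen K 'I_n.-1) ij) => rel.
exact: (etrans (esym (hecke_piM _ _)) (etrans rel (hecke_piM _ _))).
Qed.

Lemma hecke_ind (P : H -> Prop) :
  P 1 -> (forall c x y, P x -> P y -> P (c *: x + y)) ->
  (forall x y, P x -> P y -> P (x * y)) -> (forall i, P (g i)) -> forall h, P h.
Proof.
move=> P1 Plin PM Pg h; have [x ->] := hecke_pi_surj h.
have P0 : P 0 by rewrite -[0](subrr 1) addrC -scaleN1r; apply: Plin.
pose mon m : free_algebra K 'I_n.-1 := (mkmalgU m 1 : {malg K[{fmonom 'I_n.-1}]}).
have Pmon m : P (pi (mon m)).
  case: m; elim=> [|i s IH].
    by rewrite (_ : mon _ = 1) // /mon -fmoneE.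
  have -> : mon (FMonom (i :: s)) = free_gen K i * mon (FMonom s).
    have e := fgmulUU (1 : K) 1 (fmu i) (FMonom s).
    have em : mmul (fmu i) (FMonom s) = FMonom (i :: s).
      by rewrite -[mmul _ _]/(fmmul _ _) fmmulE fmuE.
    by rewrite mulr1 em in e; apply: esym e.
  by rewrite (hecke_piM (free_gen K i)); apply: PM; first exact: (Pg i).
pose x' : {malg K[{fmonom 'I_n.-1}]} := x.
have xE : x = \sum_(m <- msupp x') x'@_m *: mon m.
  rewrite {1}[x](monalgE x'); apply: eq_bigr => m _; apply/malgP => k.
  rewrite /mon mcoeffZ (mcoeffU m (x'@_m) k) (mcoeffU m 1 k).
  by rewrite mulr_natr.
rewrite xE; elim: (X in \sum_(m <- X) _) => [|m s IH].
  by rewrite big_nil (_ : pi 0 = 0) // -[0](subrr 1) addrC -scaleN1r hecke_piD hecke_piZ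
    scaleN1r addNr.
by rewrite big_cons hecke_piD hecke_piZ; apply: Plin.
Qed.

Definition gnat (k : nat) : H := if insub k is Some i then g i else 1.

Lemma gnat_ord (i : 'I_n.-1) : gnat i = g i.
Proof. by rewrite /gnat valK. Qed.

Lemma gnat_ordinal k (ltk : (k < n.-1)%N) : gnat k = g (Ordinal ltk).
Proof. by rewrite /gnat insubT. Qed.

Lemma gnat_quadratic k : (k < n.-1)%N -> gnat k * gnat k = (q - 1) *: gnat k + q%:A.
Proof. by move=> ltk; rewrite gnat_ordinal hecke_gen_quadratic. Qed.

Lemma gnat_braid k : (k.+1 < n.-1)%N ->
  gnat k * gnat k.+1 * gnat k = gnat k.+1 * gnat k * gnat k.+1.
Proof.
move=> ltk; have ltk' : (k < n.-1)%N by apply: ltnW.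
by rewrite !gnat_ordinal; apply: hecke_gen_braid.
Qed.

Lemma gnat_commute k l : (k < n.-1)%N -> (l.+1 < k)%N -> gnat k * gnat l = gnat l * gnat k.
Proof.
move=> ltk lk; have ltl : (l < n.-1)%N by lia.
by rewrite !gnat_ordinal; apply: hecke_gen_commute; rewrite lk orbT.
Qed.

End HeckeAlgebra.

Section NormalWords.
Context (K : fieldType) (A : algType K) (m : nat) (q : K) (x : nat -> A).
Hypothesis x_quadratic : forall k, (k < m)%N -> x k * x k = (q - 1) *: x k + q%:A.
Hypothesis x_braid : forall k, (k.+1 < m)%N -> x k * x k.+1 * x k = x k.+1 * x k * x k.+1.
Hypothesis x_commute : forall k l, (k < m)%N -> (l.+1 < k)%N -> x k * x l = x l * x k.

(* x_k x_(k-1) ... x_(k-d+1); meaningful for [d <= k.+1] only, the truncated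
   subtraction repeating x_0 beyond. *)
Fixpoint descending (k d : nat) : A :=
  if d is d'.+1 then descending k d' * x (k - d') else 1.

Lemma descending_commute k d i : (k < m)%N -> (d + i < k)%N ->
  descending k d * x i = x i * descending k d.
Proof.
move=> ltk; elim: d => [|d IH] lt; first by rewrite mul1r mulr1.
have c : x (k - d) * x i = x i * x (k - d) by apply: x_commute; lia.
have ltd : (d + i < k)%N by lia.
by rewrite /= -mulrA c mulrA (IH ltd) -mulrA.
Qed.

(** The letters [x i.+1], [x i] occur next to each other in the word; the braid relation absorbs the
    new [x i.+1] there and releases an [x i], which commutes with all letters before. *)
Lemma descending_shift k d i : (k < m)%N -> (d <= k.+1)%N -> (i < k)%N -> (k < d + i)%N ->
  descending k d * x i.+1 = x i * descending k d.
Proof.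
move=> ltk; elim: d => [|d IH] dk ik lt; first lia.
case: (ltnP k (d + i)) => [lt'|le] /=.
  have c : x i.+1 * x (k - d) = x (k - d) * x i.+1 by apply: x_commute; lia.
  have ltd : (d <= k.+1)%N by lia.
  by rewrite -mulrA -c mulrA (IH ltd ik lt') -mulrA.
have ei : i = (k - d)%N by lia.
case: d le lt dk IH ei => [|d] le lt dk IH ei; first lia.
have -> : descending k d.+1 = descending k d * x i.+1 by rewrite /= ei; congr (_ * x _); lia.
have lti : (i.+1 < m)%N by lia.
have ltd : (d + i < k)%N by lia.
rewrite -ei -mulrA -mulrA [x i.+1 * _]mulrA -(x_braid lti).
by rewrite !mulrA (descending_commute ltk ltd).
Qed.

(** The usual normal form of permutations: the words [descending k' d], [d <= k'.+1], are the
    shortest representatives of the cosets of one symmetric group in the next. *)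
Fixpoint normal_words (k : nat) : seq A :=
  if k is k'.+1 then [seq w * descending k' d | w <- normal_words k', d <- iota 0 k'.+2]
  else [:: 1].

Lemma size_normal_words k : size (normal_words k) = k.+1`!.
Proof.
elim: k => // k IH.
rewrite -[normal_words _]/[seq w * descending k d | w <- normal_words k, d <- iota 0 k.+2].
by rewrite size_allpairs size_iota IH [in RHS]factS mulnC.
Qed.

(** The last letter of the word is x_(k-d+1). The letter below it prolongs the word, the same letter
    is reduced by the quadratic relation, and any other passes to the left with an index less than
    [k]. *)
Lemma descending_gen k d i : (k < m)%N -> (d <= k.+1)%N -> (i <= k)%N ->
  [\/ descending k d * x i = descending k d.+1 /\ (d <= k)%N,
      exists2 j, (j < k)%N & descending k d * x i = x j * descending k d
    | exists2 d', (d' <= k)%N &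
        descending k d * x i = (q - 1) *: descending k d + q *: descending k d'].
Proof.
move=> ltk dk ik.
case: (ltngtP (d + i) k) => h.
- by constructor 2; exists i; [lia | apply: descending_commute].
- case: i ik h => [|i] ik h.
    have ed : d = k.+1 by lia.
    constructor 3; exists k => //; rewrite ed /= subnn -mulrA x_quadratic; last lia.
    by rewrite mulrDr -!scalerAr mulr1.
  case: (ltnP k (d + i)) => h'.
    by constructor 2; exists i => //; apply: descending_shift.
  constructor 3; case: d dk h h' => [|d] dk h h'; first lia.
  exists d; first lia.
  have -> : descending k d.+1 = descending k d * x i.+1 by rewrite /=; congr (_ * x _); lia.
  by rewrite -mulrA x_quadratic; [rewrite mulrDr -!scalerAr mulr1 | lia].
- by constructor 1; split; [rewrite /=; congr (_ * x _); lia | lia].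
Qed.

Lemma mulr_linear (y : A) : linear (fun z : A => z * y).
Proof. by move=> c u w; rewrite mulrDl scalerAl. Qed.

Lemma mem_normal_words k b d : b \in normal_words k -> (d <= k.+1)%N ->
  b * descending k d \in normal_words k.+1.
Proof. by move=> bk dk; apply: allpairs_f => //; rewrite mem_iota. Qed.

Lemma normal_words_mulr k i : (k <= m)%N -> (i < k)%N -> forall y,
  inspan (normal_words k) y -> inspan (normal_words k) (y * x i).
Proof.
elim: k i => // k IH i km ik y.
apply: (inspan_map (mulr_linear (x i))) => _ /allpairsP[[b d] [bk + ->]].
rewrite mem_iota add0n ltnS => /andP[_ dk]; rewrite /= in bk dk *.
have words d' u : (d' <= k.+1)%N -> inspan (normal_words k) u ->
    inspan (normal_words k.+1) (u * descending k d').
  move=> dk'; apply: (inspan_map (mulr_linear _)) => w wk.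
  exact/inspan_mem/mem_normal_words.
have bspan : inspan (normal_words k) b by apply: inspan_mem.
rewrite -mulrA.
case: (descending_gen km dk (ik : (i <= k)%N)) => [[-> dk']|[j jk ->]|[d' dk' ->]].
- exact: words.
- by rewrite mulrA; apply: words => //; apply: IH => //; apply: ltnW.
- rewrite mulrDr -!scalerAr -[q *: _]addr0; apply: inspan_lin; first exact: words.
  apply: inspan_lin; last exact: inspan0.
  by apply: words => //; apply: leqW.
Qed.

Lemma normal_words1 k : 1 \in normal_words k.
Proof.
elim: k => [|k IH]; first exact: mem_head.
by rewrite -[1]mulr1; apply: (@mem_normal_words k 1 0).
Qed.

End NormalWords.

Section SpanningSet.
Context (K : fieldType) (n : nat) (q : K).
Hypothesis n_gt0 : (0 < n)%N.
Local Notation H := (hecke n q).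

Lemma hecke_spanning : exists2 s : seq H, size s = n`! & forall h, inspan s h.
Proof.
pose s := normal_words (@gnat K n q) n.-1.
exists s; first by rewrite size_normal_words prednK.
pose P h := forall y, inspan s y -> inspan s (y * h).
have PH : forall h, P h.
  apply: hecke_ind => [y|c h1 h2 h1P h2P y ys|h1 h2 h1P h2P y ys|i].
  - by rewrite mulr1.
  - by rewrite mulrDr -scalerAr; apply: inspan_lin; [apply: h1P | apply: h2P].
  - by rewrite mulrA; apply/h2P/h1P.
  have gi : gnat n q i = hecke_gen q i by apply: gnat_ord.
  move=> y ys; rewrite -gi.
  exact: (normal_words_mulr (@gnat_quadratic _ _ _) (@gnat_braid _ _ _) (@gnat_commute _ _ _)
    (leqnn _) (ltn_ord i) ys).
by move=> h; rewrite -[h]mul1r; apply: PH; apply/inspan_mem/normal_words1.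
Qed.

End SpanningSet.

(* The values of the [phi p] on [s] and the coordinates of the [e p] in [s] form
   square matrices (after padding [s] by [0]) with product 1 in one order, hence in
   the other. *)
Lemma dual_spanning (K : fieldType) (V : lmodType K) (P : finType) (s : seq V)
    (e : P -> V) (phi : P -> V -> K^o) :
  (forall x, inspan s x) -> (size s <= #|P|)%N ->
  (forall p, linear (phi p)) -> (forall p r, phi p (e r) = (p == r)%:R) ->
  forall x, (forall p, phi p x = 0) -> x = 0.
Proof.
move=> sV sP phi_lin phi_e x phi_x.
have spanE y : exists c : nat -> K, y = \sum_(i < #|P|) c i *: s`_i.
  have [c ->] := sV y; exists c; rewrite (big_ord_widen _ (fun i => c i *: s`_i) sP).
  rewrite big_mkcond; apply: eq_bigr => i _; case: ltnP => // le.
  by rewrite nth_default // scaler0.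
have phi_sum p (c : nat -> K) :
    phi p (\sum_(i < #|P|) c i *: s`_i) = \sum_(i < #|P|) c i * phi p s`_i.
  by rewrite linear_comb.
pose C := \matrix_(r < #|P|, i < #|P|) projT1 (cid (spanE (e (enum_val r)))) i.
pose D := \matrix_(i < #|P|, p < #|P|) (phi (enum_val p) s`_i : K).
have CD : C *m D = 1%:M.
  apply/matrixP => r p; rewrite !mxE.
  under eq_bigr => i _ do rewrite !mxE.
  rewrite -phi_sum -(projT2 (cid (spanE (e (enum_val r))))) phi_e.
  by rewrite (inj_eq enum_val_inj) eq_sym.
have DC := mulmx1C CD.
have [c xE] := spanE x.
have c0 : (\row_i c (i : 'I_#|P|)) = 0.
  rewrite -[LHS]mulmx1 -DC mulmxA (_ : _ *m D = 0) ?mul0mx //.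
  apply/rowP => p; rewrite !mxE -[RHS](phi_x (enum_val p)) xE phi_sum.
  by apply: eq_bigr => i _; rewrite !mxE.
rewrite xE big1 // => i _; have /rowP/(_ i) := c0.
by rewrite !mxE => ->; rewrite scale0r.
Qed.

(** * Faithfulness of the seminormal modules *)

Section Faithful.
Context (K : numClosedFieldType) (n : nat) (q : K).
Hypothesis n_gt0 : (0 < n)%N.
Hypothesis q_neq0 : q != 0.
Hypothesis q_not_root : forall k : nat, (1 <= k <= n)%N -> q ^+ k != 1.
Local Notation H := (hecke n q).

(** Matrix coefficients are dual to the matrix units, and by [sum_stab_sqr] there are at least as
    many of them as spanning words, as [dual_spanning] requires. *)
Lemma hecke_faithful (h : H) :
  (forall (la : young n) T, is_standard la T -> pi_rep q la h (tab_vec K la T) = 0) -> h = 0.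
Proof.
move=> h0; have [s size_s sH] := hecke_spanning q n_gt0.
pose P : finType := {la : young n & (stab la * stab la)%type}.
have unit_of (p : P) : exists e : H, matrix_unit (val (tagged p).1) (val (tagged p).2) e.
  exact: (matrix_unit_exists q_neq0 q_not_root (valP (tagged p).1) (valP (tagged p).2)).
pose e p := projT1 (cid (unit_of p)).
have eP p : matrix_unit (val (tagged p).1) (val (tagged p).2) (e p) := projT2 (cid (unit_of p)).
pose phi (p : P) (x : H) : K^o :=
  (pi_rep q (tag p) x (tab_vec K (tag p) (val (tagged p).2)) : seminormal_space K _) (tagged p).1.
have rep la := pi_rep_representation q_neq0 q_not_root la.
apply: (dual_spanning (e := e) (phi := phi) sH).
- rewrite size_s; apply: leq_trans (sum_stab_sqr n_gt0) _.
  rewrite card_tagged sumnE big_map big_enum /=; apply: leq_sum => la _.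
  by rewrite card_prod mulnn.
- by move=> p c x y; rewrite /phi (act_linl (rep _)) !ffunE.
- move=> p r; rewrite /phi eP; last exact: valP.
  case: r p => [mu [S' T']] [la [S T]] /=; case: eqP => [eT|neT].
    have stdT : is_standard mu (val T) by rewrite [val T]eT; apply: (valP T').
    have emu : la = mu by apply: std_shape_inj (valP T) stdT.
    subst mu; rewrite ffunE (val_inj eT); congr (_%:R).
    by rewrite eq_Tagged /= xpair_eqE eqxx andbT val_eqE.
  rewrite ffunE (_ : (_ == _) = false) //; apply/eqP => e1.
  have emu : la = mu by have := congr1 tag e1.
  subst mu; apply: neT; have := congr1 (fun x : {la : young n & (stab la * stab la)%type} => 
     val (tagged x).2) e1; done.
by move=> p; rewrite /phi h0 ?ffunE //; apply: valP.
Qed.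

End Faithful.

(** Expresses [y * x] by [x * y] alone, which puts f_2 f_1 into the algebra generated by f_1 f_2. *)
Lemma involution_swap (K : fieldType) (A : algType K) (x y : A) (d : K) :
  x * x = 1 -> x * y * x = y * x * y + d *: (x - y) ->
  y * x = (x * y) * (x * y) + d *: (1 - x * y).
Proof.
move=> xx xyx; have := congr1 (fun z => x * z) xyx.
by rewrite !mulrA xx mul1r mulrDr -scalerAr mulrBr xx !mulrA.
Qed.

Lemma mulr_shift (K : fieldType) (A : algType K) (x y : A) (c d : K) :
  y * (c *: x + d%:A) = c *: (y * x) + (d *: y + 0).
Proof. by rewrite mulrDr -!scalerAr mulr1 addr0. Qed.

Section EvenPart.
Context (K : fieldType) (A : algType K) (S : set A) (J : Type) (f0 : A) (f : J -> A).
Hypothesis f0_sq : f0 * f0 = 1.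
Hypothesis f0f : forall j, in_subalg S (f0 * f j).
Hypothesis ff0 : forall j, in_subalg S (f j * f0).

Definition even_odd h := exists a b, [/\ in_subalg S a, in_subalg S b & h = a + b * f0].

Lemma in_subalg0 : in_subalg S 0.
Proof. by rewrite -[0](subrr 1) addrC -scaleN1r; apply: in_subalg_lin; apply: in_subalg_one. Qed.

Lemma in_subalgD x y : in_subalg S x -> in_subalg S y -> in_subalg S (x + y).
Proof. by move=> hx hy; rewrite -[x]scale1r; apply: in_subalg_lin. Qed.

Lemma in_subalgZ c x : in_subalg S x -> in_subalg S (c *: x).
Proof. by move=> hx; rewrite -[_ *: x]addr0; apply: in_subalg_lin => //; apply: in_subalg0. Qed.

Lemma even_odd1 : even_odd 1.
Proof.
exists 1, 0; split; [exact: in_subalg_one | exact: in_subalg0 |].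
by rewrite mul0r addr0.
Qed.

Lemma even_odd0 : even_odd 0.
Proof.
exists 0, 0; split; [exact: in_subalg0 | exact: in_subalg0 |].
by rewrite mul0r addr0.
Qed.

Lemma even_odd_lin c x y : even_odd x -> even_odd y -> even_odd (c *: x + y).
Proof.
move=> [a [b [ha hb ->]]] [a' [b' [ha' hb' ->]]].
exists (c *: a + a'), (c *: b + b'); split; try exact: in_subalg_lin.
by rewrite scalerDr mulrDl scalerAl addrACA.
Qed.

(** Right multiplication by [f j] exchanges the two parts: b f_0 f_j is even, and a f_j = (a f_j
    f_0) f_0. *)
Lemma even_odd_mulr x j : even_odd x -> even_odd (x * f j).
Proof.
move=> [a [b [ha hb ->]]]; exists (b * (f0 * f j)), (a * (f j * f0)); split.
- exact: in_subalg_mul.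
- exact: in_subalg_mul.
by rewrite mulrDl addrC !mulrA -[a * f j * f0 * f0]mulrA f0_sq mulr1.
Qed.

End EvenPart.

Section ShiftedOperators.
Context (K : fieldType) (X : finType) (q a b : K).
Local Notation V := {ffun X -> K^o}.
Variables g h : V -> V.
Hypothesis gD : forall u w, g (u + w) = g u + g w.
Hypothesis gZ : forall c u, g (c *: u) = c *: g u.
Hypothesis hD : forall u w, h (u + w) = h u + h w.
Hypothesis hZ : forall c u, h (c *: u) = c *: h u.
Hypothesis g_quadratic : forall w, g (g w) = (q - 1) *: g w + q *: w.
Hypothesis h_quadratic : forall w, h (h w) = (q - 1) *: h w + q *: w.
Local Notation sg := (fun w => a *: g w + b *: w).
Local Notation sh := (fun w => a *: h w + b *: w).

(** The relations of the f_i are checked on functions, where evaluation at a point leaves identities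
    in [K]; faithfulness carries them to the algebra. *)
Lemma shift_sq w : a * a * (q - 1) + 2%:R * a * b = 0 -> a * a * q + b * b = 1 ->
  sg (sg w) = w.
Proof.
move=> e1 e2; rewrite /= !(gD, gZ, g_quadratic); move: (g w) => x.
apply/ffunP => S; rewrite !ffunE /GRing.scale /=.
transitivity ((a * a * (q - 1) + 2%:R * a * b) * x S + (a * a * q + b * b) * w S); first by ring.
by rewrite e1 e2 mul0r add0r mul1r.
Qed.

Lemma shift_comm w : (forall u, g (h u) = h (g u)) -> sg (sh w) = sh (sg w).
Proof.
move=> gh; rewrite /= !(gD, gZ, hD, hZ, gh); move: (h (g w)) (g w) (h w) => x y z.
by apply/ffunP => S; rewrite !ffunE /GRing.scale /=; ring.
Qed.

(** The defect comes from a^2 b (g^2 - h^2) + a b^2 (g - h), once the quadratic relation gives g^2 -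
    h^2 = (q-1) (g - h). *)
Lemma shift_braid w : (forall u, g (h (g u)) = h (g (h u))) ->
  sg (sh (sg w)) = sh (sg (sh w)) + (a * b * (q - 1) + b * b) *: (sg w - sh w).
Proof.
move=> gh; rewrite /= !(gD, gZ, hD, hZ) gh !g_quadratic !h_quadratic.
move: (h (g (h w))) (h (g w)) (g (h w)) (g w) (h w) => x y z t u.
by apply/ffunP => S; rewrite !ffunE /GRing.scale /=; ring.
Qed.

End ShiftedOperators.

(** * The alternating subalgebra *)

Section Alternating.
Context (K : numClosedFieldType) (n : nat) (q : K).
Hypothesis n_ge2 : (1 < n)%N.
Hypothesis q_neq0 : q != 0.
Hypothesis q_not_root : forall k : nat, (1 <= k <= n)%N -> q ^+ k != 1.
Local Notation H := (hecke n q).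
Local Notation v := (tab_vec K).
Local Notation G := (seminormal_gen q).
Local Notation f := (@hecke_f K n q).

Let rep la : representation (pi_rep q la) := pi_rep_representation q_neq0 q_not_root la.

Lemma q_neqN1 : q + 1 != 0.
Proof.
have := q_not_root (n_ge2 : (1 <= 2 <= n)%N); rewrite -subr_eq0.
by apply: contra => /eqP e; rewrite (subr_sqr_1 q) e mulr0.
Qed.

Lemma hecke_ext (h h' : H) :
  (forall la (w : seminormal_space K la), pi_rep q la h w = pi_rep q la h' w) -> h = h'.
Proof.
move=> e; apply/eqP; rewrite -subr_eq0; apply/eqP.
apply: (hecke_faithful (ltnW n_ge2) q_neq0 q_not_root) => la T _.
by rewrite (actBl (rep la)) e subrr.
Qed.

Let a := 2%:R / (q + 1).
Let b := - (q - 1) / (q + 1).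

Definition fgen la (i : 'I_n.-1) (w : seminormal_space K la) : seminormal_space K la :=
  a *: G i w + b *: w.
Local Notation F := fgen.

Lemma act_hecke_f la i w : pi_rep q la (f i) w = F i w.
Proof.
apply: (etrans (act_shift (rep la) _ _ _ _ _)); rewrite (pi_rep_gen q_neq0 q_not_root).
rewrite /fgen /a /b scalerBr !scalerA.
by rewrite -scaleNr mulNr [(q - 1) / _]mulrC [2%:R / _]mulrC.
Qed.

Lemma fgen_linear la i : linear (@fgen la i).
Proof.
move=> c u w; rewrite /fgen seminormal_gen_linear.
move: (G i u) (G i w) => x y.
by apply/ffunP => S; rewrite !ffunE /GRing.scale /=; ring.
Qed.

Lemma fgen_sq la i (w : seminormal_space K la) : F i (F i w) = w.
Proof.
apply: (shift_sq (q := q)); try exact: seminormal_genD; try exact: seminormal_genZ.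
- exact: seminormal_quadratic.
- by rewrite /a /b; field; apply: q_neqN1.
- by rewrite /a /b; field; apply: q_neqN1.
Qed.

Lemma fgen_commute la (i j : 'I_n.-1) (w : seminormal_space K la) :
  (i.+1 < j)%N || (j.+1 < i)%N -> F i (F j w) = F j (F i w).
Proof.
move=> ij; apply: shift_comm; try exact: seminormal_genD; try exact: seminormal_genZ.
by move=> u; apply: seminormal_commute.
Qed.

Lemma fgen_braid la (i j : 'I_n.-1) (w : seminormal_space K la) : j = i.+1 :> nat ->
  F i (F j (F i w)) = F j (F i (F j w)) + (a * b * (q - 1) + b * b) *: (F i w - F j w).
Proof.
move=> ji; apply: (shift_braid (q := q)); try exact: seminormal_genD; try exact: seminormal_genZ.
- exact: seminormal_quadratic.
- exact: seminormal_quadratic.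
- by move=> u; apply: seminormal_braid.
Qed.

Lemma hecke_f_sq i : f i * f i = 1.
Proof.
by apply: hecke_ext => la w; rewrite (actM (rep la)) !act_hecke_f fgen_sq (act1 (rep la)).
Qed.

Lemma act_hecke_ff la i j w : pi_rep q la (f i * f j) w = F i (F j w).
Proof.
apply: (etrans (actM (rep la) (f i) (f j) w)).
by rewrite act_hecke_f act_hecke_f.
Qed.

Lemma act_hecke_fff la i j k w : pi_rep q la (f i * f j * f k) w = F i (F j (F k w)).
Proof.
apply: (etrans (actM (rep la) (f i * f j) (f k) w)).
by rewrite act_hecke_f act_hecke_ff.
Qed.

Lemma hecke_f_commute (i j : 'I_n.-1) : (i.+1 < j)%N || (j.+1 < i)%N -> f i * f j = f j * f i.
Proof.
move=> ij; apply: hecke_ext => la w.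
by apply: (etrans (act_hecke_ff i j w)); apply: (etrans _ (esym (act_hecke_ff j i w)));
  apply: fgen_commute.
Qed.

Lemma hecke_f_braid (i j : 'I_n.-1) : j = i.+1 :> nat ->
  f i * f j * f i = f j * f i * f j + (a * b * (q - 1) + b * b) *: (f i - f j).
Proof.
move=> ji; apply: hecke_ext => la w; apply: (etrans (act_hecke_fff i j i w)).
have lin c x y z : pi_rep q la (x + c *: (y - z)) w =
    pi_rep q la x w + c *: (pi_rep q la y w - pi_rep q la z w).
  by rewrite (actDl (rep la)) (actZl (rep la)) (actBl (rep la)).
apply: (etrans _ (esym (lin _ _ _ _))); apply: (etrans (fgen_braid w ji)).
by congr (_ + _ *: (_ - _)); apply: esym;
  [apply: act_hecke_fff | apply: act_hecke_f | apply: act_hecke_f].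
Qed.

Local Notation sub := (in_subalg (@alt_gens K n q)).
Lemma pred_n_gt0 : (0 < n.-1)%N.
Proof. by rewrite -subn1 subn_gt0. Qed.

Definition first_gen : 'I_n.-1 := Ordinal pred_n_gt0.
Local Notation i0 := first_gen.

Lemma first_f_sub j : sub (f i0 * f j).
Proof.
case: (posnP j) => [j0|j_gt0].
  by have -> : j = i0 by [apply: val_inj]; rewrite hecke_f_sq; apply: in_subalg_one.
by apply: in_subalg_gen; exists i0, j.
Qed.

(** Only the second generator fails to commute with the first, and for it [involution_swap]
    applies. *)
Lemma f_first_sub j : sub (f j * f i0).
Proof.
have := first_f_sub j; case: (ltngtP j 1) => [j0|j1|j1] uP.
- by have -> : j = i0 by [apply: val_inj => /=; lia]; rewrite hecke_f_sq; apply: in_subalg_one.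
- by rewrite hecke_f_commute // j1 orbT.
have -> := involution_swap (hecke_f_sq i0) (hecke_f_braid (j1 : nat_of_ord j = i0.+1)).
apply: in_subalgD; first exact: in_subalg_mul.
apply: in_subalgZ; rewrite -scaleN1r; apply: in_subalgD; first exact: in_subalg_one.
exact: in_subalgZ.
Qed.

Lemma hecke_gen_from_f i : hecke_gen q i = ((q + 1) / 2%:R) *: f i + ((q - 1) / 2%:R)%:A.
Proof.
have key (A : algType K) (x : A) : x = ((q + 1) / 2%:R) *:
    ((q + 1)^-1 *: (2%:R *: x - (q - 1)%:A)) + ((q - 1) / 2%:R)%:A.
  have e1 : (q + 1) / 2%:R * (q + 1)^-1 * 2%:R = 1 by field; apply: q_neqN1.
  have e2 : (q + 1) / 2%:R * (q + 1)^-1 * (q - 1) = (q - 1) / 2%:R by field; apply: q_neqN1.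
  by rewrite scalerA scalerBr !scalerA e1 e2 scale1r subrK.
exact: key.
Qed.

Lemma hecke_even_odd h : even_odd (@alt_gens K n q) (f i0) h.
Proof.
pose P h := forall y, even_odd (@alt_gens K n q) (f i0) y -> even_odd (@alt_gens K n q) (f i0)
  (y * h).
have PH : forall h, P h.
  apply: hecke_ind => [y|c h1 h2 h1P h2P y ys|h1 h2 h1P h2P y ys|i y ys].
  - by rewrite mulr1.
  - rewrite mulrDr -scalerAr; apply: even_odd_lin; [exact: h1P | exact: h2P].
  - rewrite mulrA; apply: h2P; exact: h1P.
  rewrite (etrans (congr1 (fun z => y * z) (hecke_gen_from_f i)) (mulr_shift _ _ _ _)).
  apply: even_odd_lin; first exact: (even_odd_mulr (hecke_f_sq i0) first_f_sub f_first_sub _ ys).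
  exact: even_odd_lin ys (even_odd0 _ _).
by rewrite -[h]mul1r; apply: PH; apply: even_odd1.
Qed.

End Alternating.

Lemma restrict_representation (K : fieldType) (A : algType K) (S : set A) (X : action A) :
  representation X -> representation (restrict_action S X).
Proof.
case=> X1 X2 X3 X4; split=> [a|c a b v|v|a b v] /=.
- exact: X1.
- exact: X2.
- exact: X3.
- exact: X4.
Qed.

(** * Signed transposition *)

Section TransposeMap.
Context (K : numClosedFieldType) (n : nat) (q : K).
Hypothesis n_ge2 : (1 < n)%N.
Hypothesis q_neq0 : q != 0.
Hypothesis q_not_root : forall k : nat, (1 <= k <= n)%N -> q ^+ k != 1.
Local Notation H := (hecke n q).
Local Notation v := (tab_vec K).
Local Notation f := (@hecke_f K n q).
Local Notation sub := (in_subalg (@alt_gens K n q)).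
Implicit Types (la : young n).

Let rep la : representation (pi_rep q la) := pi_rep_representation q_neq0 q_not_root la.

(** The target [la'] is a separate parameter, tied to [tr_young la] by an equation, so that
    [la' = la] can be taken for self-conjugate shapes without a cast. *)
Definition transpose_map la la' (w : seminormal_space K la) : seminormal_space K la' :=
  \sum_(T : stab la) (w T : K) *: ((-1) ^+ inversions (val T) *: v la' (tr_tab (val T))).

Section Map.
Variables la la' : young n.
Hypothesis la'E : la' = tr_young la.
Local Notation J := (transpose_map la').

Lemma transpose_map_linear : linear (@transpose_map la la').
Proof.
move=> c u w; rewrite /transpose_map scaler_sumr -big_split /=.
by apply: eq_bigr => T _; rewrite !ffunE [X in X *: _ = _](_ : _ = c * (u T : K) + w T) //
  scalerDl [c *: (_ *: _)]scalerA.
Qed.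

Lemma transpose_map_vec T : is_standard la T ->
  J (v la T) = (-1) ^+ inversions T *: v la' (tr_tab T).
Proof.
move=> stdT; rewrite /transpose_map (bigD1 (Sub T stdT : stab la)) //= ffunE eqxx scale1r.
rewrite big1 ?addr0 // => S; rewrite -val_eqE /= ffunE => /negPf ->.
by rewrite scale0r.
Qed.

Lemma transpose_mapD u w : J (u + w : seminormal_space K la) = J u + J w.
Proof. by rewrite -[u]scale1r transpose_map_linear !scale1r. Qed.

Lemma transpose_map0 : J (0 : seminormal_space K la) = 0.
Proof. exact: linear_at0 transpose_map_linear. Qed.

Lemma transpose_mapZ c u : J (c *: u : seminormal_space K la) = c *: J u.
Proof. by rewrite -[c *: u]addr0 transpose_map_linear transpose_map0 addr0. Qed.

Lemma transpose_mapB u w : J (u - w : seminormal_space K la) = J u - J w.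
Proof. by rewrite -[- w]scaleN1r transpose_mapD transpose_mapZ scaleN1r. Qed.

Lemma transpose_map_inj : injective (@transpose_map la la').
Proof.
suff ker w : J (w : seminormal_space K la) = 0 -> w = 0.
  move=> u w e; apply/eqP; rewrite -subr_eq0; apply/eqP/ker.
  by rewrite transpose_mapB e subrr.
move=> Jw; apply/ffunP => T.
have stdT' : is_standard la' (tr_tab (val T)) by rewrite la'E; apply/tr_std/(valP T).
have /ffunP/(_ (Sub _ stdT' : stab la')) := Jw.
rewrite /transpose_map sum_ffunE (bigD1 T) //= big1 => [|S neST].
  rewrite !ffunE eqxx addr0 /GRing.scale /= mulr1 => /eqP.
  by rewrite mulf_eq0 signr_eq0 orbF => /eqP.
rewrite !ffunE (_ : (_ == _) = false) ?scaler0 //.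
apply/eqP => /(inv_inj (@tr_tabK n)) /val_inj e.
by rewrite e eqxx in neST.
Qed.

(** Transposition replaces d by -d, and a(-d) = q-1 - a(d) negates the diagonal coefficient of f_i;
    b(-d) = b(d), but there the parity of the inversions changes. *)
Lemma transpose_map_fgen i (w : seminormal_space K la) :
  fgen q i (J w) = - J (fgen q i w).
Proof.
move: w; apply: linear_ext => [c u w|c u w|T stdT].
- by rewrite transpose_map_linear fgen_linear.
- rewrite fgen_linear transpose_map_linear opprD scalerN //.
have stdT' : is_standard la' (tr_tab T) by rewrite la'E; apply: tr_std.
have distE : gen_dist (tr_tab T) i = - gen_dist T i.
  by rewrite /gen_dist /axial_distance !content_tr -opprD.
have offE : off_coef q (gen_dist T i) *: J (v la (swap_tab i T)) =
    - (off_coef q (gen_dist T i) * (-1) ^+ inversions T) *: v la' (tr_tab (swap_tab i T)).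
  have [->|neq] : off_coef q (gen_dist T i) = 0 \/ (T (entry i)).1 != (T (entryS i)).1.
  - rewrite /gen_dist; case: (axialP stdT i) => [_|_|d _ h _|d _ h _]; try by right.
    by left; rewrite off_coefN off_coef1.
  - by rewrite mul0r oppr0 !scale0r.
  case: (swap_std_or_off0 q i stdT) => [->|stdS].
    by rewrite mul0r oppr0 !scale0r.
  rewrite transpose_map_vec // scalerA -mulrN; congr (_ * _ *: _).
  by rewrite -signr_odd inversions_swap // -[in RHS]signr_odd; case: odd;
    rewrite ?expr0 ?expr1 ?opprK.
rewrite {1}transpose_map_vec // /fgen seminormal_genZ !(seminormal_genE q_neq0 q_not_root) //.
rewrite !(transpose_mapD, transpose_mapZ) offE transpose_map_vec //.
rewrite swap_tr distE off_coefN.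
have -> : diag_coef q (- gen_dist T i) = q - 1 - diag_coef q (gen_dist T i).
  have d0 : gen_dist T i != 0 by apply: (axial_neq0 stdT).
  have qd : q ^ gen_dist T i != 1.
    by apply: (qz_neq1 q_neq0 q_not_root d0); apply/ltW/(std_axial_lt stdT).
  have qd0 : q ^ gen_dist T i != 0 by rewrite expfz_neq0.
  rewrite /diag_coef -invr_expz; move: (q ^ _) qd qd0 => x x1 x0.
  by field; rewrite x0 !subr_eq0 x1 eq_sym x1.
have q1 := q_neqN1 n_ge2 q_not_root.
apply/ffunP => S; rewrite !ffunE /GRing.scale /=.
move: (_ == _)%:R (_ == _)%:R (off_coef _ _) (diag_coef _ _) ((-1) ^+ _) => x y o d s.
by field.
Qed.

(** The generators are products of two f_i, and the two signs cancel. *)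
Lemma transpose_map_alt x (w : seminormal_space K la) : sub x ->
  pi_rep q la' x (J w) = J (pi_rep q la x w).
Proof.
move=> hx; elim: hx w => {x} [_ [i [j [_ _ ->]]]||c x y _ IHx _ IHy|x y _ IHx _ IHy] w.
- rewrite (act_hecke_ff q_neq0 q_not_root i j (J w)) (act_hecke_ff q_neq0 q_not_root i j w).
  rewrite transpose_map_fgen.
  have -> : - J (fgen q j w) = (-1) *: J (fgen q j w) by rewrite scaleN1r.
  have lin := @fgen_linear K n q la' i (-1) (J (fgen q j w)) 0.
  have F0 := linear_at0 (@fgen_linear K n q la' i).
  by rewrite F0 !addr0 in lin; rewrite lin scaleN1r transpose_map_fgen opprK.
- by rewrite (act1 (rep la')) (act1 (rep la)).
- by rewrite (act_linl (rep la')) (act_linl (rep la)) IHx IHy transpose_map_linear.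
- by rewrite (actM (rep la')) (actM (rep la)) IHy IHx.
Qed.

End Map.

(* If h = a + b f_1 with a and b even, then J a = a J and J b f_1 = - b f_1 J, so
   that J h + h J = 2 J a. *)
Lemma alt_lift (h : H) : exists x : alt_hecke n q, forall la la', la' = tr_young la ->
  forall w : seminormal_space K la,
  transpose_map la' (pi_rep q la (val x) w) =
  transpose_map la' (pi_rep q la h w) + pi_rep q la' h (transpose_map la' w).
Proof.
have [a [b [ha hb ->]]] := hecke_even_odd n_ge2 q_neq0 q_not_root h.
have h2a : 2%:R *: a \in subalg_pred (@alt_gens K n q) by apply/asboolP/in_subalgZ.
exists (Subalg h2a) => la la' la'E w; set f0 := hecke_f _ _.
have split_act (mu : young n) (x y z : H) u : pi_rep q mu (x + y * z) u =
    pi_rep q mu x u + pi_rep q mu y (pi_rep q mu z u).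
  by rewrite (actDl (rep mu)) (actM (rep mu)).
rewrite (split_act la a b f0 w) (split_act la' a b f0 (transpose_map la' w)).
have fJ u : pi_rep q la' f0 (transpose_map la' u) = - transpose_map la' (pi_rep q la f0 u).
  by rewrite /f0 !(act_hecke_f q_neq0 q_not_root) transpose_map_fgen.
have altJ x u : sub x -> pi_rep q la' x (transpose_map la' u) = transpose_map la' (pi_rep q la
  x u).
  exact: transpose_map_alt.
have actN x u : pi_rep q la' x (- u) = - pi_rep q la' x u.
  by rewrite -[- u]scaleN1r (actZr (rep la')) scaleN1r.
rewrite fJ actN !altJ // !(transpose_mapD la').
rewrite addrACA subrr addr0.
have -> : pi_rep q la (2%:R *: a) w = 2%:R *: pi_rep q la a w by rewrite (actZl (rep la)).
by rewrite transpose_mapZ scaler_nat mulr2n.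
Qed.

End TransposeMap.

(** * The two halves of a self-conjugate module *)

Section HalfSpaces.
Context (K : numClosedFieldType) (n : nat) (q : K).
Hypothesis n_ge2 : (1 < n)%N.
Hypothesis q_neq0 : q != 0.
Hypothesis q_not_root : forall k : nat, (1 <= k <= n)%N -> q ^+ k != 1.
Local Notation H := (hecke n q).
Local Notation v := (tab_vec K).
Implicit Types (la mu : young n).

Let rep la : representation (pi_rep q la) := pi_rep_representation q_neq0 q_not_root la.

Section SelfConjugate.
Variable la : young n.
Hypothesis la_self : tr_young la = la.
Local Notation V := (seminormal_space K la).

Definition self_transpose (w : V) : V := 'i ^+ above_diagonal la *: transpose_map la w.
Local Notation tau := self_transpose.

Lemma self_transpose_linear : linear tau.
Proof.
move=> c u w; rewrite /self_transpose transpose_map_linear //.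
by rewrite scalerDr !scalerA [_ * c]mulrC.
Qed.

Lemma self_transposeD u w : tau (u + w) = tau u + tau w.
Proof. by rewrite -[u]scale1r self_transpose_linear !scale1r. Qed.

Lemma self_transpose0 : tau 0 = 0.
Proof. exact: linear_at0 self_transpose_linear. Qed.

Lemma self_transposeZ c u : tau (c *: u) = c *: tau u.
Proof. by rewrite -[c *: u]addr0 self_transpose_linear self_transpose0 addr0. Qed.

Lemma self_transpose_vec T : is_standard la T -> tau (v la T) = transpose_vec K la T.
Proof. by move=> stdT; rewrite /self_transpose transpose_map_vec // scalerA. Qed.

Lemma self_std T : is_standard la T -> is_standard la (tr_tab T).
Proof. by move=> stdT; rewrite -la_self; apply: tr_std. Qed.

(** Squaring the power of ['i] gives the sign of [above_diagonal la], which by [odd_inversions_tr]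
    cancels the product of the signs of [T] and its transpose. *)
Lemma self_transposeK : involutive tau.
Proof.
apply: (linear_ext (f := fun w => tau (tau w)) (g := id)) => [c u w|c u w|T stdT] //.
  by rewrite !self_transpose_linear.
rewrite self_transpose_vec // /transpose_vec self_transposeZ self_transpose_vec;
  last exact: self_std.
rewrite /transpose_vec tr_tabK scalerA mulrACA -!exprD addnn -mul2n exprM sqrCi.
rewrite -exprD -signr_odd oddD (odd_inversions_tr stdT la_self).
by rewrite addbb expr0 scale1r.
Qed.

Lemma self_transpose_alt (x : alt_hecke n q) w :
  pi_rep q la (val x) (tau w) = tau (pi_rep q la (val x) w).
Proof.
rewrite (actZr (rep la)) (transpose_map_alt n_ge2 q_neq0 q_not_root) //.
by case: x => x /= /asboolP.
Qed.

Definition half_vec (s : bool) T : V := v la T + (-1) ^+ s *: transpose_vec K la T.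

Lemma self_transpose_half_vec s T : is_standard la T ->
  tau (half_vec s T) = (-1) ^+ s *: half_vec s T.
Proof.
move=> stdT; rewrite /half_vec -!self_transpose_vec // self_transposeD self_transposeZ.
by rewrite self_transposeK scalerDr scalerA -expr2 sqrr_sign scale1r addrC.
Qed.

Lemma half_vec_in s T : is_standard la T -> is_plus T -> half_vec s T \in half_space K s la.
Proof.
move=> stdT plusT; rewrite /half_space.
have : half_vec s T \in <[v la T + (-1) ^+ s *: transpose_vec K la T]>%VS by apply: memv_line.
by apply/subvP; apply: (sumv_sup (Sub T stdT : stab la)).
Qed.

Lemma half_space_span (s : bool) w : w \in half_space K s la ->
  exists c : stab la -> K, w = \sum_(T : stab la | is_plus (val T)) c T *: half_vec s (val T).
Proof.
move/memv_sumP => [vs vsP ->].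
have ex T : exists k : K, is_plus (val T) -> vs T = k *: half_vec s (val T).
  case: (boolP (is_plus (val T))) => plusT; last by exists 0.
  by have /vlineP[k ->] := vsP T plusT; exists k.
exists (fun T => projT1 (cid (ex T))); apply: eq_bigr => T plusT.
exact: (projT2 (cid (ex T))).
Qed.

(** Identifies the halves with the eigenspaces of the involution [tau]; stability, trivial
    intersection and full sum are then immediate. *)
Lemma half_spaceP (s : bool) w : reflect (tau w = (-1) ^+ s *: w) (w \in half_space K s la).
Proof.
apply: (iffP idP) => [/half_space_span[c ->]|e].
  have tau_sum (P : pred (stab la)) F :
      tau (\sum_(T | P T) F T) = \sum_(T | P T) tau (F T).
    by apply: (big_morph tau); [exact: self_transposeD | exact: self_transpose0].
  rewrite tau_sum scaler_sumr; apply: eq_bigr => T plusT.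
  rewrite self_transposeZ self_transpose_half_vec ?scalerA 1?mulrC //; exact: valP.
have two : 2%:R != 0 :> K by rewrite pnatr_eq0.
have -> : w = 2%:R^-1 *: (w + (-1) ^+ s *: tau w).
  rewrite e scalerA -expr2 sqrr_sign scale1r -mulr2n -scaler_nat scalerA mulVf //.
  by rewrite scale1r.
apply: memvZ.
have lin : linear (fun w => w + (-1) ^+ s *: tau w).
  move=> c u w'; rewrite self_transpose_linear !scalerDr !scalerA [_ * c]mulrC.
  by rewrite addrACA.
rewrite [X in X + _](tab_vecE w) {2}(tab_vecE w).
rewrite (linear_comb _ _ _ lin); apply: memv_suml => T _; apply: memvZ.
have stdT := valP T; case: (boolP (is_plus (val T))) => plusT.
  by rewrite self_transpose_vec //; apply: half_vec_in.
(* Exactly one of [T] and its transpose is plus, and [tau] maps one basis vector to a multiple of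
   the other. *)
pose T' := tr_tab (val T).
have stdT' : is_standard la T' by apply: self_std.
have plusT' : is_plus T' by rewrite (is_plus_tr n_ge2 stdT).
have vE : tau (v la T') = 'i ^+ above_diagonal la * (-1) ^+ inversions T' *: v la (val T).
  by rewrite self_transpose_vec // /transpose_vec tr_tabK.
set c := 'i ^+ _ * _ in vE.
have c0 : c != 0 by rewrite mulf_neq0 ?signr_eq0 // expf_neq0 ?neq0Ci.
have -> : v la (val T) = c^-1 *: tau (v la T') by rewrite vE scalerA mulVf // scale1r.
rewrite self_transposeZ self_transposeK.
have -> : c^-1 *: tau (v la T') + (-1) ^+ s *: (c^-1 *: v la T') =
    (c^-1 * (-1) ^+ s) *: half_vec s T'.
  rewrite /half_vec -self_transpose_vec //; move: (tau (v la T')) (v la T') => x y.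
  rewrite scalerDr !scalerA -(mulrA c^-1) -expr2 sqrr_sign mulr1.
  by rewrite addrC [(-1) ^+ s * _]mulrC.
by apply: memvZ; apply: half_vec_in.
Qed.

Lemma half_space_stable s (x : alt_hecke n q) w :
  w \in half_space K s la -> pi_rep q la (val x) w \in half_space K s la.
Proof.
by move=> /half_spaceP e; apply/half_spaceP; rewrite -self_transpose_alt e (actZr (rep la)).
Qed.

Lemma half_space_cap : (half_space K false la :&: half_space K true la = 0)%VS.
Proof.
apply/eqP; rewrite -subv0; apply/subvP => w; rewrite memv_cap memv0 => /andP[].
move=> /half_spaceP e1 /half_spaceP; rewrite e1 expr0 expr1 scale1r scaleN1r => /eqP.
by rewrite -addr_eq0 -mulr2n -scaler_nat scaler_eq0 pnatr_eq0.
Qed.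

Lemma half_space_sum : (half_space K false la + half_space K true la = fullv)%VS.
Proof.
apply/eqP; rewrite eqEsubv subvf; apply/subvP => w _.
have two : 2%:R != 0 :> K by rewrite pnatr_eq0.
have -> : w = 2%:R^-1 *: (w + tau w) + 2%:R^-1 *: (w - tau w).
  rewrite -scalerDr addrACA subrr addr0 -mulr2n -scaler_nat scalerA mulVf //.
  by rewrite scale1r.
apply: memv_add; apply: memvZ; apply/half_spaceP.
  by rewrite self_transposeD self_transposeK expr0 scale1r addrC.
rewrite -[- tau w]scaleN1r self_transposeD self_transposeZ self_transposeK.
by rewrite expr1 scalerDr scalerA mulrNN mulr1 scale1r scaleN1r addrC.
Qed.

End SelfConjugate.

End HalfSpaces.

Lemma subspace_representation (K : fieldType) (A : algType K) (V : vectType K)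
    (rho : A -> V -> V) (U : {vspace V}) :
  representation (Action rho) -> (forall a w, w \in U -> rho a w \in U) ->
  representation (subspace_action rho U).
Proof.
move=> [] /= lin linl one mul stab; split=> /= [a c u w|c a b w|w|a b w].
- by rewrite linearP lin linearP.
- by rewrite linl linearP.
- by rewrite one vsvalK.
- by rewrite mul vsprojK // stab // subvsP.
Qed.

Lemma in_subalg_val (K : fieldType) (A : algType K) (S : set A) (x : subalg S) :
  in_subalg S (val x).
Proof. by case: x => x /= /asboolP. Qed.

(** * Matrix units in the alternating subalgebra *)

Section AltUnits.
Context (K : numClosedFieldType) (n : nat) (q : K).
Hypothesis n_ge2 : (1 < n)%N.
Hypothesis q_neq0 : q != 0.
Hypothesis q_not_root : forall k : nat, (1 <= k <= n)%N -> q ^+ k != 1.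
Local Notation H := (hecke n q).
Local Notation v := (tab_vec K).
Local Notation alt := (alt_hecke n q).
Implicit Types (la mu : young n).

Let rep la : representation (pi_rep q la) := pi_rep_representation q_neq0 q_not_root la.

Lemma act_eq0 la (h : H) :
  (forall U, is_standard la U -> pi_rep q la h (v la U) = 0) ->
  forall w, pi_rep q la h w = 0.
Proof.
move=> h0; apply: (linear_ext (f := pi_rep q la h) (g := fun=> 0)) => //.
- exact: (act_lin (rep la)).
- by move=> c u w; rewrite scaler0 addr0.
Qed.

Lemma alt_kill la T (h : H) (x : alt) mu : is_standard la T ->
  (forall mu U, is_standard mu U -> U != T -> pi_rep q mu h (v mu U) = 0) ->
  (forall la la', la' = tr_young la -> forall w : seminormal_space K la,
    transpose_map la' (pi_rep q la (val x) w) =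
    transpose_map la' (pi_rep q la h w) + pi_rep q la' h (transpose_map la' w)) ->
  mu <> la -> tr_young mu <> la -> forall w, pi_rep q mu (val x) w = 0.
Proof.
move=> stdT hU xE nmu ntmu w; apply: (transpose_map_inj (erefl (tr_young mu))).
have kill nu : nu <> la -> forall w, pi_rep q nu h w = 0.
  move=> nnu; apply: act_eq0 => U stdU; apply: hU => //.
  by apply/eqP => e; subst U; apply: nnu; apply: std_shape_inj stdU stdT.
by rewrite xE // !kill // transpose_map0 addr0.
Qed.

(** Since [T] is not standard of the transposed shape, the matrix unit kills V_{t la}; the second
    term of [alt_lift] vanishes on V_la, and the injective J can be cancelled. *)
Lemma alt_unit_full la T S : is_standard la T -> is_standard la S -> tr_young la <> la ->
  exists x : alt,
    (forall U, is_standard la U -> pi_rep q la (val x) (v la U) = if T == U then v la S else 0) /\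
    forall mu, mu <> la -> tr_young mu <> la -> forall w, pi_rep q mu (val x) w = 0.
Proof.
move=> stdT stdS nla; have [h hE] := matrix_unit_exists q_neq0 q_not_root stdS stdT.
have [x xE] := alt_lift n_ge2 q_neq0 q_not_root h; exists x.
have hU mu U : is_standard mu U -> U != T -> pi_rep q mu h (v mu U) = 0.
  by move=> stdU /negPf nU; rewrite hE // nU.
split=> [U stdU|mu nmu ntmu]; last exact: (alt_kill stdT hU xE nmu ntmu).
apply: (transpose_map_inj (erefl (tr_young la))); rewrite xE // transpose_map_vec //.
have stdU' := tr_std stdU.
rewrite (actZr (rep (tr_young la))) (hU (tr_young la) (tr_tab U)) ?scaler0 ?addr0 //; last first.
  by apply/eqP => e; apply: nla; apply: (std_shape_inj stdU'); rewrite e.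
by rewrite hE // eq_sym.
Qed.

Lemma alt_unit_half la (s : bool) T S : is_standard la T -> is_standard la S ->
  is_plus T -> is_plus S -> tr_young la = la ->
  exists x : alt,
    (forall (t : bool) U, is_standard la U -> is_plus U -> pi_rep q la (val x) (half_vec K la t
      U) =
       if (s == t) && (T == U) then half_vec K la s S else 0) /\
    forall mu, mu <> la -> forall w, pi_rep q mu (val x) w = 0.
Proof.
move=> stdT stdS plusT plusS tla.
have stdS' := self_std tla stdS.
have [h1 h1E] := matrix_unit_exists q_neq0 q_not_root stdS stdT.
have [h2 h2E] := matrix_unit_exists q_neq0 q_not_root stdS' stdT.
pose c := 'i ^+ above_diagonal la * (-1) ^+ inversions S : K.
(* [h] sends [v T] to half of [half_vec s S]; the factor 1/2 makes up for the doubling in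
   [alt_lift]. *)
pose h : H := 2%:R^-1 *: (h1 + ((-1) ^+ s * c) *: h2).
have hE mu U : is_standard mu U -> pi_rep q mu h (v mu U) =
    if U == T then 2%:R^-1 *: (v mu S + ((-1) ^+ s * c) *: v mu (tr_tab S)) else 0.
  move=> stdU; rewrite (actZl (rep mu)) (actDl (rep mu)) (actZl (rep mu)) h1E // h2E //.
  by case: eqP => // _; rewrite scaler0 addr0 scaler0.
have hU mu U : is_standard mu U -> U != T -> pi_rep q mu h (v mu U) = 0.
  by move=> stdU /negPf nU; rewrite hE // nU.
have [x xE] := alt_lift n_ge2 q_neq0 q_not_root h; exists x.
split=> [t U stdU plusU|mu nmu]; last first.
  by apply: (alt_kill stdT hU xE) => // e; apply: nmu; rewrite -tla -e tr_youngK.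
have tau_inj := inv_inj (self_transposeK tla).
apply: tau_inj; rewrite [LHS]/self_transpose (xE la la) // scalerDr.
rewrite -[X in X + _]/(self_transpose _) -(actZr (rep la)) -[_ *: transpose_map _
  _]/(self_transpose _).
rewrite self_transpose_half_vec // (actZr (rep la)).
have stdU' := self_std tla stdU.
have hhalf : pi_rep q la h (half_vec K la t U) = if T == U then 2%:R^-1 *: half_vec K la s S
  else 0.
  rewrite /half_vec /transpose_vec (actDr (rep la)) !(actZr (rep la)) !hE //.
  (* Of the two basis vectors in a half vector, [h] can only see the one whose tableau is plus. *)
  have -> : (tr_tab U == T) = false.
    by apply: contraTF plusT => /eqP <-; rewrite (is_plus_tr n_ge2 stdU) negbK.
  rewrite !scaler0 addr0 eq_sym; case: eqP => // _.
  by rewrite scalerA.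
rewrite hhalf; case: (T == U); last by rewrite andbF self_transpose0 scaler0 addr0.
rewrite andbT self_transposeZ self_transpose_half_vec //.
have two : 2%:R != 0 :> K by rewrite pnatr_eq0.
(* The factor is ((-1)^s + (-1)^t) / 2: the sign of [s] on its own half, 0 on the other. *)
have [<-|nst] := eqVneq s t.
  rewrite self_transpose_half_vec // !scalerA -scalerDl; congr (_ *: _).
  by field.
rewrite self_transpose0 !scalerA -scalerDl (_ : _ + _ = 0) ?scale0r //.
by case: (s) (t) nst => -[] //= _; field.
Qed.

End AltUnits.

(** * The list of irreducible modules *)

Section Family.
Context (K : numClosedFieldType) (n : nat) (q : K) (p r : nat).
Variables (lam : p.-tuple (young n)) (mu : r.-tuple (young n)).
Hypothesis n_ge2 : (2 <= n)%N.
Hypothesis q_neq0 : q != 0.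
Hypothesis q_not_root : forall k : nat, (1 <= k <= n)%N -> q ^+ k != 1.
Hypothesis lam_uniq : uniq (lam ++ map (@tr_young n) lam).
Hypothesis lam_enum : forall la : young n,
  (la \in lam ++ map (@tr_young n) lam) = (tr_young la != la).
Hypothesis mu_uniq : uniq mu.
Hypothesis mu_enum : forall la : young n, (la \in mu) = (tr_young la == la).
Local Notation v := (tab_vec K).
Local Notation alt := (alt_hecke n q).

Let rep la : representation (pi_rep q la) := pi_rep_representation q_neq0 q_not_root la.

Definition family_index : finType := ('I_p + 'I_r * bool)%type.

Definition family_basis (x : family_index) : finType :=
  match x with
  | inl i => stab (tnth lam i)
  | inr (j, _) => {T : stab (tnth mu j) | is_plus (val T)}
  end.

Definition family_vec (x : family_index) :
    family_basis x -> act_space (alt_family q lam mu x) :=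
  match x with
  | inl i => fun T : stab (tnth lam i) => v (tnth lam i) (val T)
  | inr (j, s) => fun T : {T : stab (tnth mu j) | is_plus (val T)} =>
      vsproj (half_space K s (tnth mu j)) (half_vec K (tnth mu j) s (val (val T)))
  end.

Lemma tr_lam i : tr_young (tnth lam i) <> tnth lam i.
Proof. by apply/eqP; rewrite -lam_enum mem_cat mem_tnth. Qed.

Lemma tr_mu j : tr_young (tnth mu j) = tnth mu j.
Proof. by apply/eqP; rewrite -mu_enum mem_tnth. Qed.

Lemma lam_inj i k : i <> k -> tnth lam k <> tnth lam i.
Proof.
move=> nik e; apply: nik; apply/esym/eqP; rewrite -(inj_eq val_inj) /=.
move: lam_uniq; rewrite cat_uniq => /andP[uniq_lam _].
have x0 := tnth lam i; move: e; rewrite !(tnth_nth x0) => /eqP.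
by rewrite nth_uniq ?size_tuple.
Qed.

Lemma lam_tr_neq i k : tr_young (tnth lam k) <> tnth lam i.
Proof.
move=> e; move: lam_uniq; rewrite cat_uniq => /and3P[_ /hasPn + _].
move=> /(_ (tr_young (tnth lam k))); rewrite map_f ?mem_tnth // => /(_ isT).
by rewrite /= e mem_tnth.
Qed.

Lemma mu_inj j k : j <> k -> tnth mu k <> tnth mu j.
Proof.
move=> nik e; apply: nik; apply/esym/eqP; rewrite -(inj_eq val_inj) /=.
have x0 := tnth mu j; move: e; rewrite !(tnth_nth x0) => /eqP.
by rewrite nth_uniq ?size_tuple.
Qed.

Lemma lam_neq_mu i j : tnth lam i <> tnth mu j.
Proof. by move=> e; apply: (@tr_lam i); rewrite e tr_mu. Qed.

Lemma half_action j s (a : alt) (T : family_basis (inr (j, s))) :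
  alt_family q lam mu (inr (j, s)) a (family_vec T) =
  vsproj _ (pi_rep q (tnth mu j) (val a) (half_vec K (tnth mu j) s (val (val T)))).
Proof. by rewrite /= vsprojK //; apply: half_vec_in (valP (val T)) (valP T). Qed.

Lemma family_representation x : representation (alt_family q lam mu x).
Proof.
have tilde (la : young n) : representation (tilde_pi q la).
  exact: restrict_representation (rep la).
case: x => [i|[j s]] //=; apply: subspace_representation => [|a w].
  exact: (tilde (tnth mu j)).
exact: (half_space_stable n_ge2 q_neq0 q_not_root (tr_mu j)).
Qed.

Lemma family_basis_inhabited x : family_basis x.
Proof.
have n_gt0 : (0 < n)%N by apply: ltnW.
suff : exists T : family_basis x, True by move=> /cid[T _].
case: x => [i|[j s]] /=.
  by have [T stdT] := stab_exists (tnth lam i) n_gt0; exists (Sub T stdT).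
have [T stdT] := stab_exists (tnth mu j) n_gt0.
have [T' stdT' plusT'] : exists2 T', is_standard (tnth mu j) T' & is_plus T'.
  case: (boolP (is_plus T)) => plusT; first by exists T.
  exists (tr_tab T); first exact: (self_std (tr_mu j)).
  by rewrite (is_plus_tr n_ge2 stdT).
by unshelve eexists (Sub (Sub T' stdT' : stab (tnth mu j)) _).
Qed.

Lemma tab_vec_neq0 la (T : tableau n) : is_standard la T -> v la T != 0.
Proof.
move=> stdT; apply/eqP => /ffunP/(_ (Sub T stdT : stab la)).
by rewrite !ffunE eqxx => /eqP; rewrite oner_eq0.
Qed.

Lemma half_vec_neq0 la s (T : tableau n) : is_standard la T -> is_plus T ->
  half_vec K la s T != 0.
Proof.
move=> stdT plusT; apply/eqP => /ffunP/(_ (Sub T stdT : stab la)).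
rewrite !ffunE /= eqxx; case: eqP => [e|_].
  by have := is_plus_tr n_ge2 stdT; rewrite -e plusT.
rewrite /GRing.scale /= !mulr0 addr0 => /eqP; by rewrite oner_eq0.
Qed.

Lemma family_vec_neq0 x i : family_vec (x := x) i != 0.
Proof.
case: x i => [i|[j s]] T /=; first exact/tab_vec_neq0/(valP T).
have stdT := valP (val T); have plusT := valP T.
apply/eqP => e; have /eqP := half_vec_neq0 s stdT plusT; apply.
have := congr1 vsval e; rewrite vsprojK ?linear0 //.
exact: half_vec_in.
Qed.

Lemma family_span x (w : act_space (alt_family q lam mu x)) :
  exists c : family_basis x -> K, w = \sum_i c i *: family_vec i.
Proof.
case: x w => [i|[j s]] /= w; first by exists w; apply: tab_vecE.
have [c wE] := half_space_span (subvsP w).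
exists (fun T => c (val T)); rewrite -[w]vsvalK wE.
have -> : \sum_(T : stab (tnth mu j) | is_plus (val T)) c T *: half_vec K (tnth mu j) s (val T) =
   \sum_(T : {T : stab (tnth mu j) | is_plus (val T)}) c (val T) *: half_vec K (tnth mu j) s
     (val (val T)).
  rewrite (reindex_omap (val : {T : stab (tnth mu j) | is_plus (val T)} -> _) insub) => [|T
    plusT].
    by apply: eq_bigl => T; rewrite valK eqxx andbT (valP T).
  by rewrite insubT.
by rewrite linear_sum; apply: eq_bigr => T _; rewrite linearZ.
Qed.

Lemma family_unit x (i j : family_basis x) : exists e : alt,
  (forall k : family_basis x, alt_family q lam mu x e (family_vec k) =
     if j == k then family_vec i else 0) /\
  (forall y (k : family_basis y), x <> y -> alt_family q lam mu y e (family_vec k) = 0).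
Proof.
have half0 la' j' s' (T : {T : stab (tnth mu j') | is_plus (val T)}) (e : alt) : la' = tnth mu
  j' ->
    (forall w, pi_rep q (tnth mu j') (val e) w = 0) ->
    alt_family q lam mu (inr (j', s')) e (family_vec (x := inr (j', s')) T) = 0.
  by move=> _ e0; rewrite half_action e0 linear0.
case: x i j => [i0|[j0 s0]] S T.
  have [e [eE e0]] := alt_unit_full n_ge2 q_neq0 q_not_root (valP T) (valP S) (@tr_lam i0).
  exists e; split=> [U|[i1|[j1 s1]] U nx].
  - by have := eE (val U) (valP U); rewrite val_eqE; apply.
  - by apply: e0; [apply: lam_inj => e1; apply: nx; rewrite e1 | apply: lam_tr_neq].
  - apply: half0 (erefl _) _ => w; apply: e0; last rewrite tr_mu.
      by move=> e1; apply: (@lam_neq_mu i0 j1).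
    by move=> e1; apply: (@lam_neq_mu i0 j1).
have [e [eE e0]] := alt_unit_half n_ge2 q_neq0 q_not_root s0 (valP (val T)) (valP (val S))
  (valP T) (valP S) (tr_mu j0).
exists e; split=> [U|[i1|[j1 s1]] U nx].
- rewrite half_action eE; [|exact: (valP (val U))|exact: (valP U)].
  by rewrite eqxx /= !val_eqE; case: eqP => _ //; rewrite linear0.
- by apply: e0; apply: lam_neq_mu.
have [ej|/eqP nj] := eqVneq j0 j1; last first.
  by apply: half0 (erefl _) _ => w; apply: e0; apply: mu_inj.
subst j1; have ns : s0 != s1 by apply/eqP => es; apply: nx; rewrite es.
rewrite half_action eE; [|exact: (valP (val U))|exact: (valP U)].
by rewrite (negPf ns) linear0.
Qed.

(** The list omits the transposes of the [lam], but an element of the subalgebra that kills a module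
    also kills its transpose, as it commutes with J. On a self-conjugate shape the two halves give
    the plus tableaux, and J gives the others. *)
Lemma family_faithful (a : alt) :
  (forall x (k : family_basis x), alt_family q lam mu x a (family_vec k) = 0) -> a = 0.
Proof.
move=> a0; apply: val_inj; apply: (hecke_faithful (ltnW n_ge2) q_neq0 q_not_root) => la T stdT.
have lam0 i w : pi_rep q (tnth lam i) (val a) w = 0.
  by move: w; apply: (act_eq0 q_neq0 q_not_root) => U stdU; apply: (a0 (inl i) (Sub U stdU)).
case: (boolP (la \in mu)) => [/tnthP[j laE]|].
  subst la.
  have half0 s U : is_standard (tnth mu j) U -> is_plus U ->
      pi_rep q (tnth mu j) (val a) (half_vec K (tnth mu j) s U) = 0.
    move=> stdU plusU.
    have := a0 (inr (j, s)) (Sub (Sub U stdU : stab (tnth mu j)) plusU).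
    rewrite half_action => /(congr1 vsval); rewrite vsprojK ?linear0 //.
    apply: (half_space_stable n_ge2 q_neq0 q_not_root (tr_mu j)).
    exact: half_vec_in.
  have two : 2%:R != 0 :> K by rewrite pnatr_eq0.
  have plus0 U : is_standard (tnth mu j) U -> is_plus U ->
      pi_rep q (tnth mu j) (val a) (v (tnth mu j) U) = 0.
    move=> stdU plusU; have -> : v (tnth mu j) U = 2%:R^-1 *:
        (half_vec K (tnth mu j) false U + half_vec K (tnth mu j) true U).
      rewrite /half_vec expr0 expr1 scale1r scaleN1r addrACA subrr addr0.
      by rewrite -mulr2n -scaler_nat scalerA mulVf // scale1r.
    by rewrite (actZr (rep _)) (actDr (rep _)) !half0 // addr0 scaler0.
  case: (boolP (is_plus T)) => plusT; first exact: plus0.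
  have stdT' := self_std (tr_mu j) stdT.
  have plusT' : is_plus (tr_tab T) by rewrite (is_plus_tr n_ge2 stdT).
  have := transpose_map_alt n_ge2 q_neq0 q_not_root (esym (tr_mu j)) (v (tnth mu j) (tr_tab T)).
  move=> /(_ (val a)); rewrite plus0 // transpose_map0 transpose_map_vec // tr_tabK.
  rewrite (actZr (rep _)) => /(_ (in_subalg_val a))/eqP.
  by rewrite scaler_eq0 signr_eq0 /= => /eqP.
rewrite mu_enum -lam_enum mem_cat => /orP[/tnthP[i ->] //|/mapP[la' /tnthP[i ->] laE]].
have stdT' : is_standard (tnth lam i) (tr_tab T).
  by rewrite -[tnth lam i]tr_youngK -laE; apply: tr_std.
have := transpose_map_alt n_ge2 q_neq0 q_not_root laE (v (tnth lam i) (tr_tab T)).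
move=> /(_ (val a)); rewrite lam0 transpose_map0 transpose_map_vec // tr_tabK.
rewrite (actZr (rep _)) => /(_ (in_subalg_val a))/eqP.
by rewrite scaler_eq0 signr_eq0 /= => /eqP.
Qed.

Definition alt_unit x (i j : family_basis x) : alt := projT1 (cid (family_unit i j)).

Lemma alt_unit_same x i j k : alt_family q lam mu x (@alt_unit x i j) (family_vec k) =
  if j == k then family_vec i else 0.
Proof. by rewrite /alt_unit; case: cid => e []. Qed.

Lemma alt_unit_other x y i j k : x <> y ->
  alt_family q lam mu y (@alt_unit x i j) (@family_vec y k) = 0.
Proof. by rewrite /alt_unit; case: cid => e /= [_ h]; apply: h. Qed.

Theorem alt_irreducible_family :
  [/\ forall x, irreducible (alt_family q lam mu x),
      forall x y, x <> y -> ~ equivalent (alt_family q lam mu x) (alt_family q lam mu y),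
      forall X : action alt, irreducible X -> exists x, equivalent X (alt_family q lam mu x)
    & semisimple_algebra alt].
Proof.
split.
- exact: (units_irreducible family_representation family_basis_inhabited family_vec_neq0
    family_span alt_unit_same).
- exact: (units_inequivalent family_representation family_basis_inhabited family_vec_neq0
    family_span alt_unit_same alt_unit_other).
- exact: (units_complete family_representation family_vec_neq0
    family_span alt_unit_same alt_unit_other family_faithful).
- exact: (units_semisimple family_representation family_vec_neq0
    family_span alt_unit_same alt_unit_other family_faithful).
Qed.

End Family.

(** The first group of clauses certifies the encoding: an [action] carries no laws of its own, and
    [subspace_action] restricts an action only where the subspace is stable. *)
Theorem theorem6p5 (R : realType) (n : nat) (q : R[i]) (p r : nat)
    (lam : p.-tuple (young n)) (mu : r.-tuple (young n))
    (n_ge2 : (2 <= n)%N) (q_neq0 : q != 0)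
    (q_not_root : forall k : nat, (1 <= k <= n)%N -> q ^+ k != 1)
    (lam_uniq : uniq (lam ++ map (@tr_young n) lam))
    (lam_enum : forall la : young n,
       (la \in lam ++ map (@tr_young n) lam) = (tr_young la != la))
    (mu_uniq : uniq mu)
    (mu_enum : forall la : young n, (la \in mu) = (tr_young la == la)) :
  [/\ forall la : young n, representation (pi_rep q la),
      forall (la : young n) (i : 'I_n.-1) (T : stab la),
        pi_rep q la (hecke_gen q i) (tab_vec R[i] la (val T)) =
          seminormal_image q la i (val T),
      forall (j : 'I_r) (s : bool),
        submodule (X := tilde_pi q (tnth mu j))
          [set v | v \in half_space R[i] s (tnth mu j)]%classic
    & forall j : 'I_r,
        (half_space R[i] false (tnth mu j) :&:
         half_space R[i] true (tnth mu j) = 0)%VS /\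
        (half_space R[i] false (tnth mu j) +
         half_space R[i] true (tnth mu j) = fullv)%VS]
  /\
  [/\ forall x, irreducible (alt_family q lam mu x),
      forall x y, x <> y ->
        ~ equivalent (alt_family q lam mu x) (alt_family q lam mu y),
      forall X : action (alt_hecke n q), irreducible X ->
        exists x, equivalent X (alt_family q lam mu x)
    & semisimple_algebra (alt_hecke n q)].
Proof.
split; last exact: alt_irreducible_family.
split.
- exact: pi_rep_representation.
- by move=> la i T; rewrite pi_rep_gen // seminormal_gen_vec.
- move=> j s; split=> /= [|c u w|a w].
  + exact: mem0v.
  + by move=> uU wU; apply: memvD => //; apply: memvZ.
  + exact: (half_space_stable n_ge2 q_neq0 q_not_root (tr_mu mu_enum j)).
- by move=> j; split; [apply: half_space_cap | apply: half_space_sum]; rewrite ?(tr_mu mu_enum).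
Qed.
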